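(* Let $U_1$ be a random variable with p.d.f. $f_1(u)=1$ for $0<u<1$ and zero otherwise, and let $U_2$ be another random variable with p.d.f. $f_2(u)=2(1-u)$ for $0<u<1$ and zero otherwise. Suppose that $X\overset{d}{=}\hat S_2/2$ has the hyperbolic sinh-distribution with p.d.f. $$f_X(x)=\frac{\pi[\pi x\coth(\pi x)-1]}{\sinh^2(\pi x)},\quad x\in\mathbb{R}.$$ Then the Hurwitz zeta function $\zeta(s,a)$ has the integral representation $$(s-1)\zeta(s,a)=\tfrac12 E\big[(a-1+U_2+iX)^{-s}\big]+(a-1)E\big[(U_1+iX)^{-s}\big],\quad a\ge 1,\ s\in\mathbb{C}.$$ In particular, when $a=1$, $$(s-1)\zeta(s)=\tfrac12E\big[(U_2+iX)^{-s}\big],\quad s\in\mathbb{C}.$$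
   Context: $\zeta(s,a)$ is the Hurwitz zeta function, defined by $\zeta(s,a)=\sum_{n=0}^\infty (n+a)^{-s}$ for $\mathrm{Re}(s)>1$, $a>0$, and extended to all complex $s\ne 1$; it has a simple pole at $s=1$ with residue $1$, so $\lim_{s\to1}(s-1)\zeta(s,a)=1$. $\zeta(s)=\zeta(s,1)$ is the Riemann zeta function. $\hat S_2$ denotes a random variable with characteristic function $E(e^{i\theta\hat S_2})=(\theta/\sinh\theta)^2$, $\theta\in\mathbb{R}$; thus $E(e^{i\theta X})=\big(\frac{\theta/2}{\sinh(\theta/2)}\big)^2$. $X$ is taken independent of $U_1$ and of $U_2$. The identity is extended to all $s\in\mathbb{C}$ by analytic continuation.
   Formalization: The second expectation is E[(a-1+U_1+iX)^{-s}] instead of the printed E[(U_1+iX)^{-s}], which is false for a>1 (at s=-1, a=2 it gives 7/6, not 13/6); for a=1 and Re s≥2, where the expectation diverges, the right side means its analytic continuation. *)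

(* Defs.v *)
From HB Require Import structures.
From mathcomp Require Import all_boot all_order all_algebra.
From mathcomp Require Import complex.
From mathcomp Require Import all_classical all_reals all_analysis.

Set Implicit Arguments.
Unset Strict Implicit.
Unset Printing Implicit Defensive.
Import Order.TTheory GRing.Theory Num.Theory.
Import numFieldNormedType.Exports.
Local Open Scope classical_set_scope.
Local Open Scope ring_scope.
Local Open Scope complex_scope.

(* The complex field over [R], with the topology given by the modulus (which
   MathComp-Analysis only puts on the regular algebra [R[i]^o]). *)
Definition Cplx (R : realType) : normedModType R[i] := R[i]^o.

Definition sinh (R : realType) (x : R) : R := (expR x - expR (- x)) / 2.
Definition cosh (R : realType) (x : R) : R := (expR x + expR (- x)) / 2.
Definition coth (R : realType) (x : R) : R := cosh x / sinh x.

Definition cexp (R : realType) (z : R[i]) : R[i] :=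
  (expR (complex.Re z))%:C * (cos (complex.Im z) +i* sin (complex.Im z)).

(* Principal argument, with values in ]-pi, pi]. *)
Definition carg (R : realType) (z : R[i]) : R :=
  let t := acos (complex.Re z / complex.Re `|z|) in
  if 0 <= complex.Im z then t else - t.

Definition clog (R : realType) (z : R[i]) : R[i] :=
  ln (complex.Re `|z|) +i* carg z.

(* Principal branch of [z ^ w]. *)
Definition cpow (R : realType) (z w : R[i]) : R[i] :=
  if z == 0 then (w == 0)%:R else cexp (w * clog z).

Definition analytic_at (R : realType) (f : R[i] -> R[i]) (z0 : R[i]) : Prop :=
  exists2 r : R, 0 < r & exists c : nat -> R[i], forall z : R[i],
    `|z - z0| < r%:C ->
    series (fun n => c n * (z - z0) ^+ n : Cplx R) @ \oo --> (f z : Cplx R).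

(* [g] is an analytic function on [A] extending [f], given on [D]. *)
Definition analytic_continuation (R : realType) (A D : set R[i])
    (f g : R[i] -> R[i]) : Prop :=
  (forall z, A z -> analytic_at g z) /\ (forall z, D z -> g z = f z).

Definition hurwitz_series (R : realType) (a : R) (s : R[i]) : R[i] :=
  limn (series (fun n => cpow (n%:R + a)%:C (- s) : Cplx R)).

(* The analytic continuation to the plane without 1 (unique there); the value
   at the pole [s = 1] is not specified. *)
Definition hurwitz_zeta (R : realType) (a : R) : R[i] -> R[i] :=
  xget (fun=> 0) [set f | analytic_continuation
    [set s | s != 1] [set s | 1 < complex.Re s] (hurwitz_series a) f].

Definition riemann_zeta (R : realType) : R[i] -> R[i] := hurwitz_zeta (1 : R).

Section probability.
Context d (T : measurableType d) (R : realType) (P : probability T R).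

Definition has_pdf (X : {RV P >-> R}) (f : R -> R) : Prop :=
  forall A : set R, measurable A ->
    distribution P X A = (\int[lebesgue_measure]_(x in A) (f x)%:E)%E.

Definition independent_RV (X Y : {RV P >-> R}) : Prop :=
  forall A B : set R, measurable A -> measurable B ->
    P (X @^-1` A `&` Y @^-1` B) = (P (X @^-1` A) * P (Y @^-1` B))%E.

Definition cintegrable (Z : T -> R[i]) : Prop :=
  P.-integrable setT (fun w => (complex.Re (Z w))%:E) /\
  P.-integrable setT (fun w => (complex.Im (Z w))%:E).

Definition cexpectation (Z : T -> R[i]) : R[i] :=
  fine 'E_P[fun w => complex.Re (Z w)] +i* fine 'E_P[fun w => complex.Im (Z w)].

Definition char_fun (X : {RV P >-> R}) (theta : R) : R[i] :=
  cexpectation (fun w => cexp (0 +i* (theta * X w))).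

End probability.

Definition same_law d d' (T : measurableType d) (T' : measurableType d')
    (R : realType) (P : probability T R) (P' : probability T' R)
    (X : T -> R) (Y : T' -> R) : Prop :=
  forall A : set R, measurable A -> P (X @^-1` A) = P' (Y @^-1` A).

Definition pdf_U1 (R : realType) (u : R) : R :=
  if (0 < u) && (u < 1) then 1 else 0.

Definition pdf_U2 (R : realType) (u : R) : R :=
  if (0 < u) && (u < 1) then 2 * (1 - u) else 0.

(* The quotient is junk at the single point [x = 0], a removable singularity
   of the density. *)
Definition pdf_sinh (R : realType) (x : R) : R :=
  pi * (pi * x * coth (pi * x) - 1) / sinh (pi * x) ^+ 2.

(* (theta / sinh theta)^2, with its value 1 at 0 made explicit. *)
Definition charS2 (R : realType) (theta : R) : R :=
  if theta == 0 then 1 else (theta / sinh theta) ^+ 2.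

(* Main.v *)
Require Import Defs.
From HB Require Import structures.
From mathcomp Require Import all_boot all_order all_algebra.
From mathcomp Require Import complex.
From mathcomp Require Import all_classical all_reals all_analysis.
From mathcomp Require Import measurable_realfun.
From mathcomp Require Import ring lra.

Set Implicit Arguments.
Unset Strict Implicit.
Unset Printing Implicit Defensive.
Import Order.TTheory GRing.Theory Num.Theory.
Import numFieldNormedType.Exports.
Local Open Scope classical_set_scope.
Local Open Scope ring_scope.
Local Open Scope complex_scope.

(** Write [R_a(s)] for the right-hand side
    [1/2 E (a - 1 + U2 + iX)^-s + (a - 1) E (U1 + a - 1 + iX)^-s].  Everything
    rests on the difference equation [R_a(s) - R_(a+1)(s) = (s - 1) a^-s]
    ([rhsE_difference]).  For [1 < Re s] the expectations at [a + N] tend to 0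
    as [N] grows, since the real part of the random variable is at least
    [a + N - 1] ([rhsE_cvg0]); summing the difference equation over
    [a, a + 1, ...] therefore gives [(s - 1) zeta(s, a) = R_a(s)] there.

    The difference equation is first proved for real [s = p + 1] in ]1, 2[
    ([rhsE_difference_real]).  Euler's integral
    [z^-(p+1) = Gamma(p+1)^-1 int_0^oo t^p e^(-tz) dt] ([gammaI_cpow]) turns
    [R_a] into [int_0^oo t^p rho_a(t) dt] up to the factor [Gamma(p+1)], where
    [rho_a(t) = phi(t) e^(-(a-1)t) (M2(t)/2 + (a - 1) M1(t))], [phi] is the
    characteristic function of [X] and [M1], [M2] are the Laplace transforms of
    [U1], [U2] ([gammaI_expect_pow]).  All three are explicit in
    [q = e^-t]: [phi = t^2 q / (1 - q)^2], [M1 = (1 - q) / t],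
    [M2 = 2 (t - 1 + q) / t^2].  They combine into
    [rho_a - rho_(a+1) = e^(-at) (at - 1)] ([kernel_difference]), and the
    integral of [t^p e^(-at) (at - 1)] is [p Gamma(p+1) a^-(p+1)] by the
    functional equation of Gamma ([gammaI_rec]).

    Analyticity carries the identities to complex [s].  An expectation
    [E exp(s L)] is analytic wherever it is dominated near [s], by termwise
    integration of the exponential series ([cint_cexp_analytic]); the moments of
    [|a - 1 + U + iX|] ([moment]) supply the domination, for every [s] if
    [1 < a] and for [Re s < 2] if [a = 1].  Hence
    [(s - 1) a^-s + R_(a+1)(s)] is entire and extends [R_a] ([rhs_entire]).
    Dividing it by [s - 1] exhibits an analytic continuation of the series
    defining [zeta(s, a)], and the identity theorem along segments avoiding 1
    ([analytic_segment]) shows that every continuation is that quotient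
    ([hurwitz_zeta_rhs_entire]); the limit at 1 is continuity of the entire
    function. *)

(** * Moduli and power series in the complex field *)

Section modulus.
Context {R : realType}.
Implicit Types z w : R[i].

(** The norm of [R[i]] is [R[i]]-valued; this is the same modulus as an element
    of [R], so that estimates take place in a totally ordered field. *)
Definition cabs z : R := complex.Re `|z|.

Lemma cabsE z : `|z| = (cabs z)%:C.
Proof. by rewrite /cabs normc_def. Qed.

Lemma cabs_sqrt z :
  cabs z = Num.sqrt (complex.Re z ^+ 2 + complex.Im z ^+ 2).
Proof. by rewrite /cabs normc_def. Qed.

Lemma cabs_ge0 z : 0 <= cabs z.
Proof. by rewrite -lecR -cabsE normr_ge0. Qed.

Lemma cabsM z w : cabs (z * w) = cabs z * cabs w.
Proof. by apply: complexI; rewrite rmorphM/= -!cabsE normrM. Qed.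

Lemma cabsX z n : cabs (z ^+ n) = cabs z ^+ n.
Proof. by apply: complexI; rewrite rmorphXn/= -!cabsE normrX. Qed.

Lemma cabsN z : cabs (- z) = cabs z.
Proof. by rewrite /cabs normrN. Qed.

Lemma cabsD z w : cabs (z + w) <= cabs z + cabs w.
Proof. by rewrite -lecR rmorphD/= -!cabsE ler_normD. Qed.

Lemma cabsBC z w : cabs (z - w) = cabs (w - z).
Proof. by rewrite /cabs distrC. Qed.

Lemma cabs_eq0 z : (cabs z == 0) = (z == 0).
Proof. by rewrite -(inj_eq (@complexI R)) -cabsE normr_eq0. Qed.

Lemma cabs0 : cabs 0 = 0. Proof. by apply/eqP; rewrite cabs_eq0. Qed.

Lemma cabs_gt0 z : (0 < cabs z) = (z != 0).
Proof. by rewrite lt_def cabs_eq0 cabs_ge0 andbT. Qed.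

Lemma cabs_real (x : R) : cabs x%:C = `|x|.
Proof. by rewrite cabs_sqrt/= expr0n addr0 sqrtr_sqr. Qed.

Lemma cabsV z : cabs z^-1 = (cabs z)^-1.
Proof. by apply: complexI; rewrite -cabsE normfV cabsE fmorphV. Qed.

Lemma cabs_Re z : `|complex.Re z| <= cabs z.
Proof.
by rewrite cabs_sqrt -sqrtr_sqr ler_wsqrtr// lerDl sqr_ge0.
Qed.

Lemma cabs_Im z : `|complex.Im z| <= cabs z.
Proof.
by rewrite cabs_sqrt -sqrtr_sqr ler_wsqrtr// lerDr sqr_ge0.
Qed.

Lemma cabs_le z : cabs z <= `|complex.Re z| + `|complex.Im z|.
Proof.
rewrite cabs_sqrt -[leRHS]ger0_norm ?addr_ge0// -sqrtr_sqr ler_wsqrtr//.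
rewrite sqrrD !real_normK ?num_real// addrAC lerDl.
by rewrite mulrn_wge0// mulr_ge0.
Qed.

Lemma cabs_sum (I : Type) (r : seq I) (P : pred I) (F : I -> R[i]) :
  cabs (\sum_(i <- r | P i) F i) <= \sum_(i <- r | P i) cabs (F i).
Proof.
elim/big_rec2: _ => [|i y1 y2 _ ih]; first by rewrite cabs0.
by rewrite (le_trans (cabsD _ _))// lerD2l.
Qed.

Lemma cabsB z w : cabs z - cabs w <= cabs (z - w).
Proof. by rewrite lerBlDr -{1}(subrK w z) cabsD. Qed.

Lemma complex_eqE z w :
  complex.Re z = complex.Re w -> complex.Im z = complex.Im w -> z = w.
Proof. by case: z w => [a b] [c d] /= -> ->. Qed.

Lemma Re_mul z w : complex.Re (z * w) =
  complex.Re z * complex.Re w - complex.Im z * complex.Im w.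
Proof. by case: z w => [a b] [c d]. Qed.

Lemma Im_mul z w : complex.Im (z * w) =
  complex.Re z * complex.Im w + complex.Im z * complex.Re w.
Proof. by case: z w => [a b] [c d]. Qed.

Lemma Re_sub z w : complex.Re (z - w) = complex.Re z - complex.Re w.
Proof. by rewrite raddfB. Qed.
Lemma Im_sub z w : complex.Im (z - w) = complex.Im z - complex.Im w.
Proof. by rewrite raddfB. Qed.
Lemma Re_add z w : complex.Re (z + w) = complex.Re z + complex.Re w.
Proof. by rewrite raddfD. Qed.
Lemma Im_add z w : complex.Im (z + w) = complex.Im z + complex.Im w.
Proof. by rewrite raddfD. Qed.
Lemma Re_opp z : complex.Re (- z) = - complex.Re z.
Proof. by rewrite raddfN. Qed.
Lemma cexpD z w : cexp (z + w) = cexp z * cexp w.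
Proof.
case: z w => [a b] [c d]; rewrite /cexp/= expRD cosD sinD.
by apply: complex_eqE; rewrite !(Re_mul,Im_mul)/=; ring.
Qed.

Lemma cexp0 : cexp 0 = 1 :> R[i].
Proof. by rewrite /cexp/= expR0 cos0 sin0 mul1r. Qed.

Lemma cexpN z : cexp (- z) * cexp z = 1.
Proof. by rewrite -cexpD addNr cexp0. Qed.

Lemma Re_cexp z :
  complex.Re (cexp z) = expR (complex.Re z) * cos (complex.Im z).
Proof. by rewrite /cexp Re_mul/= mul0r subr0. Qed.

Lemma Im_cexp z :
  complex.Im (cexp z) = expR (complex.Re z) * sin (complex.Im z).
Proof. by rewrite /cexp Im_mul/= mul0r addr0. Qed.

Lemma cabs_cexp z : cabs (cexp z) = expR (complex.Re z).
Proof.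
rewrite /cexp cabsM cabs_real ger0_norm ?expR_ge0//.
by rewrite (cabs_sqrt (_ +i* _))/= cos2Dsin2 sqrtr1 mulr1.
Qed.

Lemma cexp_real (x : R) : cexp x%:C = (expR x)%:C.
Proof. by rewrite /cexp/= cos0 sin0 mulr1. Qed.

(** Convergence in the complex plane becomes convergence of a real sequence to 0,
    the form in which all limits below are stated. *)
Lemma Cplx_cvgP (T : Type) (F : set_system T) {FF : Filter F}
    (f : T -> R[i]) (l : R[i]) :
  ((f x : Cplx R) @[x --> F] --> (l : Cplx R)) <->
  (cabs (f x - l) @[x --> F] --> (0 : R)).
Proof.
split=> [/cvgrPdist_lt fl|/cvgrPdist_lt fl].
  apply/cvgrPdist_lt => e e0.
  have e0' : (0 : R[i]) < e%:C by rewrite ltcR.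
  apply: filterS (fl _ e0') => x.
  move=> h; rewrite sub0r normrN (ger0_norm (cabs_ge0 _)) cabsBC -ltcR -cabsE.
  exact: h.
apply/cvgrPdist_lt => e e0.
have [eI eR] : complex.Im e = 0 /\ 0 < complex.Re e.
  by move: e0; rewrite ltcE => /andP[/eqP ->].
have -> : e = (complex.Re e)%:C by apply: complex_eqE.
apply: filterS (fl _ eR) => x.
rewrite sub0r normrN (ger0_norm (cabs_ge0 _)) cabsBC -ltcR -cabsE => h.
exact: h.
Qed.

Lemma cvg_Re_Im (T : Type) (F : set_system T) {FF : Filter F}
    (f : T -> R[i]) (l : R[i]) :
  complex.Re (f x) @[x --> F] --> complex.Re l ->
  complex.Im (f x) @[x --> F] --> complex.Im l ->
  cabs (f x - l) @[x --> F] --> (0 : R).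
Proof.
move=> fr fi.
have : `|complex.Re (f x) - complex.Re l| + `|complex.Im (f x) - complex.Im l|
    @[x --> F] --> (0 : R).
  rewrite -[0 in X in _ --> X]addr0; apply: cvgD.
    rewrite -(normr0 R) -(subrr (complex.Re l)).
    by apply: cvg_norm; apply: cvgB => //; exact: cvg_cst.
  rewrite -(normr0 R) -(subrr (complex.Im l)).
  by apply: cvg_norm; apply: cvgB => //; exact: cvg_cst.
apply: squeeze_cvgr; last exact: cvg_cst.
by near=> x; rewrite cabs_ge0/= (le_trans (cabs_le _))// Re_sub Im_sub.
Unshelve. all: by end_near. Qed.

Lemma cvg_cabs_Re (T : Type) (F : set_system T) {FF : Filter F}
    (f : T -> R[i]) (l : R[i]) :
  cabs (f x - l) @[x --> F] --> (0 : R) ->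
  complex.Re (f x) @[x --> F] --> complex.Re l.
Proof.
move=> /cvgrPdist_lt h; apply/cvgrPdist_lt => e /h.
apply: filterS => x; rewrite sub0r normrN (ger0_norm (cabs_ge0 _)).
by apply: le_lt_trans; rewrite -Re_sub cabsBC cabs_Re.
Qed.

Lemma cvg_cabs_Im (T : Type) (F : set_system T) {FF : Filter F}
    (f : T -> R[i]) (l : R[i]) :
  cabs (f x - l) @[x --> F] --> (0 : R) ->
  complex.Im (f x) @[x --> F] --> complex.Im l.
Proof.
move=> /cvgrPdist_lt h; apply/cvgrPdist_lt => e /h.
apply: filterS => x; rewrite sub0r normrN (ger0_norm (cabs_ge0 _)).
by apply: le_lt_trans; rewrite -Im_sub cabsBC cabs_Im.
Qed.

Lemma cvg_cabs0_le (T : Type) (F : set_system T) {FF : Filter F}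
    (f : T -> R[i]) (g : T -> R) :
  (\forall x \near F, cabs (f x) <= g x) -> g x @[x --> F] --> (0 : R) ->
  cabs (f x) @[x --> F] --> (0 : R).
Proof.
move=> fg g0; apply: squeeze_cvgr (cvg_cst 0) g0.
by apply: filterS fg => x ->; rewrite cabs_ge0.
Qed.

Definition psum (c : nat -> R[i]) (w : R[i]) (N : nat) : R[i] :=
  \sum_(0 <= n < N) c n * w ^+ n.

Definition psums_to (c : nat -> R[i]) (w f : R[i]) : Prop :=
  cabs (psum c w N - f) @[N --> \oo] --> (0 : R).

Lemma analytic_atP (f : R[i] -> R[i]) (z0 : R[i]) :
  analytic_at f z0 <-> exists2 r : R, 0 < r & exists c, forall w,
    cabs w < r -> psums_to c w (f (z0 + w)).
Proof.
split=> -[r r0 [c fc]]; exists r => //; exists c.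
  move=> w wr; apply/(@Cplx_cvgP nat \oo _ (psum c w)).
  have := fc (z0 + w); rewrite addrAC subrr add0r cabsE ltcR; exact.
move=> z zr; have wr : cabs (z - z0) < r by rewrite -ltcR -cabsE.
have /(@Cplx_cvgP nat \oo _ (psum c (z - z0))) := fc _ wr.
by rewrite addrCA subrr addr0.
Qed.

Lemma psum_recr c w N : psum c w N.+1 = psum c w N + c N * w ^+ N.
Proof. by rewrite /psum big_nat_recr. Qed.

Lemma psums_to_le c w f e : psums_to c w f -> 0 < e ->
  \forall N \near \oo, cabs (psum c w N - f) < e.
Proof.
move=> /cvgrPdist_lt cf /cf; apply: filterS => N.
by rewrite sub0r normrN ger0_norm ?cabs_ge0.
Qed.

(** A term is the difference of two partial sums, each close to the limit; only
    boundedness of their distance to the limit matters. *)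
Lemma psums_to_bounded c w f : psums_to c w f ->
  exists2 M, 0 < M & forall n, cabs (c n) * cabs w ^+ n <= M.
Proof.
move=> cf; have : cvgn (fun N => cabs (psum c w N - f)).
  by apply/cvg_ex; exists 0.
move/cvg_seq_bounded => -[B [_ /(_ (`|B| + 1))]].
have -> : B < `|B| + 1 by rewrite (le_lt_trans (ler_norm _))// ltrDl.
move=> /(_ isT) Bn; pose B' := `|B| + 1; exists (B' + B').
  by rewrite addr_gt0// ltr_wpDl.
move=> n; rewrite -cabsX -cabsM.
have -> : c n * w ^+ n = (psum c w n.+1 - f) - (psum c w n - f).
  by rewrite psum_recr opprB addrA subrK addrAC subrr add0r.
rewrite (le_trans (cabsD _ _))// cabsN lerD//.
  by rewrite -[leLHS]ger0_norm ?cabs_ge0//; exact: (Bn n.+1 I).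
by rewrite -[leLHS]ger0_norm ?cabs_ge0//; exact: (Bn n I).
Qed.

(** The hypothesis on the coefficients is of Cauchy type: it makes the series
    geometric with ratio [|w| / rho <= 1/2], whence the factor 2. *)
Lemma power_series_tail c w f M rho m : 0 < rho ->
  (forall n, cabs (c n) * rho ^+ n <= M) -> cabs w <= rho / 2 ->
  psums_to c w f ->
  cabs (f - psum c w m) <= 2 * M * (cabs w / rho) ^+ m.
Proof.
move=> rho0 cM wr cf; set q := cabs w / rho.
have M0 : 0 <= M by rewrite (le_trans _ (cM 0))// mulr_ge0 ?cabs_ge0 ?exprn_ge0 ?ltW.
have q0 : 0 <= q by rewrite divr_ge0 ?cabs_ge0// ltW.
have q2 : q <= 2^-1 by rewrite ler_pdivrMr// mulrC.
have step k : cabs (psum c w (m + k) - psum c w m) + 2 * M * q ^+ (m + k)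
    <= 2 * M * q ^+ m.
  elim: k => [|k ih]; first by rewrite addn0 subrr cabs0 add0r.
  rewrite addnS psum_recr addrAC.
  have h1 : cabs (c (m + k)%N * w ^+ (m + k)) <= M * q ^+ (m + k).
    rewrite cabsM cabsX expr_div_n mulrA ler_pdivlMr ?exprn_gt0//.
    by rewrite mulrAC ler_wpM2r ?exprn_ge0 ?cabs_ge0.
  have h2 : 2 * M * q ^+ (m + k).+1 <= M * q ^+ (m + k).
    rewrite exprSr mulrA; have : 0 <= M * q ^+ (m + k).
      by rewrite mulr_ge0// exprn_ge0.
    by nra.
  apply: le_trans ih; have := cabsD (psum c w (m + k) - psum c w m)
    (c (m + k)%N * w ^+ (m + k)); lra.
apply/ler_addgt0Pr => e e0.
have [N0 _ hN0] := psums_to_le cf e0.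
have /= hN := hN0 (m + N0)%N (leq_addl _ _).
have -> : f - psum c w m = (psum c w (m + N0) - psum c w m) - (psum c w (m + N0) - f).
  by ring.
rewrite (le_trans (cabsD _ _))// cabsN; apply: lerD; last exact: ltW.
apply: le_trans (step N0); rewrite lerDl.
by rewrite mulr_ge0 ?exprn_ge0// mulr_ge0.
Qed.

End modulus.

(** * Analytic functions: tails, zeros, the identity theorem along segments *)

Section analytic.
Context {R : realType}.
Implicit Types (f g h : R[i] -> R[i]) (z w v : R[i]) (c : nat -> R[i]).

(** One constant [M] controls the Taylor remainders of all orders [m]: order 1
    yields continuity, and the arbitrary orders yield the discreteness of zeros. *)
Lemma analytic_tail f z0 : analytic_at f z0 ->
  exists c rho M, [/\ 0 < rho, 0 <= M & forall w m, cabs w <= rho ->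
    psums_to c w (f (z0 + w)) /\
    cabs (f (z0 + w) - psum c w m) <= M * (cabs w / rho) ^+ m].
Proof.
move/analytic_atP => [r r0 [c fc]].
have r20 : 0 < r / 2 by rewrite divr_gt0.
have r2r : r / 2 < r by rewrite ltr_pdivrMr// mulr2n mulrDr mulr1 ltrDr.
have := fc (r / 2)%:C; rewrite cabs_real (gtr0_norm r20) => /(_ r2r).
move=> /psums_to_bounded[M M0]; rewrite cabs_real (gtr0_norm r20) => cM.
exists (fun n => c n), (r / 2 / 2), (2 * M); split.
- by rewrite divr_gt0.
- by rewrite mulr_ge0// ltW.
move=> w m wr.
have wr' : cabs w < r by lra.
split; first exact: fc.
apply: (le_trans (power_series_tail m r20 cM wr (fc _ wr'))).
rewrite ler_wpM2l//; first by rewrite mulr_ge0// ltW.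
rewrite lerXn2r ?nnegrE ?divr_ge0 ?cabs_ge0//; try lra.
rewrite ler_wpM2l ?cabs_ge0// lef_pV2 ?posrE; lra.
Qed.

Lemma analytic_at_tail1 f z0 : analytic_at f z0 ->
  exists rho M, [/\ 0 < rho, 0 <= M & forall w, cabs w <= rho ->
    cabs (f (z0 + w) - f z0) <= M * cabs w].
Proof.
move/analytic_tail => [c [rho [M [rho0 M0 fM]]]].
exists rho, (M / rho); split => //; first by rewrite divr_ge0// ltW.
move=> w wr.
have [|_] := fM 0 1%N; first by rewrite cabs0 ltW.
rewrite cabs0.
rewrite mul0r expr1 mulr0 addr0 /psum big_nat1 expr0 mulr1.
move=> h; have {h} : cabs (f z0 - c 0%N) == 0 by rewrite eq_le h cabs_ge0.
rewrite cabs_eq0 subr_eq0 => /eqP fc.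
have [_] := fM w 1%N wr; rewrite /psum big_nat1 expr0 mulr1 -fc expr1.
by rewrite mulrA mulrAC.
Qed.

Lemma analytic_continuous f z0 : analytic_at f z0 ->
  (f z : Cplx R) @[z --> (z0 : Cplx R)] --> (f z0 : Cplx R).
Proof.
move/analytic_at_tail1 => [rho [M [rho0 M0 fM]]].
apply/(@Cplx_cvgP R (Cplx R) (nbhs (z0 : Cplx R)) _ f (f z0)).
apply/cvgrPdist_lt => e e0.
have d0 : 0 < Num.min rho (e / (M + 1)).
  by rewrite lt_min rho0 divr_gt0// ltr_wpDl.
have d0' : (0 : R[i]) < (Num.min rho (e / (M + 1)))%:C by rewrite ltcR.
have /cvgrPdist_lt/(_ _ d0') : (z : Cplx R) @[z --> (z0 : Cplx R)] --> (z0 : Cplx R).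
  exact: cvg_id.
apply: filterS => z zd.
have {zd} : `|z0 - z| < (Num.min rho (e / (M + 1)))%:C := zd.
rewrite cabsE ltcR lt_min cabsBC => /andP[zr ze].
rewrite sub0r normrN (ger0_norm (cabs_ge0 _)).
rewrite cabsBC in zr; rewrite cabsBC in ze; rewrite cabsBC.
have := fM (z - z0) (ltW zr).
have -> : z0 + (z - z0) = z by ring.
move=> /le_lt_trans; apply.
move: ze; rewrite ltr_pdivlMr ?ltr_wpDl// => ze.
by apply: le_lt_trans ze; rewrite mulrC ler_wpM2l ?cabs_ge0// lerDl.
Qed.

(** [z] is an accumulation point of the zero set of [f]. *)
Definition zeros_at f z := forall e : R, 0 < e ->
  exists2 w, 0 < cabs w < e & f (z + w) = 0.

(** The coefficients vanish inductively: if those below [m] do, the remainder of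
    order [m + 1] at a zero [w] reads [|c m| <= K |w|], and [w] can be taken
    arbitrarily small. *)
Lemma analytic_zeros f z0 : analytic_at f z0 -> zeros_at f z0 ->
  exists2 e : R, 0 < e & forall w, cabs w < e -> f (z0 + w) = 0.
Proof.
move/analytic_tail => [c [rho [M [rho0 M0 fM]]]] f0.
have c0 m : c m = 0.
  elim/ltn_ind: m => m ih; apply/eqP; rewrite -cabs_eq0 eq_le cabs_ge0 andbT.
  apply/ler_addgt0Pr => e e0; rewrite add0r.
  have K0 : 0 <= M / rho ^+ m.+1 by rewrite divr_ge0// exprn_ge0// ltW.
  have d0 : 0 < Num.min rho (e / (M / rho ^+ m.+1 + 1)).
    by rewrite lt_min rho0 divr_gt0// ltr_wpDl.
  have [w /andP[w0]] := f0 _ d0; rewrite lt_min => /andP[wr we] fw.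
  have [_] := fM w m.+1 (ltW wr).
  rewrite fw sub0r cabsN psum_recr.
  have -> : psum c w m = 0.
    by rewrite /psum big_nat_cond big1// => i /andP[/andP[_ im] _]; rewrite ih// mul0r.
  rewrite add0r cabsM cabsX expr_div_n exprSr -exprSr => h.
  have {h} : cabs (c m) <= M / rho ^+ m.+1 * cabs w.
    rewrite -(@ler_pM2r _ (cabs w ^+ m)) ?exprn_gt0//.
    rewrite (le_trans h)// exprS; set X := (_ ^+ m.+1)^-1.
    by rewrite le_eqVlt; apply/orP; left; apply/eqP; ring.
  move=> /le_trans; apply.
  move: we; rewrite ltr_pdivlMr ?ltr_wpDl// => we.
  by apply/ltW; apply: le_lt_trans we; rewrite mulrC ler_wpM2l ?cabs_ge0// lerDl.
exists rho => // w /ltW wr.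
apply/eqP; rewrite -cabs_eq0 eq_le cabs_ge0 andbT.
have [/psums_to_le fw _] := fM w 0%N wr.
apply/ler_addgt0Pr => e /fw [N _ /(_ N (leqnn _)) /=].
have -> : psum c w N = 0 by rewrite /psum big1// => i _; rewrite c0 mul0r.
by rewrite sub0r cabsN add0r => /ltW.
Qed.

(** The identity theorem along a segment.  Connectedness is used through a
    supremum: if [h] vanishes for all parameters below [s], its zeros accumulate
    at the point of parameter [s], so [h] vanishes around it and [s] can be
    enlarged unless it is 1. *)
Lemma analytic_segment h z v :
  (forall t : R, 0 <= t <= 1 -> analytic_at h (z + t%:C * v)) ->
  zeros_at h z -> h (z + v) = 0.
Proof.
move=> ha hz.
have [->|v0] := eqVneq v 0.
  have h0 : analytic_at h z.
    by have := ha 0; rewrite lexx ler01 mul0r addr0; exact.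
  have [e e0 /(_ 0)] := analytic_zeros h0 hz.
  by rewrite cabs0; exact.
have av0 : 0 < cabs v by rewrite cabs_gt0.
pose Z t := h (z + t%:C * v) = 0.
pose E := [set t : R | 0 <= t <= 1 /\ forall u, 0 <= u <= t -> Z u].
have ball t : 0 <= t <= 1 -> zeros_at h (z + t%:C * v) ->
    exists2 d : R, 0 < d & forall u, `|u - t| < d -> Z u.
  move=> t01 /(analytic_zeros (ha t t01))[e e0 he].
  exists (e / cabs v); first by rewrite divr_gt0.
  move=> u; rewrite ltr_pdivlMr// -cabs_real -cabsM => /he.
  have -> : z + t%:C * v + (u - t)%:C * v = z + u%:C * v.
    by rewrite rmorphB/=; ring.
  by [].
have [d0 d00 hd0] : exists2 d : R, 0 < d & forall u, `|u| < d -> Z u.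
  have := ball 0; rewrite lexx ler01 mul0r addr0 => /(_ isT hz)[d d0 hd].
  by exists d => // u ud; apply: hd; rewrite subr0.
pose t0 := Num.min 1 (d0 / 2).
have t00 : 0 < t0 by rewrite lt_min ltr01 divr_gt0.
have t01 : t0 <= 1 by rewrite ge_min lexx.
have Et0 : E t0.
  split; first by rewrite ltW.
  move=> u /andP[u0 ut]; apply: hd0; rewrite ger0_norm//.
  rewrite (le_lt_trans ut)// gt_min; apply/orP; right; lra.
have hsE : has_sup E.
  by split; [exists t0|exists 1 => t [/andP[]]].
pose s := sup E.
have t0s : t0 <= s by apply: sup_upper_bound.
have s1 : s <= 1 by apply: ge_sup; [exists t0|move=> t [/andP[]]].
have s0 : 0 < s by rewrite (lt_le_trans t00).
have Zs u : 0 <= u < s -> Z u.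
  move=> /andP[u0 us]; have su0 : 0 < s - u by rewrite subr_gt0.
  have [t [_ Et]] := sup_adherent su0 hsE.
  by rewrite opprB addrC subrK => ut; apply: Et; rewrite u0 ltW.
have s01 : 0 <= s <= 1 by rewrite ltW.
have [d dpos hd] : exists2 d : R, 0 < d & forall u, `|u - s| < d -> Z u.
  apply: ball => // e e0.
  pose x := Num.min (s / 2) (e / (2 * cabs v)).
  have x0 : 0 < x by rewrite lt_min !divr_gt0// mulr_gt0.
  exists (- (x%:C * v)).
    rewrite cabsN cabsM cabs_real gtr0_norm// mulr_gt0//=.
    have : x <= e / (2 * cabs v) by rewrite ge_min lexx orbT.
    rewrite ler_pdivlMr ?mulr_gt0//; nra.
  have := Zs (s - x); rewrite /Z.
  have -> : z + (s - x)%:C * v = z + s%:C * v + - (x%:C * v).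
    by rewrite rmorphB/=; ring.
  apply; have : x <= s / 2 by rewrite ge_min lexx.
  by move=> ?; apply/andP; split; lra.
pose t1 := Num.min 1 (s + d / 2).
have Et1 : E t1.
  split; first by rewrite le_min ler01 ge_min lexx; lra.
  move=> u /andP[u0]; rewrite le_min => /andP[u1 ud].
  have [us|su] := ltP u s; first by apply: Zs; rewrite u0.
  by apply: hd; rewrite ger0_norm ?subr_ge0//; lra.
have : t1 <= s by apply: sup_upper_bound.
rewrite ge_min => /orP[s1'|]; last by move=> ?; exfalso; lra.
have : Z 1.
  case: Et1 => _; apply; rewrite ler01/= le_min lexx/=; lra.
by rewrite /Z mul1r.
Qed.

Lemma analytic_at_near f g z0 (e : R) : 0 < e ->
  (forall z, cabs (z - z0) < e -> f z = g z) ->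
  analytic_at f z0 -> analytic_at g z0.
Proof.
move=> e0 fg /analytic_atP[r r0 [c fc]]; apply/analytic_atP.
exists (Num.min r e); first by rewrite lt_min r0.
exists c => w; rewrite lt_min => /andP[wr we].
by rewrite -fg; [exact: fc|rewrite addrAC subrr add0r].
Qed.

Lemma analyticD f g z0 : analytic_at f z0 -> analytic_at g z0 ->
  analytic_at (fun z => f z + g z) z0.
Proof.
move=> /analytic_atP[r r0 [c fc]] /analytic_atP[r' r0' [c' gc]].
apply/analytic_atP; exists (Num.min r r'); first by rewrite lt_min r0.
exists (fun n => c n + c' n) => w; rewrite lt_min => /andP[/fc cf /gc cg].
apply: (cvg_cabs0_le (g := fun N => cabs (psum c w N - f (z0 + w)) +
                                   cabs (psum c' w N - g (z0 + w)))).
  apply: nearW => N; apply: le_trans (cabsD _ _).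
  have -> : psum (fun n => c n + c' n) w N = psum c w N + psum c' w N.
    by rewrite /psum -big_split; apply: eq_bigr => i _; rewrite mulrDl.
  by rewrite opprD addrACA.
by rewrite -[0 in X in _ --> X]addr0; exact: cvgD cf cg.
Qed.

Lemma analyticZ k f z0 : analytic_at f z0 -> analytic_at (fun z => k * f z) z0.
Proof.
move=> /analytic_atP[r r0 [c fc]]; apply/analytic_atP; exists r => //.
exists (fun n => k * c n) => w /fc cf.
apply: (cvg_cabs0_le (g := fun N => cabs k * cabs (psum c w N - f (z0 + w)))).
  apply: nearW => N; rewrite -cabsM.
  have -> : psum (fun n => k * c n) w N = k * psum c w N.
    by rewrite /psum mulr_sumr; apply: eq_bigr => i _; rewrite mulrA.
  by rewrite mulrBr.
by rewrite -[0 in X in _ --> X](mulr0 (cabs k)); apply: cvgMr.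
Qed.

Lemma analyticB f g z0 : analytic_at f z0 -> analytic_at g z0 ->
  analytic_at (fun z => f z - g z) z0.
Proof.
move=> fa ga; have := analyticD fa (analyticZ (-1) ga).
by apply: (analytic_at_near ltr01) => z _; rewrite mulN1r.
Qed.

Lemma psums_to_shift c w (l : R[i]) :
  cabs (psum c w N.+1 - l) @[N --> \oo] --> (0 : R) -> psums_to c w l.
Proof. by move=> h; rewrite /psums_to -cvg_shiftS. Qed.

(** Around [z0] the factor is [b + w] with [b = z0 - p], so the coefficients are
    [b c_n + c_(n-1)]. *)
Lemma analytic_mul_lin p f z0 : analytic_at f z0 ->
  analytic_at (fun z => (z - p) * f z) z0.
Proof.
move=> /analytic_atP[r r0 [c fc]]; apply/analytic_atP; exists r => //.
set b := z0 - p.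
exists (fun n => if n is k.+1 then b * c k.+1 + c k else b * c 0%N) => w /fc cf.
apply: psums_to_shift.
set f0 := f (z0 + w) in cf *.
have dE N : psum (fun n => if n is k.+1 then b * c k.+1 + c k else b * c 0%N)
    w N.+1 = b * psum c w N.+1 + w * psum c w N.
  elim: N => [|N ih].
    by rewrite /psum !big_nat1 big_nil mulr0 addr0 !expr0 !mulr1.
  by rewrite psum_recr ih !psum_recr !exprS; ring.
apply: (cvg_cabs0_le (g := fun N => cabs b * cabs (psum c w N.+1 - f0) +
                                   cabs w * cabs (psum c w N - f0))).
  apply: nearW => N; rewrite dE -!cabsM; apply: le_trans (cabsD _ _).
  rewrite le_eqVlt; apply/orP; left; apply/eqP; congr cabs.
  by rewrite /b; ring.
have cf1 : cabs (psum c w N.+1 - f0) @[N --> \oo] --> (0 : R).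
  by rewrite (cvg_shiftS (fun N => cabs (psum c w N - f0))).
rewrite -[0 in X in _ --> X](mulr0 (cabs b)) -[X in _ --> X]addr0.
rewrite -[X in _ --> _ + X](mulr0 (cabs w)).
by apply: cvgD; apply: cvgMr.
Qed.

(** The coefficients [d_n] solving [(b + w) sum d_n w^n = sum c_n w^n]. *)
Fixpoint div_coef (b : R[i]) c n : R[i] :=
  if n is k.+1 then (c k.+1 - div_coef b c k) / b else c 0%N / b.

(** If [|c_n| rho^n <= M] and [rho <= |b| / 2], the recursion for the quotient
    propagates the bound [|d_n| rho^n <= 2 M / |b|], hence its series converges
    on the disk of radius [rho]. *)
Lemma analytic_div_lin p f z0 : z0 != p -> analytic_at f z0 ->
  analytic_at (fun z => f z / (z - p)) z0.
Proof.
move=> z0p /analytic_atP[r r0 [c fc]]; apply/analytic_atP.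
set b := z0 - p; have b0 : b != 0 by rewrite subr_eq0.
have ab0 : 0 < cabs b by rewrite cabs_gt0.
pose rho := Num.min (r / 2) (cabs b / 2).
have rho0 : 0 < rho by rewrite lt_min !divr_gt0.
have rhor : rho < r by rewrite gt_min; apply/orP; left; lra.
have rhob : rho <= cabs b / 2 by rewrite ge_min lexx orbT.
have := fc rho%:C; rewrite cabs_real (gtr0_norm rho0) => /(_ rhor).
move=> /psums_to_bounded[M M0]; rewrite cabs_real (gtr0_norm rho0) => cM.
pose K := 2 * M / cabs b.
pose d := div_coef b c.
have dK n : cabs (d n) * rho ^+ n <= K.
  elim: n => [|n ih].
    rewrite /= cabsM cabsV expr0 mulr1 /K ler_wpM2r ?invr_ge0 ?cabs_ge0//.
    by have := cM 0%N; rewrite expr0 mulr1; lra.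
  rewrite /= cabsM cabsV mulrAC /K ler_wpM2r ?invr_ge0 ?cabs_ge0//.
  have h1 := cM n.+1.
  have h2 : rho * (cabs (d n) * rho ^+ n) <= M.
    have : rho * (cabs (d n) * rho ^+ n) <= cabs b / 2 * K.
      apply: ler_pM => //; first exact: ltW.
      by rewrite mulr_ge0 ?cabs_ge0 ?exprn_ge0// ltW.
    move=> /le_trans; apply; rewrite /K le_eqVlt; apply/orP; left; apply/eqP.
    by field; rewrite gt_eqF.
  have h3 := cabsD (c n.+1) (- d n); rewrite cabsN in h3.
  have : cabs (c n.+1 - d n) * rho ^+ n.+1 <=
      (cabs (c n.+1) + cabs (d n)) * rho ^+ n.+1.
    by rewrite ler_wpM2r// exprn_ge0// ltW.
  move=> /le_trans; apply; rewrite mulrDl (_ : 2 * M = M + M); last by ring.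
  by rewrite lerD// exprS mulrCA.
exists rho => //; exists d => w wr.
have bw0 : b + w != 0.
  rewrite -cabs_gt0; have := cabsB b (- w); rewrite opprK cabsN.
  by apply: lt_le_trans; lra.
have dE N : (b + w) * psum d w N.+1 = psum c w N.+1 + d N * w ^+ N.+1.
  elim: N => [|N ih].
    by rewrite /psum !big_nat1 !expr0 !mulr1 expr1 /d /=; field.
  have dS : d N.+1 = (c N.+1 - d N) / b by [].
  rewrite (psum_recr d) mulrDr ih dS (psum_recr c w N.+1) !exprS.
  by field.
set f0 := f (z0 + w).
have cf : psums_to c w f0 by apply: fc; rewrite (lt_trans wr).
have -> : z0 + w - p = b + w by rewrite /b addrAC.
apply: psums_to_shift.
have q1 : `|cabs w / rho| < 1.
  by rewrite ger0_norm ?divr_ge0 ?cabs_ge0 ?ltW// ltr_pdivrMr// mul1r.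
apply: (cvg_cabs0_le (g := fun N => (cabs (psum c w N.+1 - f0) +
                       K * cabs w * (cabs w / rho) ^+ N) * (cabs (b + w))^-1)).
  apply: nearW => N.
  have -> : psum d w N.+1 - f0 / (b + w) =
      (psum c w N.+1 - f0 + d N * w ^+ N.+1) / (b + w).
    have -> : psum c w N.+1 = (b + w) * psum d w N.+1 - d N * w ^+ N.+1.
      by rewrite dE addrK.
    by field.
  rewrite cabsM cabsV ler_wpM2r ?invr_ge0 ?cabs_ge0//.
  rewrite (le_trans (cabsD _ _))// lerD2l cabsM cabsX exprS expr_div_n.
  rewrite [K * _]mulrC -mulrA mulrCA ler_wpM2l ?cabs_ge0// mulrCA.
  rewrite mulrC ler_wpM2l ?exprn_ge0 ?cabs_ge0//.
  by rewrite ler_pdivlMr ?exprn_gt0.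
have cf1 : cabs (psum c w N.+1 - f0) @[N --> \oo] --> (0 : R).
  by rewrite (cvg_shiftS (fun N => cabs (psum c w N - f0))).
rewrite -[0 in X in _ --> X](mul0r (cabs (b + w))^-1).
apply: cvgMl.
rewrite -[0 in X in _ --> X]addr0; apply: cvgD => //.
rewrite -[0 in X in _ --> X](mulr0 (K * cabs w)).
by apply: cvgMr; exact: cvg_expr.
Qed.

End analytic.

(** * Complex functions of a real variable and the exponential series *)

Section cder.
Context {R : realType}.
Implicit Types (f g : R -> R[i]) (D E : R[i]) (t : R).

(** The derivative of a complex function of a real variable, by components: real
    differential calculus then applies to each of them. *)
Definition cder f t D :=
  is_derive t (1 : R) (fun u => complex.Re (f u)) (complex.Re D) /\
  is_derive t (1 : R) (fun u => complex.Im (f u)) (complex.Im D).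

Lemma cder_cst (k : R[i]) t : cder (fun=> k) t 0.
Proof. by split; exact: is_derive_cst. Qed.

Lemma cderD f g t D E : cder f t D -> cder g t E ->
  cder (fun u => f u + g u) t (D + E).
Proof.
move=> [fr fi] [gr gi]; split; rewrite !(Re_add, Im_add).
  have -> : (fun u => complex.Re (f u + g u)) =
      (fun u => complex.Re (f u)) + (fun u => complex.Re (g u)).
    by apply/funext => u; rewrite Re_add.
  exact: is_deriveD.
have -> : (fun u => complex.Im (f u + g u)) =
    (fun u => complex.Im (f u)) + (fun u => complex.Im (g u)).
  by apply/funext => u; rewrite Im_add.
exact: is_deriveD.
Qed.

Lemma cderM f g t D E : cder f t D -> cder g t E ->
  cder (fun u => f u * g u) t (D * g t + f t * E).
Proof.
move=> [fr fi] [gr gi]; split.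
  have -> : (fun u => complex.Re (f u * g u)) =
      (fun u => complex.Re (f u)) * (fun u => complex.Re (g u)) -
      (fun u => complex.Im (f u)) * (fun u => complex.Im (g u)).
    by apply/funext => u; rewrite Re_mul.
  apply: is_derive_eq; rewrite !(Re_add, Re_mul) /GRing.scale/=; ring.
have -> : (fun u => complex.Im (f u * g u)) =
    (fun u => complex.Re (f u)) * (fun u => complex.Im (g u)) +
    (fun u => complex.Im (f u)) * (fun u => complex.Re (g u)).
  by apply/funext => u; rewrite Im_mul.
apply: is_derive_eq; rewrite !(Im_add, Im_mul) /GRing.scale/=; ring.
Qed.

Lemma cderZ (k : R[i]) f t D : cder f t D -> cder (fun u => k * f u) t (k * D).
Proof.
by move=> fD; have := cderM (cder_cst k t) fD; rewrite mul0r add0r.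
Qed.

Lemma cder_lin (l : R[i]) t : cder (fun u => u%:C * l) t l.
Proof.
split.
  have -> : (fun u : R => complex.Re (u%:C * l)) = complex.Re l *: id.
    by apply/funext => u; rewrite Re_mul/= mul0r subr0 mulrC.
  by apply: is_derive_eq; rewrite /GRing.scale/= mulr1.
have -> : (fun u : R => complex.Im (u%:C * l)) = complex.Im l *: id.
  by apply/funext => u; rewrite Im_mul/= mul0r addr0 mulrC.
by apply: is_derive_eq; rewrite /GRing.scale/= mulr1.
Qed.

Lemma cder_cexp f t D : cder f t D ->
  cder (fun u => cexp (f u)) t (D * cexp (f t)).
Proof.
move=> [fr fi].
have er := is_derive1_comp (is_derive_expR (complex.Re (f t))) fr.
have ec := is_derive1_comp (is_derive_cos (complex.Im (f t))) fi.
have es := is_derive1_comp (is_derive_sin (complex.Im (f t))) fi.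
split.
  have -> : (fun u => complex.Re (cexp (f u))) =
      (expR \o (fun u => complex.Re (f u))) * (cos \o (fun u => complex.Im (f u))).
    by apply/funext => u; rewrite Re_cexp.
  apply: is_derive_eq; rewrite Re_mul Re_cexp Im_cexp /GRing.scale/=; ring.
have -> : (fun u => complex.Im (cexp (f u))) =
    (expR \o (fun u => complex.Re (f u))) * (sin \o (fun u => complex.Im (f u))).
  by apply/funext => u; rewrite Im_cexp.
apply: is_derive_eq; rewrite Im_mul Re_cexp Im_cexp /GRing.scale/=; ring.
Qed.

Lemma mvt01_le (f df : R -> R) (B : R) :
  (forall t, 0 <= t <= 1 -> is_derive t (1 : R) f (df t)) ->
  (forall t, 0 <= t <= 1 -> `|df t| <= B) -> `|f 1 - f 0| <= B.
Proof.
move=> fd dB.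
have [x||c] := @MVT R f df 0 1 ltr01.
- by rewrite in_itv/= => /andP[x0 x1]; apply: fd; rewrite !ltW.
- apply: derivable_within_continuous => x; rewrite in_itv/= => x01.
  by have [] := fd _ x01.
rewrite in_itv/= => /andP[c0 c1] ->.
by rewrite subr0 mulr1; apply: dB; rewrite !ltW.
Qed.

(** There is no mean value theorem for complex values; each component has one,
    hence the two copies of [B]. *)
Lemma cder_le f (df : R -> R[i]) (B : R) :
  (forall t, 0 <= t <= 1 -> cder f t (df t)) ->
  (forall t, 0 <= t <= 1 -> cabs (df t) <= B) -> cabs (f 1 - f 0) <= B + B.
Proof.
move=> fd dB; apply: (le_trans (cabs_le _)); apply: lerD.
  rewrite Re_sub; apply: (@mvt01_le (fun t => complex.Re (f t)) (fun t => complex.Re (df t))).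
    by move=> t /fd[].
  by move=> t /dB; apply: le_trans; exact: cabs_Re.
rewrite Im_sub; apply: (@mvt01_le (fun t => complex.Im (f t)) (fun t => complex.Im (df t))).
  by move=> t /fd[].
by move=> t /dB; apply: le_trans; exact: cabs_Im.
Qed.

Lemma cder0_eq f : (forall t, 0 <= t <= 1 -> cder f t 0) -> f 1 = f 0.
Proof.
move=> fd; apply/eqP; rewrite -subr_eq0 -cabs_eq0 eq_le cabs_ge0 andbT.
rewrite -[leRHS](addr0 0); apply: (cder_le fd) => t _.
by rewrite cabs0.
Qed.

Definition expc (n : nat) : R[i] := (n`!%:R)^-1.

Lemma cder_psum_expc z t N :
  cder (fun u => psum expc (u%:C * z) N.+1) t (z * psum expc (t%:C * z) N).
Proof.
elim: N => [|N ih].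
  rewrite /psum big_nil mulr0.
  have -> : (fun u : R => \sum_(0 <= n < 1) expc n * (u%:C * z) ^+ n) = fun=> expc 0.
    by apply/funext => u; rewrite big_nat1 expr0 mulr1.
  exact: cder_cst.
have -> : (fun u : R => psum expc (u%:C * z) N.+2) =
    fun u => psum expc (u%:C * z) N.+1 + expc N.+1 * (u%:C * z) ^+ N.+1.
  by apply/funext => u; rewrite psum_recr.
rewrite psum_recr mulrDr; apply: cderD => //.
have -> : z * (expc N * (t%:C * z) ^+ N) =
    expc N.+1 * (N.+1%:R * z * (t%:C * z) ^+ N).
  rewrite /expc factS natrM invfM; field.
  by rewrite addrC natr1 !pnatr_eq0 -lt0n fact_gt0.
apply: cderZ.
have X (n : nat) : cder (fun u => (u%:C * z) ^+ n.+1) t (n.+1%:R * z * (t%:C * z) ^+ n).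
  elim: n => [|n ihn].
    rewrite expr0 mulr1 mul1r.
    have -> : (fun u : R => (u%:C * z) ^+ 1) = fun u => u%:C * z.
      by apply/funext => u; rewrite expr1.
    exact: cder_lin.
  have -> : (fun u : R => (u%:C * z) ^+ n.+2) = fun u => (u%:C * z) * (u%:C * z) ^+ n.+1.
    by apply/funext => u; rewrite exprS.
  have := cderM (cder_lin z t) ihn.
  congr cder; rewrite -[in RHS]natr1 exprS; ring.
exact: X.
Qed.

Lemma cabs_natr (n : nat) : cabs (n%:R : R[i]) = n%:R.
Proof.
by have := cabs_real (n%:R : R); rewrite rmorph_nat => ->; rewrite ger0_norm.
Qed.

Lemma cabs_psum_expc w N : cabs (psum expc w N) <= expR (cabs w).
Proof.
apply: (@le_trans _ _ (series (exp_coeff (cabs w)) N)).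
  rewrite /psum (le_trans (cabs_sum _ _ _))//.
  apply: ler_sum => n _; rewrite cabsM cabsX cabsV cabs_natr.
  by rewrite /exp_coeff/= mulrC.
rewrite /expR; apply: nondecreasing_cvgn_le; last exact: is_cvg_series_exp_coeff.
apply/nondecreasing_seqP => n.
by rewrite /series/= big_nat_recr//= lerDl exp_coeff_ge0// cabs_ge0.
Qed.

(** Compare [g t = exp(-tw) S_(N+1)(tw)] at 0 and 1, where [S] denotes the partial
    sums: in the derivative all terms cancel but
    [-w exp(-tw) (tw)^N / N!], which tends to 0 uniformly in [t]. *)
Lemma cexp_series w : psums_to expc w (cexp w).
Proof.
apply: psums_to_shift.
pose K := expR (cabs w) * (cabs w * expR (cabs w)).
apply: (cvg_cabs0_le (g := fun N => (K + K) * exp_coeff (cabs w) N)); last first.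
  rewrite -[0 in X in _ --> X](mulr0 (K + K)); apply: cvgMr.
  exact: cvg_exp_coeff.
apply: nearW => N.
pose g t := cexp (t%:C * - w) * psum expc (t%:C * w) N.+1.
pose dg t := - w * cexp (t%:C * - w) * (expc N * (t%:C * w) ^+ N).
have gd t : 0 <= t <= 1 -> cder g t (dg t).
  move=> _; have := cderM (cder_cexp (cder_lin (- w) t)) (cder_psum_expc w t N).
  by congr cder; rewrite /dg psum_recr; ring.
pose B := cabs w * expR (cabs w) * exp_coeff (cabs w) N.
have dgB t : 0 <= t <= 1 -> cabs (dg t) <= B.
  move=> /andP[t0 t1]; rewrite /dg cabsM (cabsM (- w)) (cabsM (expc N)) cabsN cabs_cexp.
  rewrite cabsX (cabsM t%:C) cabs_real.
  rewrite ger0_norm// /B -!mulrA ler_wpM2l ?cabs_ge0//; apply: ler_pM.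
  - exact: expR_ge0.
  - by rewrite mulr_ge0 ?cabs_ge0// exprn_ge0// mulr_ge0// cabs_ge0.
  - rewrite ler_expR Re_mul/= mul0r subr0 Re_opp mulrN.
    rewrite -mulNr (le_trans (ler_norm _))// normrM normrN (ger0_norm t0).
    rewrite -[leRHS]mul1r; apply: ler_pM => //; exact: cabs_Re.
  - rewrite /exp_coeff/= [leRHS]mulrC /expc cabsV cabs_natr ler_wpM2l//.
    rewrite lerXn2r ?nnegrE ?mulr_ge0 ?cabs_ge0//.
    by rewrite ler_piMl// cabs_ge0.
have gB := cder_le gd dgB.
have g0 : g 0 = 1.
  rewrite /g !mul0r cexp0 mul1r /psum big_nat_recl// big1.
    by rewrite expr0 mulr1 /expc fact0 invr1 addr0.
  by move=> i _; rewrite exprS mul0r mulr0.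
have -> : psum expc w N.+1 - cexp w = cexp w * (g 1 - g 0).
  rewrite g0 /g !mul1r mulrBr mulr1 mulrA [cexp w * _]mulrC cexpN mul1r.
  by [].
rewrite cabsM cabs_cexp (_ : (K + K) * _ = expR (cabs w) * (B + B)).
  apply: ler_pM => //; rewrite ?expR_ge0 ?cabs_ge0//.
  by rewrite ler_expR (le_trans (ler_norm _))// cabs_Re.
rewrite /K /B; ring.
Qed.

(** A function squeezed by one that touches 0 with zero slope has zero slope. *)
Lemma is_derive_squeeze (q r : R -> R) (t : R) :
  (\forall u \near t, `|r u| <= q u) -> q t = 0 -> is_derive t (1 : R) q 0 ->
  is_derive t (1 : R) r 0.
Proof.
move=> rq qt qd; have rt : r t = 0.
  by apply/normr0_eq0/eqP; rewrite eq_le normr_ge0 andbT -qt; exact: nbhs_singleton rq.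
have hq : h^-1 *: (q (h *: 1 + t) - q t) @[h --> 0^'] --> (0 : R).
  have [dq d0] := qd; exact: (cvg_toP dq d0).
suff hr : h^-1 *: (r (h *: 1 + t) - r t) @[h --> 0^'] --> (0 : R).
  by apply: DeriveDef; [apply/cvg_ex; exists 0|exact: cvg_lim].
move: hq => /cvgrPdist_lt hq; apply/cvgrPdist_lt => e e0.
have c0 : h *: 1 + t @[h --> (0 : R)] --> t.
  rewrite -[X in _ --> X]add0r; apply: cvgD; last exact: cvg_cst.
  rewrite -[0 in X in _ --> X](scale0r (1 : R)); apply: cvgZl; exact: cvg_id.
have rq0 : \forall h \near (0 : R)^', `|r (h *: 1 + t)| <= q (h *: 1 + t).
  by apply: (cvg_within (F := nbhs (0:R))); exact: (c0 _ rq).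
near=> h.
have h1 : `|0 - h^-1 *: (q (h *: 1 + t) - q t)| < e by near: h; exact: hq.
have h2 : `|r (h *: 1 + t)| <= q (h *: 1 + t) by near: h; exact: rq0.
apply: le_lt_trans h1; rewrite !sub0r !normrN rt qt !subr0 !normrZ.
by rewrite ler_wpM2l// (le_trans h2)// ler_norm.
Unshelve. all: by end_near. Qed.

(** The chain rule along a curve, for a function that is complex differentiable
    in the strong sense of a quadratic remainder: the remainder along the curve is
    squeezed by [M |z u - z0|^2], whose derivative vanishes at [t]. *)
Lemma cder_comp_tail (F : R[i] -> R[i]) (rho M : R) (c1 z0 : R[i])
    (z : R -> R[i]) (t : R) (D : R[i]) : 0 < rho ->
  (forall w, cabs w <= rho -> cabs (F (z0 + w) - F z0 - c1 * w) <= M * cabs w ^+ 2) ->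
  z t = z0 -> cder z t D -> cder (fun u => F (z u)) t (c1 * D).
Proof.
move=> rho0 FM zt zD.
have M0 : 0 <= M.
  have := FM rho%:C; rewrite cabs_real gtr0_norm// lexx => /(_ isT).
  by move=> /(le_trans (cabs_ge0 _)); rewrite pmulr_lge0// exprn_gt0.
pose r u := F (z u) - (F z0 + c1 * (z u - z0)).
pose q u : R := M * ((complex.Re (z u) - complex.Re z0) ^+ 2 +
                     (complex.Im (z u) - complex.Im z0) ^+ 2).
have q_abs u : q u = M * cabs (z u - z0) ^+ 2.
  rewrite /q cabs_sqrt sqr_sqrtr ?addr_ge0 ?sqr_ge0//.
  by rewrite Re_sub Im_sub.
have [zr zi] := zD.
have qd : is_derive t (1 : R) q 0.
  have dr := is_deriveB zr (is_derive_cst (complex.Re z0) t (1 : R)).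
  have di := is_deriveB zi (is_derive_cst (complex.Im z0) t (1 : R)).
  have -> : q = M *: (((fun u => complex.Re (z u)) - cst (complex.Re z0)) *
                      ((fun u => complex.Re (z u)) - cst (complex.Re z0)) +
                     ((fun u => complex.Im (z u)) - cst (complex.Im z0)) *
                     ((fun u => complex.Im (z u)) - cst (complex.Im z0))).
    by apply/funext => u.
  have := is_deriveZ M (is_deriveD (is_deriveM dr dr) (is_deriveM di di)).
  by rewrite !fctE zt !subrr /GRing.scale/= !mul0r !addr0 mulr0.
have qt : q t = 0 by rewrite q_abs zt subrr cabs0 expr0n mulr0.
have near_rq : \forall u \near t, cabs (r u) <= q u.
  have cz : cabs (z u - z0) @[u --> t] --> (0 : R).
    rewrite -zt; apply: cvg_Re_Im.
      by apply: differentiable_continuous; apply/derivable1_diffP; have [] := zr.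
    by apply: differentiable_continuous; apply/derivable1_diffP; have [] := zi.
  move/cvgrPdist_lt : cz => /(_ _ rho0); apply: filterS => u.
  rewrite sub0r normrN (ger0_norm (cabs_ge0 _)) => /ltW zu.
  have := FM _ zu; rewrite q_abs.
  have -> : z0 + (z u - z0) = z u by ring.
  by rewrite /r opprD addrA.
have rd : cder r t 0.
  split; apply: (is_derive_squeeze _ qt qd); apply: filterS near_rq => u.
    by apply: le_trans; exact: cabs_Re.
  by apply: le_trans; exact: cabs_Im.
have ld : cder (fun u => F z0 + c1 * (z u - z0)) t (c1 * D).
  rewrite -[X in cder _ _ X]add0r; apply: cderD; first exact: cder_cst.
  apply: cderZ; rewrite -[X in cder _ _ X]addr0; apply: cderD => //.
  exact: cder_cst.
have := cderD rd ld; rewrite add0r.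
by congr cder; apply/funext => u; rewrite /r subrK.
Qed.

End cder.

(** * Integration of complex-valued functions *)

Section cmeas.
Context d {T : measurableType d} {R : realType}.
Implicit Types (f g : T -> R[i]).

Definition cmeas f :=
  measurable_fun [set: T] (fun x => complex.Re (f x)) /\
  measurable_fun [set: T] (fun x => complex.Im (f x)).

Lemma cmeas_cst (k : R[i]) : cmeas (fun=> k).
Proof. by split; exact: measurable_cst. Qed.

Lemma cmeas_pair (u v : T -> R) : measurable_fun setT u -> measurable_fun setT v ->
  cmeas (fun x => u x +i* v x).
Proof. by split. Qed.

Lemma cmeas_real (u : T -> R) : measurable_fun setT u -> cmeas (fun x => (u x)%:C).
Proof. by move=> mu; split => //; exact: measurable_cst. Qed.

Lemma cmeasD f g : cmeas f -> cmeas g -> cmeas (fun x => f x + g x).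
Proof.
move=> [fr fi] [gr gi]; split.
  under eq_fun do rewrite Re_add; exact: measurable_funD.
under eq_fun do rewrite Im_add; exact: measurable_funD.
Qed.

Lemma cmeasM f g : cmeas f -> cmeas g -> cmeas (fun x => f x * g x).
Proof.
move=> [fr fi] [gr gi]; split.
  under eq_fun do rewrite Re_mul.
  by apply: measurable_funB; exact: measurable_funM.
under eq_fun do rewrite Im_mul.
by apply: measurable_funD; exact: measurable_funM.
Qed.

Lemma cmeasN f : cmeas f -> cmeas (fun x => - f x).
Proof.
move=> mf; have := cmeasM (cmeas_cst (-1)) mf.
by under eq_fun do rewrite mulN1r.
Qed.

Lemma cmeasX f n : cmeas f -> cmeas (fun x => f x ^+ n).
Proof.
move=> mf; elim: n => [|n ih]; first exact: cmeas_cst.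
under eq_fun do rewrite exprS; exact: cmeasM.
Qed.

Lemma cmeas_cexp f : cmeas f -> cmeas (fun x => cexp (f x)).
Proof.
move=> [fr fi]; split.
  under eq_fun do rewrite Re_cexp; apply: measurable_funM.
    exact: measurableT_comp.
  by apply: measurableT_comp => //; exact: continuous_measurable_fun (@continuous_cos R).
under eq_fun do rewrite Im_cexp; apply: measurable_funM.
  exact: measurableT_comp.
by apply: measurableT_comp => //; exact: continuous_measurable_fun (@continuous_sin R).
Qed.

Lemma measurable_cabs f : cmeas f -> measurable_fun setT (fun x => cabs (f x)).
Proof.
move=> [fr fi]; under eq_fun do rewrite cabs_sqrt.
apply: (measurableT_comp (f := @Num.sqrt R)).
  by apply: continuous_measurable_fun; exact: sqrt_continuous.
by apply: measurable_funD; exact: measurable_funX.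
Qed.

Lemma cmeas_psum (c : nat -> R[i]) f N : cmeas f -> cmeas (fun x => psum c (f x) N).
Proof.
move=> mf; elim: N => [|N ih].
  by under eq_fun do rewrite /psum big_nil; exact: cmeas_cst.
under eq_fun do rewrite psum_recr.
by apply: cmeasD => //; apply: cmeasM; [exact: cmeas_cst|exact: cmeasX].
Qed.

End cmeas.

Section cint.
Context d {T : measurableType d} {R : realType}.
Variable mu : {measure set T -> \bar R}.
Implicit Types (f g : T -> R[i]).

Definition cintble f :=
  mu.-integrable setT (fun x => (complex.Re (f x))%:E) /\
  mu.-integrable setT (fun x => (complex.Im (f x))%:E).

Definition cint f : R[i] :=
  (\int[mu]_x complex.Re (f x)) +i* (\int[mu]_x complex.Im (f x)).

Lemma eq_cint f g : f =1 g -> cint f = cint g.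
Proof. by move=> /funext ->. Qed.

Lemma cintble_le f (g : T -> R) : cmeas f -> mu.-integrable setT (EFin \o g) ->
  (forall x, cabs (f x) <= g x) -> cintble f.
Proof.
move=> [fr fi] gi fg; split; apply: le_integrable gi => //.
- exact/measurable_EFinP.
- move=> x _ /=; rewrite lee_fin (le_trans (cabs_Re _))// (le_trans (fg x))//.
  exact: ler_norm.
- exact/measurable_EFinP.
- move=> x _ /=; rewrite lee_fin (le_trans (cabs_Im _))// (le_trans (fg x))//.
  exact: ler_norm.
Qed.

Lemma cintble_meas f : cintble f -> cmeas f.
Proof.
by move=> [/measurable_int/measurable_EFinP fr /measurable_int/measurable_EFinP fi].
Qed.

Lemma cintble_cabs f : cintble f -> mu.-integrable setT (fun x => (cabs (f x))%:E).
Proof.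
move=> fi; have [fr' fi'] := fi.
have /= := integrableD measurableT (integrable_abse fr') (integrable_abse fi').
apply: le_integrable => //.
  exact/measurable_EFinP/measurable_cabs/cintble_meas.
move=> x _ /=; rewrite lee_fin ger0_norm ?cabs_ge0//.
by rewrite ger0_norm ?addr_ge0// cabs_le.
Qed.

Lemma cintbleD f g : cintble f -> cintble g -> cintble (fun x => f x + g x).
Proof.
move=> [fr fi] [gr gi]; split.
  have := integrableD measurableT fr gr.
  by apply: eq_integrable => // x _ /=; rewrite Re_add.
have := integrableD measurableT fi gi.
by apply: eq_integrable => // x _ /=; rewrite Im_add.
Qed.

Lemma cintD f g : cintble f -> cintble g ->
  cint (fun x => f x + g x) = cint f + cint g.
Proof.
move=> [fr fi] [gr gi]; apply: complex_eqE; rewrite ?(Re_add,Im_add)/=.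
  by under eq_Rintegral do rewrite Re_add; rewrite RintegralD.
by under eq_Rintegral do rewrite Im_add; rewrite RintegralD.
Qed.

Lemma cintbleZ (k : R[i]) f : cintble f -> cintble (fun x => k * f x).
Proof.
move=> fi; apply: (cintble_le (g := fun x => cabs k * cabs (f x))).
- by apply: cmeasM; [exact: cmeas_cst|exact: cintble_meas].
- have := integrableZl measurableT (cabs k) (cintble_cabs fi).
  by apply: eq_integrable.
- by move=> x; rewrite cabsM.
Qed.

Lemma cintZ (k : R[i]) f : cintble f -> cint (fun x => k * f x) = k * cint f.
Proof.
move=> [fr fi].
have h (a b : R) (u v : T -> R) : mu.-integrable setT (EFin \o u) ->
    mu.-integrable setT (EFin \o v) ->
    \int[mu]_x (a * u x + b * v x) = a * \int[mu]_x u x + b * \int[mu]_x v x.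
  move=> ui vi; rewrite RintegralD//.
  - by rewrite !RintegralZl.
  - have := integrableZl measurableT a ui.
    by apply: eq_integrable.
  - have := integrableZl measurableT b vi.
    by apply: eq_integrable.
apply: complex_eqE; rewrite ?(Re_mul,Im_mul)/=.
  under eq_Rintegral do rewrite Re_mul -mulNr.
  by rewrite h// mulNr.
under eq_Rintegral do rewrite Im_mul.
by rewrite h.
Qed.

Lemma cintbleN f : cintble f -> cintble (fun x => - f x).
Proof.
move=> /(cintbleZ (-1)); congr cintble.
by apply/funext => x; rewrite mulN1r.
Qed.

Lemma cintB f g : cintble f -> cintble g ->
  cint (fun x => f x - g x) = cint f - cint g.
Proof.
move=> fi gi; rewrite cintD//; last exact: cintbleN.
congr (_ + _); rewrite -mulN1r -cintZ//.
by apply: eq_cint => x; rewrite mulN1r.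
Qed.

Lemma Rintegral_le_integrable (u g : T -> R) : mu.-integrable setT (EFin \o u) ->
  mu.-integrable setT (EFin \o g) -> (forall x, `|u x| <= g x) ->
  `|\int[mu]_x u x| <= \int[mu]_x g x.
Proof.
move=> ui gi ug; apply: (le_trans (le_normr_Rintegral measurableT ui)).
by apply: le_Rintegral => //; exact: integrable_norm.
Qed.

(** The real and imaginary parts are bounded separately, hence the two copies of
    the integral of [g]. *)
Lemma cabs_cint_le f (g : T -> R) : cmeas f -> mu.-integrable setT (EFin \o g) ->
  (forall x, cabs (f x) <= g x) ->
  cabs (cint f) <= \int[mu]_x g x + \int[mu]_x g x.
Proof.
move=> mf gi fg; have [fr fi] := cintble_le mf gi fg.
rewrite (le_trans (cabs_le _))//= lerD//; apply: Rintegral_le_integrable => // x.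
  by rewrite (le_trans (cabs_Re _)).
by rewrite (le_trans (cabs_Im _)).
Qed.

Lemma Rintegral_dominated (u_ : nat -> T -> R) (u g : T -> R) :
  (forall n, measurable_fun setT (u_ n)) -> measurable_fun setT u ->
  (forall x, u_ n x @[n --> \oo] --> u x) ->
  mu.-integrable setT (EFin \o g) -> (forall n x, `|u_ n x| <= g x) ->
  \int[mu]_x u_ n x @[n --> \oo] --> \int[mu]_x u x.
Proof.
move=> mu_ mu' cu gi ug.
have [|||||ui _ h] := @dominated_convergence _ T R mu setT measurableT
    (fun n x => (u_ n x)%:E) (fun x => (u x)%:E) (fun x => (g x)%:E).
- by move=> n; exact/measurable_EFinP.
- exact/measurable_EFinP.
- by apply: aeW => x _; apply: cvg_EFin; [exact: nearW|exact: cu].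
- exact: gi.
- by apply: aeW => x n _; rewrite lee_fin.
apply: fine_cvg; rewrite fineK//.
exact: integrable_fin_num ui.
Qed.

Lemma cint_dominated (f_ : nat -> T -> R[i]) f (g : T -> R) :
  (forall n, cmeas (f_ n)) -> cmeas f ->
  (forall x, cabs (f_ n x - f x) @[n --> \oo] --> (0 : R)) ->
  mu.-integrable setT (EFin \o g) -> (forall n x, cabs (f_ n x) <= g x) ->
  cabs (cint (f_ n) - cint f) @[n --> \oo] --> (0 : R).
Proof.
move=> mf_ mf cf gi fg; apply: cvg_Re_Im => /=.
  apply: Rintegral_dominated gi _.
  - by move=> n; have [] := mf_ n.
  - by have [] := mf.
  - by move=> x; exact: cvg_cabs_Re (cf x).
  - by move=> n x; rewrite (le_trans (cabs_Re _)).
apply: Rintegral_dominated gi _.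
- by move=> n; have [] := mf_ n.
- by have [] := mf.
- by move=> x; exact: cvg_cabs_Im (cf x).
- by move=> n x; rewrite (le_trans (cabs_Im _)).
Qed.

Lemma exp_coeff_le (x : R) n : 0 <= x -> exp_coeff x n <= expR x.
Proof.
move=> x0; apply: (@le_trans _ _ (series (exp_coeff x) n.+1)).
  rewrite /series/= big_nat_recr//= lerDr.
  by apply: sumr_ge0 => i _; exact: exp_coeff_ge0.
rewrite /expR; apply: nondecreasing_cvgn_le; last exact: is_cvg_series_exp_coeff.
apply/nondecreasing_seqP => k.
by rewrite /series/= big_nat_recr//= lerDl exp_coeff_ge0.
Qed.

Lemma cabs_expc_term (z : R[i]) n : cabs (expc n * z ^+ n) <= expR (cabs z).
Proof.
rewrite cabsM cabsX /expc cabsV cabs_natr mulrC.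
exact: exp_coeff_le (cabs_ge0 z).
Qed.

(** Termwise integration of the exponential series: its partial sums at [w L] are
    dominated by [e^(r |L|)] as long as [|w| <= r]. *)
Lemma cint_cexp_series (W L : T -> R[i]) (r : R) : cmeas W -> cmeas L -> 0 < r ->
  mu.-integrable setT (fun x => (cabs (W x) * expR (r * cabs (L x)))%:E) ->
  forall w, cabs w <= r ->
  psums_to (fun n => cint (fun x => W x * (expc n * L x ^+ n))) w
    (cint (fun x => W x * cexp (w * L x))).
Proof.
move=> mW mL r0 iWL w wr.
set c := fun n => _.
have wL x : cabs (w * L x) <= r * cabs (L x).
  by rewrite cabsM ler_wpM2r ?cabs_ge0.
have mwL : cmeas (fun x => w * L x) := cmeasM (cmeas_cst w) mL.
have ic n : cintble (fun x => W x * (expc n * L x ^+ n)).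
  apply: (cintble_le (g := fun x => r ^- n * (cabs (W x) * expR (r * cabs (L x))))).
  - by apply: cmeasM => //; apply: cmeasM; [exact: cmeas_cst|exact: cmeasX].
  - have := integrableZl measurableT (r ^- n) iWL.
    by apply: eq_integrable.
  - move=> x; rewrite cabsM mulrCA ler_wpM2l ?cabs_ge0// [leRHS]mulrC.
    rewrite ler_pdivlMr ?exprn_gt0//.
    have := cabs_expc_term (r%:C * L x) n.
    have -> : expc n * (r%:C * L x) ^+ n = r%:C ^+ n * (expc n * L x ^+ n).
      by rewrite exprMn mulrCA.
    rewrite (cabsM (_ ^+ n)) (cabsM r%:C) cabsX cabs_real gtr0_norm//.
    by rewrite mulrC.
have ip N : cintble (fun x => W x * psum expc (w * L x) N).
  apply: cintble_le iWL _.
    by apply: cmeasM => //; exact: cmeas_psum.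
  move=> x; rewrite cabsM ler_wpM2l ?cabs_ge0//.
  by rewrite (le_trans (cabs_psum_expc _ _))// ler_expR.
have cE N : psum c w N = cint (fun x => W x * psum expc (w * L x) N).
  elim: N => [|N ih].
    rewrite /psum big_nil; apply: complex_eqE => /=;
      under eq_Rintegral do rewrite big_nil mulr0/=;
      by rewrite Rintegral_cst// mul0r.
  rewrite psum_recr ih /c mulrC -cintZ// -cintD//; last exact: cintbleZ.
  apply: eq_cint => x; rewrite psum_recr exprMn; ring.
have := @cint_dominated (fun N x => W x * psum expc (w * L x) N)
  (fun x => W x * cexp (w * L x))
  (fun x => cabs (W x) * expR (r * cabs (L x))).
rewrite /psums_to; under [X in _ -> X @ _ --> _]eq_fun do rewrite cE.
apply.
- by move=> n; exact: cintble_meas.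
- by apply: cmeasM => //; exact: cmeas_cexp.
- move=> x; have h := cexp_series (w * L x).
  apply: (cvg_cabs0_le (g := fun N => cabs (W x) *
      cabs (psum expc (w * L x) N - cexp (w * L x)))).
    by apply: nearW => N; rewrite -mulrBr cabsM.
  by rewrite -[0 in X in _ --> X](mulr0 (cabs (W x))); apply: cvgMr.
- exact: iWL.
- move=> N x; rewrite cabsM ler_wpM2l ?cabs_ge0//.
  by rewrite (le_trans (cabs_psum_expc _ _))// ler_expR.
Qed.

Lemma cint_cexp_analytic (W L : T -> R[i]) (r : R) s0 :
  cmeas W -> cmeas L -> 0 < r ->
  mu.-integrable setT
    (fun x => (cabs (W x * cexp (s0 * L x)) * expR (r * cabs (L x)))%:E) ->
  analytic_at (fun s => cint (fun x => W x * cexp (s * L x))) s0.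
Proof.
move=> mW mL r0 iWL; apply/analytic_atP; exists r => //.
have mW0 : cmeas (fun x => W x * cexp (s0 * L x)).
  by apply: cmeasM => //; apply: cmeas_cexp; exact: (cmeasM (cmeas_cst s0) mL).
exists (fun n => cint (fun x => W x * cexp (s0 * L x) * (expc n * L x ^+ n))).
move=> w /ltW wr.
have := cint_cexp_series mW0 mL r0 iWL wr.
congr psums_to; apply: eq_cint => x.
by rewrite mulrDl cexpD mulrA.
Qed.

(** Differentiation under the integral sign, in the form required by the chain
    rule [cder_comp_tail]. *)
Lemma cint_cexp_tail2 (W L : T -> R[i]) (r : R) s0 :
  cmeas W -> cmeas L -> 0 < r ->
  mu.-integrable setT
    (fun x => (cabs (W x * cexp (s0 * L x)) * expR (r * cabs (L x)))%:E) ->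
  let F s := cint (fun x => W x * cexp (s * L x)) in
  let F1 := cint (fun x => W x * L x * cexp (s0 * L x)) in
  exists rho M, 0 < rho /\ forall w, cabs w <= rho ->
    cabs (F (s0 + w) - F s0 - F1 * w) <= M * cabs w ^+ 2.
Proof.
move=> mW mL r0 iWL F F1.
have mW0 : cmeas (fun x => W x * cexp (s0 * L x)).
  by apply: cmeasM => //; apply: cmeas_cexp; exact: (cmeasM (cmeas_cst s0) mL).
pose c n := cint (fun x => W x * cexp (s0 * L x) * (expc n * L x ^+ n)).
have cF w : cabs w <= r -> psums_to c w (F (s0 + w)).
  move=> wr; have := cint_cexp_series mW0 mL r0 iWL wr.
  congr psums_to; apply: eq_cint => x.
  by rewrite mulrDl cexpD mulrA.
have [M M0 cM] : exists2 M, 0 < M & forall n, cabs (c n) * r ^+ n <= M.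
  have := cF r%:C; rewrite cabs_real gtr0_norm// => /(_ (lexx _)).
  by move=> /psums_to_bounded; rewrite cabs_real gtr0_norm.
exists (r / 2), (2 * M / r ^+ 2); split; first by rewrite divr_gt0.
move=> w wr.
have wr' : cabs w <= r by lra.
have := power_series_tail 2 r0 cM wr (cF w wr').
have -> : psum c w 2 = F s0 + F1 * w.
  rewrite /psum !big_nat_recr//= big_nil add0r expr0 mulr1 expr1; congr (_ + _ * _).
    by apply: eq_cint => x; rewrite /expc fact0 invr1 expr0 !mulr1.
  by apply: eq_cint => x; rewrite /expc invr1 mul1r expr1; ring.
by rewrite opprD addrA expr_div_n mulrA mulrAC.
Qed.

End cint.

Section fubini.
Context d1 d2 (T1 : measurableType d1) (T2 : measurableType d2) (R : realType).
Variable m1 : {sigma_finite_measure set T1 -> \bar R}.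
Variable m2 : {sigma_finite_measure set T2 -> \bar R}.
Variable f : T1 * T2 -> R[i].
Hypothesis fi : cintble (m1 \x m2)%E f.

Lemma cint_prod12 : (forall x, cintble m2 (fun y => f (x, y))) ->
  cint (m1 \x m2)%E f = cint m1 (fun x => cint m2 (fun y => f (x, y))).
Proof.
move=> fxi; have [fr fim] := fi; apply: complex_eqE => /=.
  rewrite {1}/Rintegral -integral12_prod_meas1// /Rintegral; congr fine.
  apply: eq_integral => x _; rewrite /fubini_F/= fineK//.
  by apply: integrable_fin_num => //; have [] := fxi x.
rewrite {1}/Rintegral -integral12_prod_meas1// /Rintegral; congr fine.
apply: eq_integral => x _; rewrite /fubini_F/= fineK//.
by apply: integrable_fin_num => //; have [] := fxi x.
Qed.

Lemma cint_prod21 : (forall y, cintble m1 (fun x => f (x, y))) ->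
  cint (m1 \x m2)%E f = cint m2 (fun y => cint m1 (fun x => f (x, y))).
Proof.
move=> fyi; have [fr fim] := fi; apply: complex_eqE => /=.
  rewrite {1}/Rintegral -integral21_prod_meas1// /Rintegral; congr fine.
  apply: eq_integral => x _; rewrite /fubini_G/= fineK//.
  by apply: integrable_fin_num => //; have [] := fyi x.
rewrite {1}/Rintegral -integral21_prod_meas1// /Rintegral; congr fine.
apply: eq_integral => x _; rewrite /fubini_G/= fineK//.
by apply: integrable_fin_num => //; have [] := fyi x.
Qed.

End fubini.

Section fubini_probability.
Context d1 d2 (T1 : measurableType d1) (T2 : measurableType d2) (R : realType).
Variable P : probability T1 R.
Variable m : {sigma_finite_measure set T2 -> \bar R}.

(** A majorant depending on the second variable only is integrable on the product,
    because the first measure has mass 1. *)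
Lemma cint_swap (f : T1 * T2 -> R[i]) (g : T2 -> R) : cmeas f ->
  m.-integrable setT (EFin \o g) -> (forall x y, cabs (f (x, y)) <= g y) ->
  cint P (fun x => cint m (fun y => f (x, y))) =
  cint m (fun y => cint P (fun x => f (x, y))).
Proof.
move=> mf gi fg.
have mfx x : cmeas (fun y => f (x, y)).
  have [fr fim] := mf; split.
    exact: (measurableT_comp fr (measurable_pair1 x)).
  exact: (measurableT_comp fim (measurable_pair1 x)).
have mfy y : cmeas (fun x => f (x, y)).
  have [fr fim] := mf; split.
    exact: (measurableT_comp fr (measurable_pair2 y)).
  exact: (measurableT_comp fim (measurable_pair2 y)).
have fi : cintble (P \x m)%E f.
  apply: (cintble_le (g := fun xy => g xy.2)) => //.
    have mg : measurable_fun setT (fun xy : T1 * T2 => (g xy.2)%:E).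
      by apply: (measurableT_comp (measurable_int _ gi)); exact: measurable_snd.
    apply/integrable12ltyP => //=.
    rewrite integral_cst//= probability_setT mule1.
    by have /integrableP[] := gi.
  by move=> [x y]; exact: fg.
rewrite -cint_prod12//.
  apply: cint_prod21 => // y.
  apply: (cintble_le (g := fun=> g y)) => //.
  exact: finite_measure_integrable_cst.
by move=> x; exact: cintble_le gi _.
Qed.

End fubini_probability.

(** * Principal logarithm and power *)

Section complex_log.
Context {R : realType}.
Implicit Types z w : R[i].

Lemma Re_div_cabs z : z != 0 -> -1 <= complex.Re z / cabs z <= 1.
Proof.
move=> z0; have a0 : 0 < cabs z by rewrite cabs_gt0.
rewrite -ler_norml normrM normfV (ger0_norm (cabs_ge0 z)).
by rewrite ler_pdivrMr// mul1r cabs_Re.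
Qed.

Lemma cargE z : carg z =
  if 0 <= complex.Im z then acos (complex.Re z / cabs z)
  else - acos (complex.Re z / cabs z).
Proof. by []. Qed.

Lemma cos_carg z : z != 0 -> cos (carg z) = complex.Re z / cabs z.
Proof.
move=> z0; rewrite cargE; have := Re_div_cabs z0.
by case: ifP => _ h; rewrite ?cosN acosK// in_itv/=.
Qed.

Lemma sin_carg z : z != 0 -> sin (carg z) = complex.Im z / cabs z.
Proof.
move=> z0; rewrite cargE; have h := Re_div_cabs z0.
have a0 : 0 < cabs z by rewrite cabs_gt0.
have s : sin (acos (complex.Re z / cabs z)) = `|complex.Im z| / cabs z.
  rewrite sin_acos//.
  have -> : 1 - (complex.Re z / cabs z) ^+ 2 = (complex.Im z / cabs z) ^+ 2.
    have e : cabs z ^+ 2 = complex.Re z ^+ 2 + complex.Im z ^+ 2.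
      by rewrite cabs_sqrt sqr_sqrtr// addr_ge0 ?sqr_ge0.
    apply: (@mulIf _ (cabs z ^+ 2)); first by rewrite sqrf_eq0 gt_eqF.
    rewrite mulrBl !expr_div_n !divfK ?sqrf_eq0 ?gt_eqF// e.
    by rewrite mul1r addrAC subrr add0r.
  by rewrite sqrtr_sqr normrM normfV (ger0_norm (cabs_ge0 z)).
case: ifPn => [i0|]; first by rewrite s ger0_norm.
by rewrite -ltNge => i0; rewrite sinN s ltr0_norm// mulNr opprK.
Qed.

Lemma clogE z : clog z = ln (cabs z) +i* carg z. Proof. by []. Qed.

Lemma cexp_clog z : z != 0 -> cexp (clog z) = z.
Proof.
move=> z0; have a0 : 0 < cabs z by rewrite cabs_gt0.
apply: complex_eqE; rewrite ?Re_cexp ?Im_cexp clogE/= lnK ?posrE//.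
  by rewrite cos_carg// mulrCA divff ?mulr1// gt_eqF.
by rewrite sin_carg// mulrCA divff ?mulr1// gt_eqF.
Qed.

Lemma carg_lepi z : `|carg z| <= pi.
Proof.
have [->|z0] := eqVneq z 0.
  rewrite cargE/= lexx mul0r acos0 ger0_norm ?divr_ge0 ?pi_ge0//.
  by rewrite ler_pdivrMr// mulr2n mulrDr mulr1 lerDl pi_ge0.
have h := Re_div_cabs z0; rewrite cargE.
have h1 := acos_ge0 h; have h2 := acos_lepi h.
by case: ifP => _; rewrite ?normrN ger0_norm.
Qed.

Lemma carg_pihalf z : 0 < complex.Re z -> `|carg z| < pi / 2.
Proof.
move=> z0; have zn0 : z != 0 by apply: contraTneq z0 => ->; rewrite /= ltxx.
have a0 : 0 < cabs z by rewrite cabs_gt0.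
have h := Re_div_cabs zn0; rewrite cargE.
have h1 := acos_ge0 h; have h2 := acos_lepi h.
suff : acos (complex.Re z / cabs z) < pi / 2.
  by case: ifP => _; rewrite ?normrN ger0_norm.
rewrite -ltr_cos ?in_itv/= ?h1 ?h2//; last first.
  by rewrite divr_ge0 ?pi_ge0//= ler_pdivrMr// mulr2n mulrDr mulr1 lerDl pi_ge0.
by rewrite cos_pihalf acosK ?in_itv//= divr_gt0.
Qed.

(** The path [z^t], for [t] between 0 and 1, joins 1 to [z] inside the right
    half-plane because [|arg z| < pi / 2]. *)
Lemma Re_cexp_clog_gt0 z t : 0 < complex.Re z -> 0 <= t <= 1 ->
  0 < complex.Re (cexp (t%:C * clog z)).
Proof.
move=> z0 /andP[t0 t1]; rewrite Re_cexp mulr_gt0 ?expR_gt0//.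
apply: cos_gt0_pihalf; rewrite -ltr_norml Im_mul/= mul0r addr0 normrM ger0_norm//.
by apply: le_lt_trans (carg_pihalf z0); rewrite ler_piMl.
Qed.

Lemma cpowE z s : z != 0 -> cpow z s = cexp (s * clog z).
Proof. by rewrite /cpow => /negPf ->. Qed.

(** [acos] is monotone only on [-1, 1]; precomposed with the projection to that
    interval it is monotone on the whole line, hence measurable. *)
Lemma measurable_acos_clamp d (T : measurableType d) (u : T -> R) :
  measurable_fun setT u -> (forall x, -1 <= u x <= 1) ->
  measurable_fun setT (fun x => acos (u x)).
Proof.
move=> mu u1.
pose clamp (v : R) : R := Num.max (-1) (Num.min 1 v).
have c1 v : -1 <= clamp v <= 1.
  by rewrite /clamp le_max lexx/= ge_max ge_min lexx andbT; lra.
have -> : (fun x => acos (u x)) = (fun v => acos (clamp v)) \o u.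
  apply/funext => x /=; congr acos; rewrite /clamp.
  by have /andP[h1 h2] := u1 x; rewrite (min_r h2) (max_r h1).
apply: measurableT_comp => //.
apply: nonincreasing_measurable => // v w vw.
have vw' : clamp v <= clamp w.
  by rewrite /clamp ge_max !le_max lexx/= le_min !ge_min lexx vw !orbT.
have hv := c1 v; have hw := c1 w.
rewrite leNgt -ltr_cos ?in_itv/= ?acos_ge0 ?acos_lepi//.
by rewrite !acosK ?in_itv//= -leNgt.
Qed.

Lemma cmeas_clog d (T : measurableType d) (f : T -> R[i]) :
  cmeas f -> cmeas (fun x => clog (f x)).
Proof.
move=> mf; have [fr fi] := mf; have ma := measurable_cabs mf.
split=> /=.
  by apply: measurableT_comp => //; exact: measurable_ln.
have -> : (fun x => carg (f x)) = fun x => if 0 <= complex.Im (f x)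
    then acos (complex.Re (f x) / cabs (f x))
    else - acos (complex.Re (f x) / cabs (f x)) by [].
have mac : measurable_fun setT (fun x => acos (complex.Re (f x) / cabs (f x))).
  apply: measurable_acos_clamp.
    apply: measurable_funM => //.
    under eq_fun do rewrite -powR_inv1 ?cabs_ge0//.
    exact: (measurableT_comp (@measurable_powR R (-1)) ma).
  move=> x; have [->|] := eqVneq (f x) 0; first by rewrite /= mul0r; lra.
  exact: Re_div_cabs.
apply: measurable_fun_ifT => //.
  exact: measurable_fun_ler.
exact: measurable_funN.
Qed.

Lemma cmeas_cpow d (T : measurableType d) (f : T -> R[i]) s :
  cmeas f -> cmeas (fun x => cpow (f x) s).
Proof.
move=> mf; have mc : cmeas (fun x => cexp (s * clog (f x))).
  by apply: cmeas_cexp; apply: cmeasM; [exact: cmeas_cst|exact: cmeas_clog].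
have mb : measurable_fun setT (fun x => f x == 0).
  have -> : (fun x => f x == 0) = (fun x => cabs (f x) == 0).
    by apply/funext => x; rewrite cabs_eq0.
  apply: measurable_fun_eqr => //; exact: measurable_cabs.
have [mcr mci] := mc; split; rewrite /cpow.
  under eq_fun do rewrite (fun_if (@complex.Re R)).
  by apply: measurable_fun_ifT => //; exact: measurable_cst.
under eq_fun do rewrite (fun_if (@complex.Im R)).
by apply: measurable_fun_ifT => //; exact: measurable_cst.
Qed.

End complex_log.

(** * The Gamma integral on the right half-plane *)

Section gamma.
Context {R : realType}.
Notation leb := (@lebesgue_measure R).
Implicit Types (p y t : R) (z : R[i]).

(** The weight [t^p] extended by 0 to the negative half-line, so that all integrals
    of this part run over the whole line. *)
Definition halfpow p t : R := if 0 < t then t `^ p else 0.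

Lemma halfpow_ge0 p t : 0 <= halfpow p t.
Proof. by rewrite /halfpow; case: ifP => // _; exact: powR_ge0. Qed.

Lemma measurable_halfpow p : measurable_fun setT (halfpow p).
Proof.
apply: measurable_fun_ifT => //; first exact: measurable_fun_ltr.
Qed.

Lemma halfpowS p t : halfpow p t * t = halfpow (p + 1) t.
Proof.
rewrite /halfpow; case: ifPn => [t0|_]; last by rewrite mul0r.
by rewrite powRD ?powRr1 ?ltW// (gt_eqF t0) implybT.
Qed.

(** Apply [ln x <= x] to [x = t y / p]. *)
Lemma halfpow_le p y : 0 < p -> 0 < y ->
  exists2 C, 0 < C & forall t, halfpow p t <= C * expR (y * t).
Proof.
move=> p0 y0; pose c := y / p.
have c0 : 0 < c by rewrite divr_gt0.
exists (expR (- (p * ln c))); first exact: expR_gt0.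
move=> t; rewrite -expRD /halfpow; case: ifPn => [t0|_]; last exact: expR_ge0.
rewrite /powR (gt_eqF t0) ler_expR.
have : ln (t * c) <= t * c.
  have tc : 0 < t * c by rewrite mulr_gt0.
  by rewrite -ler_expR lnK ?posrE// (le_trans _ (expR_ge1Dx _))// lerDr.
rewrite lnM ?posrE// => /(ler_wpM2l (ltW p0)).
have -> : p * (t * c) = y * t by rewrite /c; field; rewrite gt_eqF.
by rewrite mulrDr => h; lra.
Qed.

Lemma integrable_halfpow p y : 0 < p -> 0 < y ->
  leb.-integrable setT (fun t => (halfpow p t * expR (- (y * t)))%:E).
Proof.
move=> p0 y0; have y20 : 0 < y / 2 by rewrite divr_gt0.
have [C C0 hC] := halfpow_le p0 y20.
have := integrableZl measurableT (C / (y / 2)) (integrable_exponential_pdf y20).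
apply: le_integrable => //.
  apply/measurable_EFinP; apply: measurable_funM; first exact: measurable_halfpow.
  apply: measurableT_comp => //; apply: measurable_funN.
  by apply: measurable_funM => //; exact: measurable_cst.
move=> t _ /=; rewrite lee_fin ger0_norm; last first.
  by rewrite mulr_ge0 ?halfpow_ge0 ?expR_ge0.
apply: le_trans (ler_norm _).
have [t0|t0] := ltP 0 t; last first.
  rewrite /halfpow ltNge t0/= mul0r mulr_ge0 ?exponential_pdf_ge0 ?ltW//.
  by rewrite divr_gt0.
rewrite exponential_pdfE ?(ltW t0)// mulrA divfK ?gt_eqF//.
apply: (le_trans (ler_wpM2r (expR_ge0 _) (hC t))).
by rewrite -[leLHS]mulrA -expRD ler_wpM2l ?(ltW C0)// ler_expR; lra.
Qed.

(** Euler's integral of [t^p e^(-tz)] over the positive half-line, that is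
    [Gamma(p+1) z^-(p+1)]. *)
Definition gammaI p z : R[i] :=
  cint leb (fun t => (halfpow p t)%:C * cexp (z * (- t%:C))).

Lemma cmeas_halfpow p : cmeas (fun t : R => (halfpow p t)%:C).
Proof. by apply: cmeas_real; exact: measurable_halfpow. Qed.

Lemma cmeas_negid : cmeas (fun t : R => - t%:C).
Proof. by apply: cmeasN; apply: cmeas_real; exact: measurable_id. Qed.

Lemma cabs_halfpow_cexp p z t :
  cabs ((halfpow p t)%:C * cexp (z * (- t%:C))) = halfpow p t * expR (- (complex.Re z * t)).
Proof.
rewrite cabsM cabs_real cabs_cexp ger0_norm ?halfpow_ge0//.
by rewrite mulrN Re_opp Re_mul/= mulr0 subr0.
Qed.

Lemma gammaI_cintble p z : 0 < p -> 0 < complex.Re z ->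
  cintble leb (fun t => (halfpow p t)%:C * cexp (z * (- t%:C))).
Proof.
move=> p0 z0; apply: (cintble_le _ (integrable_halfpow p0 z0)).
  apply: cmeasM; first exact: cmeas_halfpow.
  by apply: cmeas_cexp; apply: cmeasM; [exact: cmeas_cst|exact: cmeas_negid].
by move=> t; rewrite cabs_halfpow_cexp.
Qed.

Lemma gammaI_dominated p z : 0 < p -> 0 < complex.Re z ->
  leb.-integrable setT (fun t => (cabs ((halfpow p t)%:C * cexp (z * (- t%:C))) *
     expR (complex.Re z / 2 * cabs (- t%:C)))%:E).
Proof.
move=> p0 z0; have z20 : 0 < complex.Re z / 2 by rewrite divr_gt0.
have := integrable_halfpow p0 z20.
apply: eq_integrable => // t _; congr (_%:E).
rewrite cabs_halfpow_cexp cabsN cabs_real -[in RHS]mulrA -[in RHS]expRD.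
have [t0|t0] := ltP 0 t; last by rewrite /halfpow ltNge t0 !mul0r.
by rewrite gtr0_norm//; congr (_ * expR _); lra.
Qed.

(** The derivative of [gammaI p] is [- gammaI (p + 1)]. *)
Lemma gammaI_tail2 p z : 0 < p -> 0 < complex.Re z ->
  exists rho M, 0 < rho /\ forall w, cabs w <= rho ->
    cabs (gammaI p (z + w) - gammaI p z - (- gammaI (p + 1) z) * w) <= M * cabs w ^+ 2.
Proof.
move=> p0 z0; have z20 : 0 < complex.Re z / 2 by rewrite divr_gt0.
have [rho [M [rho0 h]]] :=
  @cint_cexp_tail2 _ (measurableTypeR R) R leb _ _ _ _ (cmeas_halfpow p) cmeas_negid z20
    (gammaI_dominated p0 z0).
exists rho, M; split => // w wr; have := h w wr.
congr (cabs (_ - _ * _) <= _).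
have p10 : 0 < p + 1 by rewrite addr_gt0.
rewrite -mulN1r -cintZ; last exact: gammaI_cintble.
by apply: eq_cint => t; rewrite -halfpowS rmorphM/=; ring.
Qed.

Lemma cder_powR_cexp p z t : 0 < t ->
  cder (fun u => (u `^ (p + 1))%:C * cexp (z * (- u%:C))) t
    (((p + 1) * t `^ p)%:C * cexp (z * (- t%:C)) +
     (t `^ (p + 1))%:C * (- z * cexp (z * (- t%:C)))).
Proof.
move=> t0; apply: cderM.
  split => /=.
    have := is_derive1_powR (p + 1) t0.
    by rewrite addrK.
  exact: is_derive_cst.
apply: cder_cexp.
have := cder_lin (- z) t.
by congr cder; apply/funext => u; ring.
Qed.

(** The fundamental theorem of calculus with right limits at the lower end, where
    [t^p] need not be differentiable. *)
Lemma Rintegral_FTC (G H : R -> R) (b : R) : 0 < b ->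
  (forall t, 0 < t -> is_derive t (1 : R) G (H t)) ->
  (forall t, 0 < t -> {for t, continuous H}) ->
  H t @[t --> 0^'+] --> H 0 -> G t @[t --> 0^'+] --> G 0 ->
  \int[leb]_(t in `[0, b]) H t = G b - G 0.
Proof.
move=> b0 GH cH H0 G0.
have cG t : 0 < t -> {for t, continuous G}.
  move=> t0; apply/differentiable_continuous/derivable1_diffP.
  by have [] := GH _ t0.
rewrite /Rintegral (@continuous_FTC2 R H G 0 b b0).
- by rewrite -EFinB.
- apply/continuous_within_itvP => //; split => //.
    by move=> t; rewrite in_itv/= => /andP[t0 _]; exact: cH.
  by apply: cvg_at_left_filter; exact: cH.
- split => //.
    by move=> t; rewrite in_itv/= => /andP[t0 _]; have [] := GH _ t0.
  by apply: cvg_at_left_filter; exact: cG.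
- move=> t; rewrite in_itv/= => /andP[t0 _].
  by rewrite derive1E; have [_ ->] := GH _ t0.
Qed.

Lemma cder_continuous (f : R -> R[i]) t D : cder f t D ->
  {for t, continuous (fun u => complex.Re (f u))} /\
  {for t, continuous (fun u => complex.Im (f u))}.
Proof.
by move=> [[fr _] [fi _]]; split; apply/differentiable_continuous/derivable1_diffP.
Qed.

(** The functional equation of Gamma: integrate the derivative of
    [t^(p+1) e^(-tz)] over [0, n] and let [n] tend to infinity. *)
Lemma gammaI_rec p z : 0 < p -> 0 < complex.Re z ->
  z * gammaI (p + 1) z = (p + 1)%:C * gammaI p z.
Proof.
move=> p0 z0; have p10 : 0 < p + 1 by rewrite addr_gt0.
pose E t := cexp (z * (- t%:C)).
pose G t := (t `^ (p + 1))%:C * E t.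
pose Hp t := ((p + 1) * t `^ p)%:C * E t + (t `^ (p + 1))%:C * (- z * E t).
pose H t := (p + 1)%:C * ((halfpow p t)%:C * E t) - z * ((halfpow (p + 1) t)%:C * E t).
have i0 := gammaI_cintble p0 z0; have i1 := gammaI_cintble p10 z0.
have HE : cint leb H = (p + 1)%:C * gammaI p z - z * gammaI (p + 1) z.
  by rewrite /H cintB ?cintZ//; exact: cintbleZ.
suff H0 : cint leb H = 0 by apply/esym/eqP; rewrite -subr_eq0 -HE H0.
have cabsE1 t : 0 <= t -> cabs (E t) <= 1.
  move=> t0; rewrite cabs_cexp mulrN Re_opp Re_mul/= mulr0 subr0.
  by rewrite -expR0 ler_expR oppr_le0 mulr_ge0// ltW.
have HpH t : 0 <= t -> Hp t = H t.
  move=> t0; rewrite /Hp /H /halfpow lt_neqAle t0 andbT eq_sym.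
  case: eqVneq => [->|tn0] /=; rewrite ?powR0 ?(gt_eqF p0) ?(gt_eqF p10)// ?mulr0.
    by rewrite !mul0r !mulr0 addr0 subr0.
  by rewrite rmorphM/=; ring.
have GH t : 0 < t -> cder G t (Hp t) by move=> t0; exact: cder_powR_cexp.
have Hp0 : Hp 0 = 0.
  by rewrite /Hp !powR0 ?gt_eqF// mulr0 !mul0r addr0.
have G0 : G 0 = 0 by rewrite /G powR0 ?gt_eqF// mul0r.
have cp0 : t `^ p @[t --> 0^'+] --> (0 : R) := powR_cvg0 p0.
have cp1 : t `^ (p + 1) @[t --> 0^'+] --> (0 : R) := powR_cvg0 p10.
have cG0 : cabs (G t - G 0) @[t --> 0^'+] --> (0 : R).
  under eq_fun do rewrite G0 subr0.
  apply: (cvg_cabs0_le (g := fun t : R => t `^ (p + 1))) cp1.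
  near=> t; have t0 : 0 < t by near: t; exact: nbhs_right_gt.
  rewrite /G cabsM cabs_real ger0_norm ?powR_ge0// ler_piMr ?powR_ge0//.
  by rewrite cabsE1// ltW.
have cHp0 : cabs (Hp t - Hp 0) @[t --> 0^'+] --> (0 : R).
  under eq_fun do rewrite Hp0 subr0.
  apply: (cvg_cabs0_le (g := fun t : R => (p + 1) * t `^ p + cabs z * t `^ (p + 1))).
    near=> t; have t0 : 0 < t by near: t; exact: nbhs_right_gt.
    have h := cabsE1 _ (ltW t0).
    rewrite /Hp; apply: (le_trans (cabsD _ _)).
    rewrite (cabsM _ (E t)) (cabsM _ (- z * E t)) (cabsM (- z)) cabsN !cabs_real.
    rewrite !ger0_norm ?powR_ge0 ?mulr_ge0 ?powR_ge0 ?(ltW p10)//.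
    apply: lerD; first by rewrite ler_piMr// mulr_ge0 ?powR_ge0 ?(ltW p10).
    by rewrite mulrC ler_wpM2r ?powR_ge0// ler_piMr ?cabs_ge0.
  rewrite -[0 in X in _ --> X]addr0; apply: cvgD.
    by rewrite -[0 in X in _ --> X](mulr0 (p + 1)); exact: cvgMr.
  by rewrite -[0 in X in _ --> X](mulr0 (cabs z)); exact: cvgMr.
have cHp t : 0 < t -> exists D, cder Hp t D.
  move=> t0.
  have dE : cder E t (- z * E t).
    apply: cder_cexp; have := cder_lin (- z) t.
    by congr cder; apply/funext => u; ring.
  have dp q : cder (fun u : R => (u `^ q)%:C) t (q * t `^ (q - 1))%:C.
    by split => /=; [exact: is_derive1_powR|exact: is_derive_cst].
  have := cderD (cderM (cderZ (p + 1)%:C (dp p)) dE)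
    (cderM (dp (p + 1)) (cderZ (- z) dE)).
  set D := (X in cder _ _ X) => h; exists D; move: h.
  by congr cder; apply/funext => u; rewrite /Hp rmorphM.
pose f_ n t := if (0 <= t) && (t <= n%:R) then H t else 0.
have fG n : (0 < n)%N -> cint leb (f_ n) = G n%:R.
  move=> n0; have n0' : 0 < n%:R :> R by rewrite ltr0n.
  have patchf (u : R[i] -> R) : u 0 = 0 -> (fun t => u (f_ n t)) =
      (fun t => u (Hp t)) \_ `[0, n%:R].
    move=> u0; apply/funext => t; rewrite patchE mem_setE in_itv/= /f_.
    by case: ifPn => // /andP[t0 _]; rewrite HpH.
  apply: complex_eqE.
    rewrite [LHS]/= (patchf (@complex.Re R) erefl) -Rintegral_mkcond.
    transitivity (complex.Re (G n%:R) - complex.Re (G 0)); last first.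
      by rewrite G0 subr0.
    apply: (@Rintegral_FTC (fun t => complex.Re (G t))) => //.
    - by move=> t t0; have [] := GH _ t0.
    - by move=> t t0; have [D /cder_continuous[]] := cHp _ t0.
    - exact: cvg_cabs_Re cHp0.
    - exact: cvg_cabs_Re cG0.
  rewrite [LHS]/= (patchf (@complex.Im R) erefl) -Rintegral_mkcond.
  transitivity (complex.Im (G n%:R) - complex.Im (G 0)); last first.
    by rewrite G0 subr0.
  apply: (@Rintegral_FTC (fun t => complex.Im (G t))) => //.
  - by move=> t t0; have [] := GH _ t0.
  - by move=> t t0; have [D /cder_continuous[]] := cHp _ t0.
  - exact: cvg_cabs_Im cHp0.
  - exact: cvg_cabs_Im cG0.
have iH : cintble leb H.
  by rewrite /H; apply: cintbleD; [|apply: cintbleN]; exact: cintbleZ.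
have mH := cintble_meas iH.
have cf : cabs (cint leb (f_ n) - cint leb H) @[n --> \oo] --> (0 : R).
  apply: (@cint_dominated _ (measurableTypeR R) R leb f_ H (fun t => cabs (H t))) => //.
  - move=> n; have [mr mi] := mH; rewrite /f_; split.
      under eq_fun do rewrite (fun_if (@complex.Re R)).
      apply: measurable_fun_ifT => //; apply: measurable_and => //;
        exact: measurable_fun_ler.
    under eq_fun do rewrite (fun_if (@complex.Im R)).
    apply: measurable_fun_ifT => //; apply: measurable_and => //;
      exact: measurable_fun_ler.
  - move=> t; apply: (cvg_cabs0_le (g := fun=> 0)); last exact: cvg_cst.
    near=> n; have tn : t <= n%:R by near: n; exact: nbhs_infty_ger.
    rewrite /f_ tn andbT; case: (leP 0 t) => t0; first by rewrite subrr cabs0.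
    by rewrite /H /halfpow ltNge (ltW t0)/= !mul0r !mulr0 subr0 subr0 cabs0.
  - exact: cintble_cabs.
  - move=> n t; rewrite /f_; case: ifP => // _.
    by rewrite cabs0 cabs_ge0.
have x20 : 0 < complex.Re z / 2 by rewrite divr_gt0.
have [C C0 hC] := halfpow_le p10 x20.
have cG : cabs (G n%:R) @[n --> \oo] --> (0 : R).
  apply: (cvg_cabs0_le (g := fun n => C * (expR (- (complex.Re z / 2))) ^+ n)).
    near=> n; have n0 : (0 < n)%N by near: n; exact: nbhs_infty_gt.
    have n0' : 0 < n%:R :> R by rewrite ltr0n.
    have := hC n%:R; rewrite /halfpow n0' => h.
    rewrite /G cabsM cabs_real ger0_norm ?powR_ge0// cabs_cexp.
    apply: (le_trans (ler_wpM2r (expR_ge0 _) h)).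
    rewrite -[leLHS]mulrA -expRD ler_wpM2l ?(ltW C0)// -expRM_natl ler_expR.
    by rewrite mulrN Re_opp Re_mul/= mulr0 subr0; lra.
  rewrite -[0 in X in _ --> X](mulr0 C); apply: cvgMr; apply: cvg_expr.
  by rewrite ger0_norm ?expR_ge0// expR_lt1 oppr_lt0.
have : (cabs (cint leb H)) @[n --> \oo] --> (0 : R).
  apply: (cvg_cabs0_le (g := fun n => cabs (cint leb (f_ n) - cint leb H) +
    cabs (G n%:R))); last by rewrite -[0 in X in _ --> X]addr0; exact: cvgD.
  near=> n; have n0 : (0 < n)%N by near: n; exact: nbhs_infty_gt.
  rewrite fG// cabsBC -{1}(subrK (G n%:R) (cint leb H)); exact: cabsD.
move=> h; apply/eqP; rewrite -cabs_eq0; apply/eqP.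
by apply: (cvg_unique _ _ h) => //; exact: cvg_cst.
Unshelve. all: by end_near. Qed.

(** Along the path [z^t] the derivative of [gammaI p (z^t) z^(t(p+1))] is zero, by
    [gammaI_rec] and the formula for the derivative of [gammaI]; its values at
    the ends of the path give the claim. *)
Lemma gammaI_cpow p z : 0 < p -> 0 < complex.Re z ->
  gammaI p z = gammaI p 1 * cpow z (- (p + 1)%:C).
Proof.
move=> p0 z0; have zn0 : z != 0 by apply: contraTneq z0 => ->; rewrite /= ltxx.
pose l := clog z.
pose g (t : R) := gammaI p (cexp (t%:C * l)) * cexp (t%:C * ((p + 1)%:C * l)).
have g01 : g 1 = g 0.
  apply: cder0_eq => t t01.
  have zt0 := Re_cexp_clog_gt0 z0 t01; rewrite -/l in zt0.
  have [rho [M [rho0 hM]]] := gammaI_tail2 p0 zt0.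
  have d1 := cder_comp_tail rho0 hM erefl (cder_cexp (cder_lin l t)).
  have d2 := cder_cexp (cder_lin ((p + 1)%:C * l) t).
  have := cderM d1 d2; congr cder.
  have h := gammaI_rec p0 zt0.
  set F1 := gammaI (p + 1) _ in h *; set F0 := gammaI p _ in h *.
  set ct := cexp (t%:C * l) in h *.
  have -> : - F1 * (l * ct) = - l * (ct * F1) by ring.
  by rewrite h; ring.
move: g01; rewrite /g !mul1r !mul0r !cexp0 mulr1 cexp_clog// => <-.
rewrite cpowE// -mulrA -cexpD -/l mulNr subrr cexp0 mulr1 //.
Qed.

(** This is [Gamma(p+1)]; being nonzero, it can be cancelled. *)
Lemma gammaI1_gt0 p : 0 < p -> 0 < complex.Re (gammaI p 1).
Proof.
move=> p0; rewrite /gammaI/=.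
have -> : (fun t => complex.Re ((halfpow p t)%:C * cexp (1 * (- t%:C)))) =
    (fun t => halfpow p t * expR (- t)).
  apply/funext => t; rewrite mul1r Re_mul Re_cexp/=.
  by rewrite mul0r subr0 oppr0 cos0 mulr1.
have h := integrable_halfpow p0 ltr01.
have {}h : leb.-integrable setT (fun t => (halfpow p t * expR (- t))%:E).
  by apply: eq_integrable h => // t _; rewrite mul1r.
(* the integrand is at least [e^-2] on [1, 2] *)
pose g : R -> R := fun t => expR (- 2) * \1_(`[1, 2]%classic : set R) t.
have gi : leb.-integrable setT (EFin \o g).
  have := integrableZl measurableT (expR (- 2)) (@integrable_indic_itv R 1 2 true false).
  by apply: eq_integrable.
apply: (@lt_le_trans _ _ (\int[leb]_t g t)).
  rewrite RintegralZl//; last exact: integrable_indic_itv.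
  rewrite mulr_gt0 ?expR_gt0// /Rintegral integral_indic//= setIT.
  by rewrite lebesgue_measure_itv/= lte_fin ltr1n/= subr_gt0 ltr1n.
apply: le_Rintegral => // t _; rewrite /g indicE.
case: (boolP (t \in _)) => [|_]; last by rewrite mulr0 mulr_ge0 ?halfpow_ge0 ?expR_ge0.
rewrite mem_setE in_itv/= => /andP[t1 t2]; rewrite mulr1.
have t0 : 0 < t by rewrite (lt_le_trans _ t1).
rewrite -[leLHS]mul1r; apply: ler_pM => //; rewrite ?expR_ge0//.
  by rewrite /halfpow t0 -(powRr0 t) ler_powR// ltW.
by rewrite ler_expR; lra.
Qed.

End gamma.

(** * Hyperbolic functions and the density of X *)

Section hyperbolic.
Context {R : realType}.
Implicit Types x y : R.

Lemma measurable_invr d (T : measurableType d) (u : T -> R) :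
  measurable_fun setT u -> measurable_fun setT (fun w => (u w)^-1).
Proof.
move=> mu.
have -> : (fun w => (u w)^-1) = (fun w => u w * ((u w ^+ 2) `^ (-1))).
  apply/funext => x; rewrite powR_inv1 ?sqr_ge0//.
  have [->|u0] := eqVneq (u x) 0; first by rewrite invr0 mul0r.
  by rewrite expr2 invfM mulrA divff// mul1r.
apply: measurable_funM => //.
exact: (measurableT_comp (@measurable_powR R (-1)) (measurable_funX 2 mu)).
Qed.

Lemma measurable_sinh : measurable_fun setT (@sinh R).
Proof.
apply: measurable_funM; last exact: measurable_cst.
apply: measurable_funB; first exact: measurable_expR.
by apply: measurableT_comp => //; exact: measurable_funN.
Qed.

Lemma measurable_cosh : measurable_fun setT (@cosh R).
Proof.
apply: measurable_funM; last exact: measurable_cst.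
apply: measurable_funD; first exact: measurable_expR.
by apply: measurableT_comp => //; exact: measurable_funN.
Qed.

Lemma measurable_pdf_sinh : measurable_fun setT (@pdf_sinh R).
Proof.
have mp : measurable_fun setT (fun x : R => pi * x).
  by apply: measurable_funM => //; exact: measurable_cst.
have ms : measurable_fun setT (fun x : R => sinh (pi * x)).
  exact: (measurableT_comp measurable_sinh mp).
apply: measurable_funM.
  apply: measurable_funM; first exact: measurable_cst.
  apply: measurable_funB; last exact: measurable_cst.
  apply: measurable_funM => //; apply: measurable_funM.
    exact: (measurableT_comp measurable_cosh mp).
  exact: measurable_invr.
by apply: measurable_invr; exact: measurable_funX.
Qed.

Lemma measurable_charS2 : measurable_fun setT (@charS2 R).
Proof.
apply: measurable_fun_ifT; last 2 first.
- exact: measurable_cst.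
- apply: measurable_funX; apply: measurable_funM => //.
  by apply: measurable_invr; exact: measurable_sinh.
- by apply: measurable_fun_eqr => //; exact: measurable_cst.
Qed.

Lemma sinhN x : sinh (- x) = - sinh x.
Proof. by rewrite /sinh opprK -mulNr opprB. Qed.

Lemma coshN x : cosh (- x) = cosh x.
Proof. by rewrite /cosh opprK addrC. Qed.

Lemma is_derive_sinh x : is_derive x 1 (@sinh R) (cosh x).
Proof.
have eN : is_derive x 1 (fun y : R => expR (- y)) (- expR (- x)).
  have := is_derive1_comp (is_derive_expR (- x)) (is_deriveNid x 1).
  by rewrite mulrN1.
have := is_deriveZ (2^-1) (is_deriveB (is_derive_expR x) eN).
have -> : 2^-1 \*: (expR - (fun y : R => expR (- y))) = @sinh R.
  by apply/funext => y; rewrite /sinh /= mulrC.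
by rewrite /GRing.scale/= opprK /cosh mulrC.
Qed.

Lemma is_derive_cosh x : is_derive x 1 (@cosh R) (sinh x).
Proof.
have eN : is_derive x 1 (fun y : R => expR (- y)) (- expR (- x)).
  have := is_derive1_comp (is_derive_expR (- x)) (is_deriveNid x 1).
  by rewrite mulrN1.
have := is_deriveZ (2^-1) (is_deriveD (is_derive_expR x) eN).
have -> : 2^-1 \*: (expR + (fun y : R => expR (- y))) = @cosh R.
  by apply/funext => y; rewrite /cosh /= mulrC.
by rewrite /GRing.scale/= /sinh mulrC.
Qed.

Lemma ge0_from_derive (g dg : R -> R) y : (forall x, is_derive x (1 : R) g (dg x)) ->
  (forall x, 0 < x -> 0 <= dg x) -> g 0 = 0 -> 0 <= y -> 0 <= g y.
Proof.
move=> gd dg0 g0; rewrite le_eqVlt => /predU1P[<-|y0]; first by rewrite g0.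
have [|c] := @MVT R g dg 0 y y0 (fun x _ => gd x).
  apply: derivable_within_continuous => x _.
  by have [] := gd x.
rewrite in_itv/= g0 !subr0 => /andP[c0 _] ->.
by rewrite mulr_ge0 ?dg0// ltW.
Qed.

Lemma sinh_ge0 y : 0 <= y -> 0 <= sinh y.
Proof.
by move=> y0; rewrite /sinh divr_ge0// subr_ge0 ler_expR; lra.
Qed.

Lemma cosh_ge1 y : 1 <= cosh y.
Proof.
rewrite /cosh ler_pdivlMr// mul1r.
have e1 : expR (y / 2) * expR (- (y / 2)) = 1 by rewrite -expRD subrr expR0.
have -> : expR y = expR (y / 2) ^+ 2 by rewrite expr2 -expRD; congr expR; lra.
have -> : expR (- y) = expR (- (y / 2)) ^+ 2 by rewrite expr2 -expRD; congr expR; lra.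
have := sqr_ge0 (expR (y / 2) - expR (- (y / 2))).
by rewrite sqrrB e1; lra.
Qed.

Lemma sinh_ge y : 0 <= y -> y <= sinh y.
Proof.
move=> y0; rewrite -subr_ge0.
apply: (@ge0_from_derive (fun x => sinh x - x) (fun x => cosh x - 1)) => //.
- by move=> x; exact: (is_deriveB (is_derive_sinh x) (is_derive_id x 1)).
- by move=> x _; rewrite subr_ge0 cosh_ge1.
- by rewrite subr0 /sinh oppr0 subrr mul0r.
Qed.

Lemma sinh_le_cosh y : 0 <= y -> sinh y <= y * cosh y.
Proof.
move=> y0; rewrite -subr_ge0.
apply: (@ge0_from_derive (fun x => x * cosh x - sinh x) (fun x => x * sinh x)) => //.
- move=> x; have := is_deriveB (is_deriveM (is_derive_id x 1) (is_derive_cosh x))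
    (is_derive_sinh x).
  by rewrite /GRing.scale/= mulr1 addrK.
- by move=> x x0; rewrite mulr_ge0 ?sinh_ge0// ltW.
- by rewrite /sinh oppr0 subrr !mul0r subr0.
Qed.

Lemma cosh_le_sinh y : 0 <= y -> cosh y - 1 <= y * sinh y.
Proof.
move=> y0; rewrite -subr_ge0.
apply: (@ge0_from_derive (fun x => x * sinh x - (cosh x - 1)) (fun x => x * cosh x)) => //.
- move=> x; have := is_deriveB (is_deriveM (is_derive_id x 1) (is_derive_sinh x))
    (is_deriveB (is_derive_cosh x) (is_derive_cst (1 : R) x 1)).
  by rewrite /GRing.scale/= mulr1 subr0 addrK.
- by move=> x x0; rewrite mulr_ge0 ?(le_trans ler01 (cosh_ge1 _))// ltW.
- by rewrite /cosh oppr0 expR0 mul0r sub0r -mulr2n divff// subrr oppr0.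
Qed.

(** The function [y / sinh y] decays at least like [4 e^(-y/2)]; the exponent 1/2
    leaves room for the factor [y]. *)
Lemma sinh_lower y : 0 <= y -> y * expR (y / 2) <= 4 * sinh y.
Proof.
move=> y0; have e1 : expR y * expR (- y) = 1 by rewrite -expRD subrr expR0.
have h1 := expR_ge1Dx (2 * y); have h2 := expR_ge1Dx (y / 2).
have e2 : expR (2 * y) = expR y * expR y by rewrite -expRD; congr expR; lra.
have e3 : expR (y / 2) * expR (y / 2) = expR y by rewrite -expRD; congr expR; lra.
rewrite /sinh.
have b0 := expR_gt0 (- y); have a0 := expR_gt0 y; have c0 := expR_gt0 (y / 2).
have E : 4 * ((expR y - expR (- y)) / 2) = 2 * expR (- y) * (expR (2 * y) - 1).
  rewrite e2 mulrBr mulr1 -!mulrA [expR (- y) * _]mulrCA mulrA [expR (- y) * _]mulrC.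
  by rewrite e1; field.
(* with c = e^(y/2): b = c^-2 and the claim is y c^3 <= 2 (c^4 - 1) *)
set c := expR (y / 2) in e3 h2 c0 *.
set b := expR (- y) in e1 b0 E *.
rewrite E e2 -e3.
have cb : c * c * b = 1 by rewrite e3.
have c1 : 1 + y / 2 <= c by [].
suff H : y * (c * c * c) <= 2 * (c * c * (c * c) - 1).
  have -> : y * c = y * (c * c * c) * b by rewrite -(mulr1 (y * c)) -cb; ring.
  have -> : 2 * b * (c * c * (c * c) - 1) = 2 * (c * c * (c * c) - 1) * b by ring.
  by rewrite ler_wpM2r// ltW.
have : 0 <= (c - 1 - y / 2) * (c * c * c).
  by apply: mulr_ge0; [lra|rewrite !mulr_ge0 ?(ltW c0)].
have c1' : 1 <= c by lra.
have c2 : 1 <= c * c by nra.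
have c3 : 1 <= c * c * c by nra.
by move=> h; lra.
Qed.

Lemma charS2_le (t : R) : 0 < t -> charS2 t <= 16 * expR (- t).
Proof.
move=> t0; rewrite /charS2 gt_eqF//.
have s0 : 0 < sinh t by rewrite (lt_le_trans t0)// sinh_ge// ltW.
have h := sinh_lower (ltW t0).
have c0 := expR_gt0 (t / 2).
have h1 : t / sinh t <= 4 * (expR (t / 2))^-1.
  by rewrite ler_pdivrMr// mulrAC ler_pdivlMr.
have -> : 16 * expR (- t) = (4 * (expR (t / 2))^-1) ^+ 2.
  rewrite -expRN exprMn expr2 -[in RHS]expRM_natl; congr (_ * expR _); lra.
apply: lerXn2r => //; rewrite nnegrE; first by rewrite divr_ge0 ?(ltW t0) ?(ltW s0).
by rewrite mulr_ge0 ?invr_ge0 ?(ltW c0).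
Qed.

Lemma charS2_ge0 (t : R) : 0 <= charS2 t.
Proof. by rewrite /charS2; case: ifP => // _; exact: sqr_ge0. Qed.

Lemma pdf_sinhN x : pdf_sinh (- x) = pdf_sinh x.
Proof.
rewrite /pdf_sinh mulrN sinhN sqrrN /coth coshN sinhN.
by rewrite invrN mulrN mulrNN.
Qed.

Lemma pdf_sinh_abs x : pdf_sinh `|x| = pdf_sinh x.
Proof. by have [?|?] := ger0P x; rewrite ?pdf_sinhN. Qed.

(** With [y = pi |x|] one has [0 <= y coth y - 1 <= y^2], so the density is at most
    [pi (y / sinh y)^2], and [charS2_le] applies. *)
Lemma pdf_sinh_bounds x : 0 <= pdf_sinh x <= 16 * pi * expR (- (pi * `|x|)).
Proof.
rewrite -(pdf_sinh_abs x); set v := `|x|.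
have v0 : 0 <= v by exact: normr_ge0.
have p0 : 0 < (pi : R) := pi_gt0 R.
have [->|vn0] := eqVneq v 0.
  rewrite /pdf_sinh mulr0 /sinh oppr0 subrr !mul0r expr0n/= invr0 mulr0 lexx/=.
  by rewrite !mulr_ge0 ?expR_ge0// ltW.
have vp : 0 < v by rewrite lt_neqAle eq_sym vn0.
set y := pi * v; have y0 : 0 < y by rewrite mulr_gt0.
have hs := sinh_ge (ltW y0); have s0 : 0 < sinh y by rewrite (lt_le_trans y0).
have hc := sinh_le_cosh (ltW y0); have hd := cosh_le_sinh (ltW y0).
have num : y * coth y - 1 = (y * cosh y - sinh y) / sinh y.
  by rewrite /coth; field; rewrite gt_eqF.
rewrite /pdf_sinh -/y num; apply/andP; split.
  rewrite divr_ge0 ?sqr_ge0// mulr_ge0 ?(ltW p0)//.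
  by rewrite divr_ge0 ?subr_ge0 ?(ltW s0).
have h1 : (y * cosh y - sinh y) / sinh y <= y ^+ 2.
  rewrite ler_pdivrMr//.
  have : y * (cosh y - 1) <= y * (y * sinh y) by rewrite ler_wpM2l// ltW.
  by rewrite expr2; lra.
have h2 : y ^+ 2 / sinh y ^+ 2 <= 16 * expR (- y).
  by have := charS2_le y0; rewrite /charS2 gt_eqF// expr_div_n.
rewrite -mulrA; apply: (@le_trans _ _ (pi * (y ^+ 2 / sinh y ^+ 2))).
  by rewrite ler_wpM2l ?(ltW p0)// ler_wpM2r// invr_ge0 sqr_ge0.
have -> : 16 * pi * expR (- y) = pi * (16 * expR (- y)) by ring.
by rewrite ler_wpM2l ?(ltW p0).
Qed.

End hyperbolic.

(** * Random variables with a density; independent pairs *)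

Section density.
Context d {T : measurableType d} {R : realType} (P : probability T R).
Notation leb := (@lebesgue_measure R).
Variables (X : {RV P >-> R}) (f : R -> R).
Hypotheses (Xf : has_pdf X f) (mf : measurable_fun setT f) (f0 : forall x, 0 <= f x).

Lemma pdf_itv_le (C a b : R) : a <= b -> (forall x, a <= x <= b -> f x <= C) ->
  (P (X @^-1` `[a, b]%classic) <= (C * (b - a))%:E)%E.
Proof.
move=> ab fC; have := Xf (measurable_itv `[a, b]%R).
rewrite /distribution/= /pushforward => ->.
apply: (@le_trans _ _ (\int[leb]_(x in `[a, b]) C%:E)%E).
  apply: ge0_le_integral => //=.
  - by move=> x _; rewrite lee_fin.
  - by apply/measurable_EFinP; exact: measurable_funTS.
rewrite integral_cst//= lebesgue_measure_itv/= lte_fin.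
have [ab'|ba] := ltP a b; first by rewrite -EFinD -EFinM.
by rewrite mule0 lee_fin (le_anti (introT andP (conj ab ba))) subrr mulr0.
Qed.

(** The Lebesgue measure lives on [measurableTypeR R], whose measurable sets are
    those of [R] but which is a different structure; densities with respect to it
    require a variable with values there. *)
Definition borelRV : T -> measurableTypeR R := X.

Lemma measurable_borelRV : measurable_fun setT borelRV.
Proof. exact: (measurable_funPT X). Qed.

HB.instance Definition _ :=
  isMeasurableFun.Build _ _ _ _ borelRV measurable_borelRV.

Let nu := distribution P borelRV.

Lemma pdf_dominates : nu `<< leb.
Proof.
apply/null_content_dominatesP => A mA A0.
have -> : nu A = (\int[leb]_(x in A) (f x)%:E)%E by exact: Xf.
by apply: null_set_integral => //; apply/measurable_EFinP; exact: measurable_funTS.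
Qed.

(** A density is almost everywhere the Radon-Nikodym derivative of the law. *)
Lemma integral_pdf (g : R -> R) (B : R) : measurable_fun setT g ->
  (forall x, `|g x| <= B) ->
  \int[P]_w g (X w) = \int[leb]_x (g x * f x).
Proof.
move=> mg gB; congr fine.
have mg' : measurable_fun [set: measurableTypeR R] (fun x => (g x)%:E).
  exact/measurable_EFinP.
have gi : nu.-integrable setT (fun x => (g x)%:E).
  apply: (@le_integrable _ _ _ _ _ measurableT _ (fun=> B%:E)) => //.
  - by move=> x _ /=; rewrite lee_fin (le_trans (gB x))// ler_norm.
  - exact: finite_measure_integrable_cst.
have -> : (\int[P]_w (g (X w))%:E = \int[nu]_x (g x)%:E)%E.
  rewrite integral_distribution//.
  have := @finite_measure_integrable_cst _ T R P setT B measurableT.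
  apply: le_integrable => //.
    by apply/measurable_EFinP; exact: (measurableT_comp mg).
  by move=> w _ /=; rewrite lee_fin (le_trans (gB _))// ler_norm.
rewrite -(Radon_Nikodym_change_of_variables pdf_dominates measurableT gi).
have mf' : measurable_fun [set: measurableTypeR R] (fun x => (f x)%:E).
  exact/measurable_EFinP.
under [RHS]eq_integral do rewrite EFinM.
apply: ae_eq_integral => //.
- apply: emeasurable_funM => //.
  by apply: (measurable_int leb); apply: Radon_Nikodym_integrable; exact: pdf_dominates.
- exact: emeasurable_funM.
- apply: ae_eqe_mul2l => /=.
  rewrite Radon_NikodymE//=; first exact: pdf_dominates.
  move=> numu; case: cid => /= h [h1 h2 h3].
  apply: integral_ae_eq => //= E _ mE; rewrite -h3//=.
  exact: Xf.
Qed.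

End density.

Section layers.
Context d {T : measurableType d} {R : realType} (P : probability T R).

(** The function is dominated by 1 plus the sum of the [c k] over the layers [A k],
    whose expectation is at most a geometric series. *)
Lemma layer_integrable (h : T -> R) (A : nat -> set T) (c : nat -> R) (K q : R) :
  measurable_fun setT h -> (forall w, 0 <= h w) -> (forall k, measurable (A k)) ->
  (forall k, 0 <= c k) -> 0 <= K -> 0 < q < 1 ->
  (forall k, ((c k)%:E * P (A k) <= (K * q ^+ k)%:E)%E) ->
  (forall w, h w <= 1 \/ exists2 k, A k w & h w <= c k) ->
  P.-integrable setT (fun w => (h w)%:E).
Proof.
move=> mh h0 mA c0 K0 /andP[q0 q1] cP hc.
apply/integrableP; split; first exact/measurable_EFinP.
pose f k w := (c k * \1_(A k) w)%:E.
have f0 k w : (0 <= f k w)%E by rewrite lee_fin mulr_ge0.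
have mf k : measurable_fun setT (f k).
  by apply/measurable_EFinP; apply: measurable_funM => //; exact: measurable_cst.
have ms : measurable_fun setT (fun w => \sum_(k <oo) f k w)%E.
  exact: ge0_emeasurable_sum.
apply: (@le_lt_trans _ _ (\int[P]_w (1 + \sum_(k <oo) f k w))%E).
  apply: ge0_le_integral => //.
  - by apply/measurable_EFinP; exact: measurableT_comp.
  - by apply: emeasurable_funD => //; exact: measurable_cst.
  - move=> w _; rewrite gee0_abs ?lee_fin//.
    have s0 : (0 <= \sum_(k <oo) f k w)%E by exact: nneseries_ge0.
    case: (hc w) => [h1|[k Ak hk]].
      by rewrite -[leLHS]adde0 leeD// lee_fin.
    rewrite -[leLHS]add0e leeD//.
    apply: (@le_trans _ _ (\sum_(0 <= i < k.+1) f i w)%E); last first.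
      exact: nneseries_lim_ge.
    rewrite big_nat_recr//= -[leLHS]add0e leeD ?sume_ge0//.
    by rewrite /f indicE mem_set// mulr1 lee_fin.
rewrite ge0_integralD//; last by move=> w _; exact: nneseries_ge0.
rewrite integral_cst//= probability_setT mule1 integral_nneseries//.
apply: (@le_lt_trans _ _ (1 + (K / (1 - q))%:E)%E); last by rewrite -EFinD ltry.
rewrite leeD2l//; apply: lime_le.
  by apply: is_cvg_nneseries => k _ _; exact: integral_ge0.
apply: nearW => n.
apply: (@le_trans _ _ (\sum_(0 <= k < n) (K * q ^+ k)%:E)%E).
  apply: lee_sum => k _; rewrite /f.
  under eq_integral do rewrite EFinM.
  rewrite ge0_integralZl_EFin//; first by rewrite integral_indic// setIT; exact: cP.
  exact/measurable_EFinP.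
rewrite sumEFin lee_fin; apply: (geometric_le_lim n K0 q0).
by rewrite gtr0_norm.
Qed.

(** Negative moments of order below 1 are finite for a variable with bounded density
    at 0: on the layer [|Y| <= e^-k] the integrand is at most [e^(b(k+1))] and the
    layer has probability at most [C e^-k]. *)
Lemma inv_power_integrable (Y : T -> R) (C b : R) : measurable_fun setT Y ->
  0 <= C -> 0 < b < 1 ->
  (forall r, 0 < r -> (P [set w | (`|Y w| <= r)%R] <= (C * r)%:E)%E) ->
  P.-integrable setT (fun w => (expR (- b * ln `|Y w|))%:E).
Proof.
move=> mY C0 /andP[b0 b1] PY.
have q1 : 0 < expR (b - 1) < 1 by rewrite expR_gt0 expR_lt1 subr_lt0.
apply: (@layer_integrable _ (fun k => [set w | `|Y w| <= expR (- k%:R)])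
  (fun k => expR (b * k.+1%:R)) (C * expR b) (expR (b - 1))) => //.
- apply: measurableT_comp => //; apply: measurable_funM; first exact: measurable_cst.
  by apply: measurableT_comp => //; exact: measurableT_comp.
- move=> k.
  have -> : [set w | `|Y w| <= expR (- k%:R)] =
      setT `&` (fun w => `|Y w|) @^-1` `]-oo, expR (- k%:R)]%classic.
    by rewrite setTI; apply/seteqP; split => w /=; rewrite in_itv.
  by apply: (measurableT_comp (@normr_measurable R setT) mY).
- by rewrite mulr_ge0 ?expR_ge0.
- move=> k; apply: (@le_trans _ _ ((expR (b * k.+1%:R))%:E * (C * expR (- k%:R))%:E)%E).
    by rewrite lee_wpmul2l ?lee_fin ?expR_ge0// PY// expR_gt0.
  rewrite -EFinM lee_fin -expRM_natl mulrCA -!mulrA ler_wpM2l// -!expRD.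
  by rewrite ler_expR -natr1; lra.
- move=> w; have [l0|l0] := leP 0 (ln `|Y w|).
    by left; rewrite -expR0 ler_expR mulNr oppr_le0 mulr_ge0// ltW.
  have Y0 : 0 < `|Y w|.
    by rewrite normr_gt0; apply: contraTneq l0 => ->; rewrite normr0 ln0// ltxx.
  have v0 : 0 <= - ln `|Y w| by rewrite oppr_ge0 ltW.
  have /andP[k1 k2] := truncn_itv v0.
  right; exists (Num.truncn (- ln `|Y w|)) => /=.
    by rewrite -[leLHS](@lnK R) ?posrE// ler_expR lerNr.
  by rewrite ler_expR mulNr -mulrN ler_wpM2l ?ltW.
Qed.

Lemma exp_abs_integrable (Y : T -> R) (C : R) : measurable_fun setT Y -> 0 <= C ->
  (forall k : nat, (P [set w | (k%:R <= `|Y w| <= k.+1%:R)%R] <=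
    (C * expR (- (2 * k%:R)))%:E)%E) ->
  P.-integrable setT (fun w => (expR `|Y w|)%:E).
Proof.
move=> mY C0 PY.
have q1 : 0 < expR (- 1 : R) < 1.
  by rewrite expR_gt0 expR_lt1 oppr_lt0 ltr01.
apply: (@layer_integrable _ (fun k => [set w | k%:R <= `|Y w| <= k.+1%:R])
  (fun k => expR (k.+1%:R)) (C * expR 1) (expR (- 1))) => //.
- by apply: measurableT_comp => //; exact: measurableT_comp.
- move=> k.
  have -> : [set w | k%:R <= `|Y w| <= k.+1%:R] =
      setT `&` (fun w => `|Y w|) @^-1` `[k%:R, k.+1%:R]%classic.
    by rewrite setTI; apply/seteqP; split => w /=; rewrite in_itv.
  by apply: (measurableT_comp (@normr_measurable R setT) mY).
- by rewrite mulr_ge0 ?expR_ge0.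
- move=> k; apply: (@le_trans _ _ ((expR k.+1%:R)%:E * (C * expR (- (2 * k%:R)))%:E)%E).
    by rewrite lee_wpmul2l ?lee_fin ?expR_ge0// PY.
  rewrite -EFinM lee_fin -expRM_natl mulrCA -!mulrA ler_wpM2l// -!expRD.
  by rewrite ler_expR -natr1; lra.
- move=> w; right; have /andP[k1 k2] := truncn_itv (normr_ge0 (Y w)).
  exists (Num.truncn `|Y w|) => /=; first by rewrite k1 ltW.
  by rewrite ler_expR ltW.
Qed.

End layers.

Section pair_law.
Context d {T : measurableType d} {R : realType} (P : probability T R).

Definition RVpair (U X : {RV P >-> R}) (w : T) : R * R := (U w, X w).

Lemma measurable_RVpair U X : measurable_fun setT (RVpair U X).
Proof.
apply/measurable_fun_pairP; split.
  exact: (measurable_funPT U).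
exact: (measurable_funPT X).
Qed.

HB.instance Definition _ U X :=
  isMeasurableFun.Build _ _ _ _ (RVpair U X) (measurable_RVpair U X).

Variables (X U : {RV P >-> R}).
Hypothesis XU : independent_RV X U.
Notation mU := (distribution P U).
Notation mX := (distribution P X).

(** Independence, stated on rectangles, determines the joint law by uniqueness of
    the product measure. *)
Lemma pair_law (A : set (R * R)) : measurable A ->
  (mU \x mX)%E A = distribution P (RVpair U X) A.
Proof.
apply: product_measure_unique => B C mB mC.
have e : RVpair U X @^-1` (B `*` C) = X @^-1` C `&` U @^-1` B.
  by apply/seteqP; split => w [].
transitivity (P (X @^-1` C `&` U @^-1` B)); first by rewrite -e.
by rewrite XU// muleC.
Qed.

Lemma integral_pair (h : R * R -> \bar R) : measurable_fun setT h ->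
  P.-integrable setT (h \o RVpair U X) ->
  (mU \x mX)%E.-integrable setT h /\
  (\int[mU \x mX]_z h z = \int[P]_w h (U w, X w))%E.
Proof.
move=> mh ih.
have e : (\int[mU \x mX]_z h z = \int[distribution P (RVpair U X)]_z h z)%E.
  by apply: eq_measure_integral => A mA _; exact: pair_law.
split; last by rewrite e integral_distribution.
apply/integrableP; split => //.
have -> : (\int[mU \x mX]_z `|h z| = \int[distribution P (RVpair U X)]_z `|h z|)%E.
  by apply: eq_measure_integral => A mA _; exact: pair_law.
rewrite ge0_integral_distribution//; last exact: measurableT_comp.
by have /integrableP[] := ih.
Qed.

Lemma cint_pair (G : R * R -> R[i]) : cmeas G ->
  cintble P (fun w => G (U w, X w)) ->
  cintble (mU \x mX)%E G /\ cint (mU \x mX)%E G = cint P (fun w => G (U w, X w)).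
Proof.
move=> [mr mi] [ir ii].
have [jr er] := @integral_pair (fun z => (complex.Re (G z))%:E)
  ((measurable_EFinP _ _).2 mr) ir.
have [ji ei] := @integral_pair (fun z => (complex.Im (G z))%:E)
  ((measurable_EFinP _ _).2 mi) ii.
by split => //; apply: complex_eqE => /=; rewrite /Rintegral ?er ?ei.
Qed.

Lemma integrable_prod (h k : R -> R) : measurable_fun setT h -> measurable_fun setT k ->
  (forall x, 0 <= h x) -> (forall x, 0 <= k x) ->
  P.-integrable setT (fun w => (h (U w))%:E) ->
  P.-integrable setT (fun w => (k (X w))%:E) ->
  P.-integrable setT (fun w => (h (U w) * k (X w))%:E).
Proof.
move=> mh mk h0 k0 ih ik.
have mhk : measurable_fun setT (fun z : R * R => (h z.1 * k z.2)%:E).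
  apply/measurable_EFinP; apply: measurable_funM.
    exact: (measurableT_comp mh measurable_fst).
  exact: (measurableT_comp mk measurable_snd).
apply/integrableP; split.
  apply/measurable_EFinP; apply: measurable_funM.
    exact: (measurableT_comp mh (measurable_funPT U)).
  exact: (measurableT_comp mk (measurable_funPT X)).
have -> : (\int[P]_w `|(h (U w) * k (X w))%:E| =
    \int[distribution P (RVpair U X)]_z (h z.1 * k z.2)%:E)%E.
  rewrite ge0_integral_distribution//; last by move=> z; rewrite lee_fin mulr_ge0.
  by apply: eq_integral => w _ /=; rewrite ger0_norm// mulr_ge0.
have -> : (\int[distribution P (RVpair U X)]_z (h z.1 * k z.2)%:E =
    \int[mU \x mX]_z (h z.1 * k z.2)%:E)%E.
  by apply: eq_measure_integral => A mA _; exact/esym/pair_law.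
rewrite fubini_tonelli1//; last by move=> z; rewrite lee_fin mulr_ge0.
have e2 x : (\int[mX]_y (h x * k y)%:E = (h x)%:E * \int[mX]_y (k y)%:E)%E.
  under eq_integral do rewrite EFinM.
  rewrite ge0_integralZl_EFin//; last exact/measurable_EFinP.
  by move=> y _; rewrite lee_fin.
rewrite /fubini_F/=.
under eq_integral do rewrite e2.
have mk' : measurable_fun setT (fun y => (k y)%:E) by exact/measurable_EFinP.
have mh' : measurable_fun setT (fun y => (h y)%:E) by exact/measurable_EFinP.
have k0' y : (0 <= (k y)%:E)%E by rewrite lee_fin.
have h0' y : (0 <= (h y)%:E)%E by rewrite lee_fin.
have fk : (\int[mX]_y (k y)%:E \is a fin_num)%E.
  rewrite (ge0_integral_distribution X mk' k0').
  exact: integrable_fin_num ik.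
rewrite -(fineK fk); under eq_integral do rewrite muleC.
have c0 : 0 <= fine (\int[mX]_y (k y)%:E)%E by rewrite fine_ge0// integral_ge0.
rewrite ge0_integralZl_EFin// (ge0_integral_distribution U mh' h0').
have /integrable_fin_num := ih => /(_ measurableT) fh.
by rewrite /comp -(fineK fh) -EFinM ltry.
Qed.

End pair_law.

(** * Moments and the expectation of a complex power *)

Section ae_transfer.
Context d {T : measurableType d} {R : realType} (P : probability T R).

Lemma integrable_ae_eq (f g : T -> R) (N : set T) : measurable_fun setT f ->
  P.-integrable setT (fun w => (g w)%:E) -> measurable N -> P N = 0%E ->
  (forall w, ~ N w -> f w = g w) ->
  P.-integrable setT (fun w => (f w)%:E) /\ \int[P]_w f w = \int[P]_w g w.
Proof.
move=> mf ig mN N0 fg.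
have mf' : measurable_fun setT (fun w => (f w)%:E) by exact/measurable_EFinP.
have mg' := measurable_int _ ig.
have ae : ae_eq P setT (fun w => (f w)%:E) (fun w => (g w)%:E).
  exists N; split => // w /= h; apply: contrapT => nN; apply: h => _.
  by rewrite fg.
split; last by congr fine; exact: ae_eq_integral.
apply/integrableP; split => //; have /integrableP[_] := ig.
apply: le_lt_trans; rewrite le_eqVlt; apply/orP; left; apply/eqP.
apply: ge0_ae_eq_integral => //; try exact: measurableT_comp.
by exists N; split => // w /= h; apply: contrapT => nN; apply: h => _; rewrite fg.
Qed.

Lemma cint_ae_eq (f g : T -> R[i]) (N : set T) : cmeas f ->
  cintble P g -> measurable N -> P N = 0%E ->
  (forall w, ~ N w -> f w = g w) -> cintble P f /\ cint P f = cint P g.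
Proof.
move=> [fr fi] [gr gi] mN N0 fg.
have [ir er] := integrable_ae_eq fr gr mN N0 (fun w h => congr1 (@complex.Re R) (fg w h)).
have [ii ei] := integrable_ae_eq fi gi mN N0 (fun w h => congr1 (@complex.Im R) (fg w h)).
by split => //; rewrite /cint er ei.
Qed.

Lemma cexpectationE (Z : T -> R[i]) : cexpectation P Z = cint P Z.
Proof. by rewrite /cexpectation /cint unlock. Qed.

End ae_transfer.

Section moments.
Context d {T : measurableType d} {R : realType} (P : probability T R).
Variables (X U : {RV P >-> R}) (fU : R -> R).
Hypotheses (U_pdf : has_pdf U fU) (mfU : measurable_fun setT fU)
  (fU02 : forall u, 0 <= fU u <= 2)
  (fU_out : forall u, ~~ ((0 < u) && (u < 1)) -> fU u = 0).
Hypotheses (X_pdf : has_pdf X (@pdf_sinh R)) (XU : independent_RV X U).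

(** [U] lies in ]0, 1[ only almost surely.  Moving the exceptional values to 1/2
    changes no expectation and makes [a - 1 + U + iX] lie in the right half-plane
    everywhere, away from the cut of the logarithm. *)
Definition clip (u : R) : R := if (0 < u) && (u < 1) then u else 2^-1.

Lemma clip01 u : 0 < clip u < 1.
Proof. by rewrite /clip; case: ifP => // _; lra. Qed.

Lemma measurable_clip : measurable_fun setT clip.
Proof.
apply: measurable_fun_ifT => //.
by apply: measurable_and; apply: measurable_fun_ltr.
Qed.

Definition Uout : set T := U @^-1` [set u | ~~ ((0 < u) && (u < 1))].

Lemma Uout_meas : measurable Uout /\ P Uout = 0%E.
Proof.
pose O := [set u : R | ~~ ((0 < u) && (u < 1))].
have mo : measurable O.
  have -> : O = ~` `]0, 1[%classic.
    by apply/seteqP; split => u /=; rewrite in_itv/= => /negP.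
  exact: measurableC.
split.
  exact: (measurable_funPTI U mo).
have -> : P Uout = (\int[lebesgue_measure]_(u in O) (fU u)%:E)%E.
  exact: U_pdf mo.
by apply: integral0_eq => u /= /fU_out ->.
Qed.

Lemma clipU w : ~ Uout w -> clip (U w) = U w /\ 0 < U w.
Proof.
move=> /negP; rewrite negbK => /[dup] h /andP[h0 _].
by rewrite /clip h.
Qed.

(** The random variable [a - 1 + U + iX], with [U] clipped. *)
Definition Zclip (a : R) (w : T) : R[i] := (a - 1 + clip (U w)) +i* X w.

Lemma Re_Zclip a w : complex.Re (Zclip a w) = a - 1 + clip (U w). Proof. by []. Qed.

Lemma Re_Zclip_gt0 a w : 1 <= a -> 0 < complex.Re (Zclip a w).
Proof. by move=> a1; have := clip01 (U w); rewrite Re_Zclip; lra. Qed.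

Lemma Zclip_neq0 a w : 1 <= a -> Zclip a w != 0.
Proof.
by move=> /(@Re_Zclip_gt0 _ w); apply: contraTneq => ->; rewrite ltxx.
Qed.

Lemma measurable_clipU : measurable_fun setT (fun w => clip (U w)).
Proof. exact: (measurableT_comp measurable_clip (measurable_funPT U)). Qed.

Lemma cmeas_Zclip a : cmeas (Zclip a).
Proof.
apply: cmeas_pair; last exact: (measurable_funPT X).
by apply: measurable_funD; [exact: measurable_cst|exact: measurable_clipU].
Qed.

Lemma integrable_invU b : 0 < b < 1 ->
  P.-integrable setT (fun w => (expR (- b * ln (clip (U w))))%:E).
Proof.
move=> b01.
have := @inv_power_integrable _ T R P (fun w => clip (U w)) 2 b measurable_clipU _ b01.
under [X in (_ -> _ -> is_true (_.-integrable _ X)) -> _]eq_fun => w.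
  rewrite gtr0_norm; last by have /andP[] := clip01 (U w).
  over.
apply => // r r0.
have [mN N0] := Uout_meas.
have mI : measurable (U @^-1` `[0, r]%classic).
  exact: (measurable_funPTI U (measurable_itv `[0, r]%R)).
apply: (@le_trans _ _ (P (U @^-1` `[0, r]%classic `|` Uout))).
  apply: le_measure; rewrite ?inE.
  - have -> : [set w | `|clip (U w)| <= r] =
        setT `&` (fun w => clip (U w)) @^-1` `[-r, r]%classic.
      by rewrite setTI; apply/seteqP; split => w /=; rewrite in_itv/= ler_norml.
    exact: measurable_clipU.
  - exact: measurableU.
  - move=> w /= h; have [wN|wN] := pselect (Uout w); first by right.
    left; have [e u0] := clipU wN; rewrite /= in_itv/= (ltW u0)/=.
    by move: h; rewrite e (gtr0_norm u0).
have h := measureU2 P mI mN; apply: (le_trans h) => {h}.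
rewrite [X in (_ + X)%E]N0 adde0.
have := @pdf_itv_le _ T R P U fU U_pdf mfU (fun u => proj1 (andP (fU02 u))) 2 0 r.
rewrite subr0; apply; first exact: ltW.
by move=> u _; have /andP[] := fU02 u.
Qed.

Let mp := @measurable_pdf_sinh R.
Let p0 x : 0 <= pdf_sinh x :> R. Proof. by have /andP[] := pdf_sinh_bounds x. Qed.
Let mX : measurable_fun setT (fun w => X w) := measurable_funPT X.

Lemma integrable_invX b : 0 < b < 1 ->
  P.-integrable setT (fun w => (expR (- b * ln `|X w|))%:E).
Proof.
move=> b01; apply: (@inv_power_integrable _ _ _ _ X (16 * pi * 2)) => //.
  by rewrite !mulr_ge0 ?pi_ge0.
move=> r r0.
have -> : [set w | `|X w| <= r] = X @^-1` `[-r, r]%classic.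
  by apply/seteqP; split => w /=; rewrite in_itv/= ler_norml.
have -> : 16 * pi * 2 * r = 16 * pi * (r - (- r)) by ring.
apply: (pdf_itv_le X_pdf mp p0); first by lra.
move=> x _; have /andP[_] := pdf_sinh_bounds x => /le_trans; apply.
rewrite ler_piMr ?mulr_ge0 ?pi_ge0// -expR0 ler_expR oppr_le0.
by rewrite mulr_ge0 ?pi_ge0.
Qed.

Lemma integrable_expX : P.-integrable setT (fun w => (expR `|X w|)%:E).
Proof.
apply: (@exp_abs_integrable _ _ _ _ X (16 * pi * 2)) => //.
  by rewrite !mulr_ge0 ?pi_ge0.
move=> k; pose K : R := 16 * pi * expR (- (2 * k%:R)).
have k1 : (k%:R : R) + 1 = k.+1%:R by rewrite natr1.
have bnd x : k%:R <= `|x| -> pdf_sinh x <= K.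
  move=> kx; have /andP[_] := pdf_sinh_bounds x => /le_trans; apply.
  rewrite ler_wpM2l ?mulr_ge0 ?pi_ge0// ler_expR lerN2.
  by apply: ler_pM => //; exact: pi_ge2.
have m1 : measurable (X @^-1` `[k%:R, k.+1%:R]%classic).
  exact: (measurable_funPTI X (measurable_itv `[k%:R, k.+1%:R]%R)).
have m2 : measurable (X @^-1` `[- k.+1%:R, - k%:R]%classic).
  exact: (measurable_funPTI X (measurable_itv `[- k.+1%:R, - k%:R]%R)).
have e : [set w | (k%:R <= `|X w| <= k.+1%:R)%R] =
    X @^-1` `[k%:R, k.+1%:R]%classic `|` X @^-1` `[- k.+1%:R, - k%:R]%classic.
  apply/seteqP; split => w /=; rewrite !in_itv/=.
    by have [x0|x0] := ger0P (X w) => h; [left|right]; lra.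
  have k0 : 0 <= k%:R :> R by [].
  case=> /andP[h1 h2].
    by rewrite ger0_norm ?h1//; lra.
  by rewrite ler0_norm; lra.
have h := measureU2 P m1 m2; rewrite e; apply: (le_trans h) => {h}.
have -> : 16 * pi * 2 * expR (- (2 * k%:R)) =
    K * (k.+1%:R - k%:R) + K * (- k%:R - (- k.+1%:R)).
  by rewrite -k1 /K; ring.
rewrite EFinD leeD//; apply: (pdf_itv_le X_pdf mp p0); rewrite -?k1; try lra.
  by move=> x /andP[h _]; apply: bnd; rewrite (le_trans h)// ler_norm.
move=> x /andP[_ h]; apply: bnd; rewrite -normrN.
by rewrite (le_trans _ (ler_norm _))//; lra.
Qed.

(** Moments of all orders if [1 < a], of order above -2 if [a = 1].  Positive ones
    are dominated by [e^|X|].  For negative ones, either [|Z| >= a - 1 > 0], or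
    [|Z|^2 >= U |X|] splits [|Z|^p] into a product of independent factors of order
    [p / 2 > -1], integrable because both densities are bounded. *)
Lemma moment a p : 1 <= a -> 1 < a \/ -2 < p ->
  P.-integrable setT (fun w => (expR (p * ln (cabs (Zclip a w))))%:E).
Proof.
move=> a1 ap.
have mh : measurable_fun setT (fun w => expR (p * ln (cabs (Zclip a w)))).
  apply: measurableT_comp => //; apply: measurable_funM; first exact: measurable_cst.
  by apply: measurableT_comp; [exact: measurable_ln|exact/measurable_cabs/cmeas_Zclip].
have Zpos w : 0 < cabs (Zclip a w) by rewrite cabs_gt0 Zclip_neq0.
have [->|pn0] := eqVneq p 0.
  under eq_fun do rewrite mul0r expR0.
  exact: finite_measure_integrable_cst.
have [p0'|p0'] := ltP 0 p.
  (* [|Z| <= a + |X|] and [ln (|Z| / p) <= |Z| / p] *)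
  pose K := expR (a + p * ln p).
  have := integrableZl measurableT K integrable_expX.
  apply: le_integrable => //; first exact/measurable_EFinP.
  move=> w _ /=; rewrite lee_fin ger0_norm ?expR_ge0//.
  rewrite [leRHS]ger0_norm ?mulr_ge0 ?expR_ge0// /K -expRD ler_expR.
  have Zle : cabs (Zclip a w) <= a + `|X w|.
    rewrite (le_trans (cabs_le _))// lerD2r Re_Zclip ger0_norm.
      by have := clip01 (U w); lra.
    by have := clip01 (U w); lra.
  have h : ln (cabs (Zclip a w) / p) <= cabs (Zclip a w) / p.
    have zp : 0 < cabs (Zclip a w) / p by rewrite divr_gt0.
    by rewrite -ler_expR lnK ?posrE// (le_trans _ (expR_ge1Dx _))// lerDr.
  rewrite lnM ?posrE ?invr_gt0// lnV ?posrE// in h.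
  have := ler_wpM2l (ltW p0') h.
  rewrite [p * (_ / p)]mulrCA mulfV ?gt_eqF// mulr1 mulrBr; lra.
have {pn0}p0' : p < 0 by rewrite lt_neqAle pn0.
have [a1'|aN] := ltP 1 a.
  have b0 : 0 < a - 1 by rewrite subr_gt0.
  have := @finite_measure_integrable_cst _ T R P setT (expR (p * ln (a - 1))) measurableT.
  apply: le_integrable => //; first exact/measurable_EFinP.
  move=> w _ /=; rewrite lee_fin !ger0_norm ?expR_ge0// ler_expR.
  rewrite ler_wnM2l ?(ltW p0')// ler_ln ?posrE//.
  apply: le_trans (cabs_Re _); rewrite Re_Zclip ger0_norm; have := clip01 (U w); lra.
have p2 : -2 < p by case: ap => //; rewrite ltNge aN.
have b01 : 0 < - p / 2 < 1 by lra.
pose h (u : R) := expR (- (- p / 2) * ln (clip u)).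
pose k (x : R) := expR (- (- p / 2) * ln `|x|).
have mh' : measurable_fun setT h.
  apply: measurableT_comp => //; apply: measurable_funM; first exact: measurable_cst.
  by apply: measurableT_comp; [exact: measurable_ln|exact: measurable_clip].
have mk' : measurable_fun setT k.
  apply: measurableT_comp => //; apply: measurable_funM; first exact: measurable_cst.
  by apply: measurableT_comp; [exact: measurable_ln|exact: normr_measurable].
(* on the null event [X = 0] the majorant, which uses [ln 0 = 0], may fail *)
pose f w := if X w == 0 then 0 else expR (p * ln (cabs (Zclip a w))).
have mf : measurable_fun setT f.
  by apply: measurable_fun_ifT => //; apply: measurable_fun_eqr.
have m0 : measurable (X @^-1` [set 0]) by exact: (measurable_funPTI X).
have P0 : P (X @^-1` [set 0]) = 0%E.
  apply/eqP; rewrite -measure_le0.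
  have := @pdf_itv_le _ T R P X _ X_pdf mp p0 (16 * pi) 0 0.
  rewrite subrr mulr0 set_itv1; apply => // x _.
  have /andP[_] := pdf_sinh_bounds x => /le_trans; apply.
  rewrite ler_piMr ?mulr_ge0 ?pi_ge0// -expR0 ler_expR oppr_le0.
  by rewrite mulr_ge0 ?pi_ge0.
suff fi : P.-integrable setT (fun w => (f w)%:E).
  apply: (proj1 (integrable_ae_eq mh fi m0 P0 _)) => w /= /eqP/negbTE x0.
  by rewrite /f x0.
have := integrable_prod XU mh' mk' (fun x => expR_ge0 _) (fun x => expR_ge0 _)
  (integrable_invU b01) (integrable_invX b01).
apply: le_integrable => //; first exact/measurable_EFinP.
move=> w _ /=; rewrite lee_fin [leRHS]ger0_norm ?mulr_ge0 ?expR_ge0//.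
rewrite /f; have [_|x0] := eqVneq (X w) 0; first by rewrite normr0 mulr_ge0 ?expR_ge0.
rewrite ger0_norm ?expR_ge0// /h /k -expRD ler_expR.
suff H : ln (clip (U w)) + ln `|X w| <= 2 * ln (cabs (Zclip a w)).
  have := ler_wpM2l (ltW (proj1 (andP b01))) H; lra.
have /andP[c0 c1] := clip01 (U w).
have cZ : clip (U w) <= cabs (Zclip a w).
  by apply: le_trans (cabs_Re _); rewrite Re_Zclip ger0_norm; lra.
have x0' : 0 < `|X w| by rewrite normr_gt0.
have xZ : `|X w| <= cabs (Zclip a w) by exact: (cabs_Im (Zclip a w)).
have : ln (clip (U w)) <= ln (cabs (Zclip a w)) by rewrite ler_ln ?posrE.
have : ln `|X w| <= ln (cabs (Zclip a w)) by rewrite ler_ln ?posrE.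
lra.
Qed.

(** The expectation of [Z^-s], with the power written as an exponential that is
    linear in [s]. *)
Definition expect_pow (a : R) (s : R[i]) : R[i] :=
  cint P (fun w => cexp (s * - clog (Zclip a w))).

Lemma cmeas_nclog a : cmeas (fun w => - clog (Zclip a w)).
Proof. by apply: cmeasN; apply: cmeas_clog; exact: cmeas_Zclip. Qed.

Lemma cmeas_expect_pow a s : cmeas (fun w => cexp (s * - clog (Zclip a w))).
Proof.
by apply: cmeas_cexp; apply: cmeasM; [exact: cmeas_cst|exact: cmeas_nclog].
Qed.

Lemma cabs_expect_pow_integrand a s w : cabs (cexp (s * - clog (Zclip a w))) =
  expR (- complex.Re s * ln (cabs (Zclip a w)) + complex.Im s * carg (Zclip a w)).
Proof. by rewrite cabs_cexp mulrN Re_opp Re_mul clogE/=; congr expR; ring. Qed.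

Lemma Im_carg_le (s z : R[i]) : complex.Im s * carg z <= `|complex.Im s| * pi.
Proof.
rewrite (le_trans (ler_norm _))// normrM ler_wpM2l//; exact: carg_lepi.
Qed.

(** The modulus of [Z^-s] is at most a constant times [|Z|^(- Re s)], the argument
    being bounded, and [e^(r |log Z|)] is at most a constant times
    [|Z|^r + |Z|^-r]; two moments bound the product. *)
Lemma expect_pow_dominated a s r : 1 <= a -> 0 <= r -> 1 < a \/ complex.Re s + r < 2 ->
  P.-integrable setT (fun w => (cabs (cexp (s * - clog (Zclip a w))) *
     expR (r * cabs (- clog (Zclip a w))))%:E).
Proof.
move=> a1 r0 asr.
have m1 : P.-integrable setT
    (fun w => (expR ((r - complex.Re s) * ln (cabs (Zclip a w))))%:E).
  by apply: moment => //; case: asr => h; [left|right; lra].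
have m2 : P.-integrable setT
    (fun w => (expR ((- r - complex.Re s) * ln (cabs (Zclip a w))))%:E).
  by apply: moment => //; case: asr => h; [left|right; lra].
pose K := expR (`|complex.Im s| * pi + r * pi).
have := integrableZl measurableT K (integrableD measurableT m1 m2).
apply: le_integrable => //.
  apply/measurable_EFinP; apply: measurable_funM.
    exact/measurable_cabs/cmeas_expect_pow.
  apply: measurableT_comp => //; apply: measurable_funM; first exact: measurable_cst.
  exact/measurable_cabs/cmeas_nclog.
move=> w _ /=; rewrite lee_fin !ger0_norm ?mulr_ge0 ?addr_ge0 ?expR_ge0 ?cabs_ge0//.
rewrite cabs_expect_pow_integrand -expRD cabsN.
set l := ln (cabs (Zclip a w)).
have h1 : cabs (clog (Zclip a w)) <= `|l| + pi.
  by rewrite (le_trans (cabs_le _))// lerD2l clogE/=; exact: carg_lepi.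
have h2 := Im_carg_le s (Zclip a w).
have h3 : r * cabs (clog (Zclip a w)) <= r * `|l| + r * pi.
  by rewrite -mulrDr ler_wpM2l.
rewrite mulrDr /K -!expRD; have [l0|l0] := ger0P l.
  rewrite -[leLHS]addr0 lerD ?expR_ge0// ler_expR.
  rewrite (ger0_norm l0) in h3; lra.
rewrite -[leLHS]add0r lerD ?expR_ge0// ler_expR.
by rewrite (ltr0_norm l0) in h3; lra.
Qed.

Lemma expect_pow_cintble a s : 1 <= a -> 1 < a \/ complex.Re s < 2 ->
  cintble P (fun w => cexp (s * - clog (Zclip a w))).
Proof.
move=> a1 as2; apply: (cintble_le (cmeas_expect_pow a s)
  (@expect_pow_dominated a s 0 a1 (lexx 0) _)).
  by case: as2 => h; [left|right; rewrite addr0].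
by move=> w; rewrite mul0r expR0 mulr1.
Qed.

Lemma expect_pow_analytic a s : 1 <= a -> 1 < a \/ complex.Re s < 2 ->
  analytic_at (expect_pow a) s.
Proof.
move=> a1 as2.
have [r r0 hr] : exists2 r, 0 < r & 1 < a \/ complex.Re s + r < 2.
  case: as2 => h; first by exists 1; [|left].
  by exists ((2 - complex.Re s) / 2); [lra|right; lra].
have := @cint_cexp_analytic _ T R P (fun=> 1) (fun w => - clog (Zclip a w)) r s
  (cmeas_cst 1) (cmeas_nclog a) r0.
have -> : (fun s0 => cint P (fun x => 1 * cexp (s0 * - clog (Zclip a x)))) = expect_pow a.
  by apply/funext => s0; apply: eq_cint => w; rewrite mul1r.
apply; under eq_fun do rewrite mul1r.
by apply: expect_pow_dominated => //; exact: ltW.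
Qed.

Lemma expect_powE a s : 1 <= a -> 1 < a \/ complex.Re s < 2 ->
  cintegrable P (fun w => cpow ((a - 1 + U w) +i* X w) (- s)) /\
  cexpectation P (fun w => cpow ((a - 1 + U w) +i* X w) (- s)) = expect_pow a s.
Proof.
move=> a1 as2; have [mN N0] := Uout_meas.
rewrite cexpectationE; apply: (cint_ae_eq _ (expect_pow_cintble a1 as2) mN N0).
  apply: cmeas_cpow; apply: cmeas_pair; last exact: mX.
  by apply: measurable_funD; [exact: measurable_cst|exact: (measurable_funPT U)].
move=> w /clipU[e _]; rewrite -{1}e -/(Zclip a w) cpowE ?Zclip_neq0//.
by rewrite mulNr mulrN.
Qed.

(** The real part of [Z] is at least [a - 1]. *)
Lemma expect_pow_bound a s : 1 < a -> 0 <= complex.Re s ->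
  cabs (expect_pow a s) <= 2 * expR (`|complex.Im s| * pi) *
                   expR (- complex.Re s * ln (a - 1)).
Proof.
move=> a1 s0; set K := expR (`|complex.Im s| * pi) * expR (- complex.Re s * ln (a - 1)).
have b0 : 0 < a - 1 by rewrite subr_gt0.
have := @cabs_cint_le _ T R P (fun w => cexp (s * - clog (Zclip a w))) (cst K)
  (cmeas_expect_pow a s)
  (finite_measure_integrable_cst P K measurableT).
rewrite Rintegral_cst//= probability_setT/= mulr1.
have -> : 2 * expR (`|complex.Im s| * pi) * expR (- complex.Re s * ln (a - 1)) = K + K.
  by rewrite /K; ring.
apply=> w; rewrite cabs_expect_pow_integrand /= /K -expRD ler_expR addrC.
apply: lerD; first exact: Im_carg_le.
rewrite ler_wnM2l ?oppr_le0// ler_ln ?posrE ?cabs_gt0 ?Zclip_neq0 ?(ltW a1)//.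
by apply: le_trans (cabs_Re _); rewrite Re_Zclip ger0_norm; have := clip01 (U w); lra.
Qed.

End moments.

(** * Mellin representation of the expectations *)

Section laws.
Context d {T : measurableType d} {R : realType} (P : probability T R).

Lemma cint_distribution (X : {RV P >-> R}) (g : R -> R[i]) : cmeas g ->
  cintble P (fun w => g (X w)) ->
  cint (distribution P X) g = cint P (fun w => g (X w)).
Proof.
move=> [mr mi] [ir ii]; apply: complex_eqE => /=; congr fine.
  by rewrite integral_distribution//; exact/measurable_EFinP.
by rewrite integral_distribution//; exact/measurable_EFinP.
Qed.

Lemma cintble_bounded (m : probability T R) (f : T -> R[i]) (B : R) :
  cmeas f -> (forall x, cabs (f x) <= B) -> cintble m f.
Proof.
move=> mf fB; apply: (@cintble_le _ _ _ m f (cst B) mf) => //.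
exact: finite_measure_integrable_cst.
Qed.

End laws.

Section transform.
Context {R : realType}.
Notation leb := (@lebesgue_measure R).

Lemma charS2N (t : R) : charS2 (- t) = charS2 t.
Proof.
rewrite /charS2 oppr_eq0; case: ifP => // _.
by rewrite sinhN invrN mulrNN.
Qed.

(** The characteristic function of [X], half of a variable with characteristic
    function [charS2]. *)
Definition phiX (t : R) : R := charS2 (t / 2).

Lemma measurable_phiX : measurable_fun setT phiX.
Proof.
apply: (measurableT_comp measurable_charS2).
by apply: measurable_funM; [exact: measurable_id|exact: measurable_cst].
Qed.

(** The exponential decay of the characteristic function, inherited from
    [charS2_le], makes the weight integrable without any help from [U]. *)
Lemma halfpow_phiX_bounds p t :
  0 <= halfpow p t * phiX t <= 16 * (halfpow p t * expR (- (2^-1 * t))).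
Proof.
rewrite mulr_ge0 ?halfpow_ge0 ?charS2_ge0//= mulrCA.
rewrite /halfpow; case: ifPn => t0; last by rewrite !mul0r.
rewrite ler_wpM2l ?powR_ge0// mulrC [2^-1 * t]mulrC.
by rewrite mulrC; apply: charS2_le; rewrite divr_gt0.
Qed.

Lemma Rintegral_unit (G H : R -> R) : (forall t, is_derive t (1 : R) G (H t)) ->
  (forall t, {for t, continuous H}) ->
  \int[leb]_u (if (0 < u) && (u < 1) then H u else 0) = G 1 - G 0.
Proof.
move=> dG cH.
have iH : leb.-integrable `[0, 1] (EFin \o H).
  apply: continuous_compact_integrable; first exact: segment_compact.
  by apply: continuous_subspaceT => x; exact: cH.
transitivity (\int[leb]_(u in `]0, 1[) H u).
  rewrite [RHS]Rintegral_mkcond; apply: eq_Rintegral => u _.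
  rewrite patchE; case: ifPn => h; case: ifPn => // h'.
    by move: h'; rewrite notin_setE/= in_itv/= h.
  by move: h'; rewrite inE/= in_itv/= (negbTE h).
rewrite Rintegral_itv_obnd_cbnd; last first.
  by apply: integrableS iH => //; exact: subset_itv_oo_cc.
rewrite Rintegral_itv_bndo_bndc; last first.
  by apply: integrableS iH => //; exact: subset_itv_co_cc.
apply: Rintegral_FTC => //.
- by apply: cvg_at_right_filter; exact: cH.
- apply: cvg_at_right_filter; apply: differentiable_continuous.
  by apply/derivable1_diffP; apply: ex_derive.
Qed.

End transform.

Section charX.
Context {R : realType} d (T : measurableType d) (P : probability T R)
  d' (T' : measurableType d') (P' : probability T' R).
Variables (X : {RV P >-> R}) (S2 : {RV P' >-> R}).
Hypotheses (S2_char : forall theta : R, char_fun S2 theta = (charS2 theta)%:C)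
  (X_law : same_law P P' X (fun w => S2 w / 2)).
Notation leb := (@lebesgue_measure R).
Notation mX := (distribution P X).

Lemma cmeas_osc (t : R) : cmeas (fun x : R => cexp (0 +i* (- (t * x)))).
Proof.
apply: cmeas_cexp; apply: cmeas_pair; first exact: measurable_cst.
exact: measurableT_comp.
Qed.

Lemma cabs_osc (t x : R) : cabs (cexp (0 +i* (- (t * x)))) = 1.
Proof. by rewrite cabs_cexp/= expR0. Qed.

(** The law of [X] enters the computation only here and in the moments: this is
    the characteristic function at [-t]. *)
Lemma cint_osc (t : R) : cint mX (fun x => cexp (0 +i* (- (t * x)))) = (phiX t)%:C.
Proof.
pose Y : {RV P' >-> R} := (2^-1 \o* S2)%R.
have -> : cint mX (fun x => cexp (0 +i* (- (t * x)))) =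
    cint (distribution P' Y) (fun x => cexp (0 +i* (- (t * x)))).
  apply: complex_eqE => /=; congr fine;
    by apply: eq_measure_integral => A mA _; exact: X_law.
have mY : cmeas (fun w => cexp (0 +i* (- (t * Y w)))).
  have [m1 m2] := cmeas_osc t.
  by split; [apply: (measurableT_comp m1)|apply: (measurableT_comp m2)];
    exact: measurable_funPT.
rewrite cint_distribution; [|exact: cmeas_osc|]; last first.
  by apply: (cintble_bounded _ mY) => w; rewrite cabs_osc.
rewrite /phiX -charS2N -S2_char /char_fun cexpectationE.
by apply: eq_cint => w; congr (cexp (_ +i* _)); rewrite /Y/=; ring.
Qed.

(** Euler's integral is absolutely convergent for fixed [y > 0], which allows the
    expectation over [X] to be taken first, inside the integral over [t]. *)
Lemma cint_gammaI p y : 0 < p -> 0 < y ->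
  cint mX (fun x => gammaI p (y +i* x)) =
  cint leb (fun t => (halfpow p t * expR (- (y * t)) * phiX t)%:C).
Proof.
move=> p0 y0.
pose f (z : R * measurableTypeR R) : R[i] :=
  (halfpow p z.2)%:C * cexp ((y +i* z.1) * (- z.2%:C)).
have mf : cmeas f.
  apply: cmeasM.
    apply: cmeas_real; apply: measurableT_comp; first exact: measurable_halfpow.
    exact: measurable_snd.
  apply: cmeas_cexp; apply: cmeasM.
    by apply: cmeas_pair; [exact: measurable_cst|exact: measurable_fst].
  by apply: cmeasN; apply: cmeas_real; exact: measurable_snd.
have := @cint_swap _ _ _ (measurableTypeR R) R mX leb f
  (fun t => halfpow p t * expR (- (y * t))) mf (integrable_halfpow p0 y0).
move=> ->; last by move=> x t; rewrite cabs_halfpow_cexp.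
apply: eq_cint => t.
have e x : f (x, t) = (halfpow p t * expR (- (y * t)))%:C * cexp (0 +i* (- (t * x))).
  rewrite /f/= rmorphM/= -mulrA -cexp_real -cexpD; congr (_ * cexp _).
  by apply: complex_eqE; rewrite ?Re_mul ?Im_mul ?Re_add ?Im_add/=; ring.
rewrite (eq_cint _ e) cintZ ?cint_osc -?rmorphM//.
by apply: (cintble_bounded _ (cmeas_osc t)) => x; rewrite cabs_osc.
Qed.

Section withU.
Variables (U : {RV P >-> R}) (fU : R -> R).
Hypotheses (U_pdf : has_pdf U fU) (mfU : measurable_fun setT fU)
  (fU02 : forall u, 0 <= fU u <= 2)
  (fU_out : forall u, ~~ ((0 < u) && (u < 1)) -> fU u = 0).
Hypotheses (X_pdf : has_pdf X (@pdf_sinh R)) (XU : independent_RV X U).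
Notation mU := (distribution P U).

(** The Laplace transform of the law of [U]. *)
Definition mgf (t : R) : R := \int[mU]_u expR (- (t * clip u)).

Lemma measurable_expclip t : measurable_fun setT (fun u : R => expR (- (t * clip u))).
Proof.
apply: measurableT_comp => //; apply: measurableT_comp => //.
by apply: measurable_funM; [exact: measurable_cst|exact: measurable_clip].
Qed.

Lemma expclip_le1 (t u : R) : 0 <= t -> expR (- (t * clip u)) <= 1.
Proof.
move=> t0; rewrite -expR0 ler_expR oppr_le0 mulr_ge0//.
by have /andP[/ltW] := clip01 u.
Qed.

Lemma integrable_expclip t : 0 <= t ->
  mU.-integrable setT (EFin \o (fun u : R => expR (- (t * clip u)))).
Proof.
move=> t0; have := @finite_measure_integrable_cst _ R R mU setT 1 measurableT.
apply: le_integrable => //; first by apply/measurable_EFinP; exact: measurable_expclip.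
by move=> u _ /=; rewrite lee_fin normr1 ger0_norm ?expR_ge0// expclip_le1.
Qed.

Lemma mgfE t : 0 <= t -> mgf t = \int[leb]_u (expR (- (t * clip u)) * fU u).
Proof.
move=> t0.
rewrite -(integral_pdf U_pdf mfU (measurable_expclip t) (B := 1)); last first.
  by move=> u; rewrite ger0_norm ?expR_ge0// expclip_le1.
congr fine; rewrite integral_distribution//.
  by apply/measurable_EFinP; exact: measurable_expclip.
have := @finite_measure_integrable_cst _ T R P setT 1 measurableT.
apply: le_integrable => //.
  apply/measurable_EFinP; apply: (measurableT_comp (measurable_expclip t)).
  exact: measurable_funPT.
by move=> u _ /=; rewrite lee_fin normr1 ger0_norm ?expR_ge0// expclip_le1.
Qed.

Lemma mgf01 t : 0 <= t -> 0 <= mgf t <= 1.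
Proof.
move=> t0; rewrite /mgf Rintegral_ge0/=; last by move=> u _; exact: expR_ge0.
apply: (@le_trans _ _ (\int[mU]_u (cst 1 u))).
  apply: le_Rintegral => //; first exact: integrable_expclip.
    exact: (@finite_measure_integrable_cst _ R R mU setT 1 measurableT).
  by move=> u _; rewrite expclip_le1.
rewrite Rintegral_cst// mul1r le_eqVlt; apply/orP; left; apply/eqP.
exact: (congr1 fine (@probability_setT _ _ _ mU)).
Qed.

Section real_exponent.
Variables (a p : R) (m : R -> R).
Hypotheses (a1 : 1 <= a) (p0 : 0 < p) (p1 : 1 < a \/ p < 1)
  (mm : measurable_fun setT m) (mE : forall t, 0 < t -> mgf t = m t).

(** The integrand obtained when the expectations over [X] and [U] are carried out:
    [phiX] comes from [X], and [m] stands for the Laplace transform of [U]. *)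
Definition laplace (t : R) : R[i] :=
  (halfpow p t * (phiX t * expR (- ((a - 1) * t)) * m t))%:C.

Lemma cintble_laplace : cintble leb laplace.
Proof.
have h2 : (0 : R) < 2^-1 by [].
have mi : leb.-integrable setT (EFin \o (fun t => 16 * (halfpow p t * expR (- (2^-1 * t))))).
  exact: (integrableZl measurableT 16 (integrable_halfpow p0 h2)).
apply: (@cintble_le _ (measurableTypeR R) R leb laplace _ _ mi).
  apply: cmeas_real; apply: measurable_funM; first exact: measurable_halfpow.
  apply: measurable_funM; last exact: mm.
  apply: measurable_funM; first exact: measurable_phiX.
  apply: measurableT_comp => //; exact: measurableT_comp.
move=> t; have /andP[q0 q1] := halfpow_phiX_bounds p t.
rewrite /laplace cabs_real; apply: le_trans q1.
have [t0|t0] := ltP 0 t; last by rewrite /halfpow ltNge t0/= !mul0r normr0.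
have /andP[m0 m1] := mgf01 (ltW t0); rewrite mE// in m0 m1.
rewrite !mulrA -mulrA normrM (ger0_norm q0) ler_piMr//.
rewrite ger0_norm ?mulr_ge0 ?expR_ge0// mulr_ile1 ?expR_ge0//.
by rewrite -[leRHS]expR0 ler_expR oppr_le0 mulr_ge0 ?subr_ge0// ltW.
Qed.

(** The integrals over [X], [U] and [t] are not jointly dominated in an obvious way
    when [a = 1], as [Z] comes close to 0.  Two successive exchanges are used
    instead: over [X] for a fixed value of [U], where [e^(-ty)] dominates, then
    over [U], where the decay of the characteristic function dominates. *)
Lemma gammaI_expect_pow : gammaI p 1 * expect_pow X U a (p + 1)%:C = cint leb laplace.
Proof.
have y0 u : 0 < a - 1 + clip u by rewrite ltr_wpDl ?subr_ge0//; have /andP[] := clip01 u.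
have as2 : 1 < a \/ complex.Re ((p + 1)%:C : R[i]) < 2.
  by case: p1 => h; [left|right => /=; lra].
pose Z (z : R * R) : R[i] := (a - 1 + clip z.1) +i* z.2.
have Zn0 z : Z z != 0.
  by apply: contraTneq (y0 z.1) => e; rewrite -[X in 0 < X]/(complex.Re (Z z)) e ltxx.
pose G z := gammaI p 1 * cexp ((p + 1)%:C * - clog (Z z)).
have GE z : G z = gammaI p (Z z).
  by rewrite (gammaI_cpow p0) ?y0// /G cpowE// mulNr mulrN.
have mZ : cmeas Z.
  apply: cmeas_pair; last exact: measurable_snd.
  apply: measurable_funD; first exact: measurable_cst.
  by apply: measurableT_comp; [exact: measurable_clip|exact: measurable_fst].
have mG : cmeas G.
  apply: cmeasM; first exact: cmeas_cst.
  apply: cmeas_cexp; apply: cmeasM; first exact: cmeas_cst.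
  by apply: cmeasN; exact: cmeas_clog.
have iG := cintbleZ (gammaI p 1) (expect_pow_cintble U_pdf mfU fU02 fU_out X_pdf XU a1 as2).
rewrite /expect_pow -cintZ; last first.
  exact: (expect_pow_cintble U_pdf mfU fU02 fU_out X_pdf XU a1 as2).
have [iG' <-] := cint_pair XU mG iG.
rewrite (cint_prod12 iG'); last first.
  move=> u; have [m1 m2] := mG.
  apply: (@cintble_bounded _ R R _ _ (cabs (gammaI p 1) *
    expR (- (p + 1) * ln (a - 1 + clip u)))).
    by split; [apply: (measurableT_comp m1)|apply: (measurableT_comp m2)];
      exact: measurable_pair1.
  move=> x; rewrite /G cabsM ler_wpM2l ?cabs_ge0// cabs_cexp ler_expR.
  rewrite mulrN Re_opp Re_mul clogE/= mul0r subr0 mulNr lerN2.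
  rewrite ler_wpM2l ?addr_ge0 ?(ltW p0)//.
  rewrite ler_ln ?posrE ?cabs_gt0//.
  apply: le_trans (cabs_Re _); exact: ler_norm.
transitivity (cint mU (fun u : R => cint leb (fun t =>
    (halfpow p t * expR (- ((a - 1 + clip u) * t)) * phiX t)%:C))).
  apply: eq_cint => u; rewrite -cint_gammaI//; apply: eq_cint => x.
  by rewrite GE.
pose f (z : R * measurableTypeR R) : R[i] :=
  (halfpow p z.2 * expR (- ((a - 1 + clip z.1) * z.2)) * phiX z.2)%:C.
have mf : cmeas f.
  apply: cmeas_real; apply: measurable_funM.
    apply: measurable_funM.
      by apply: measurableT_comp; [exact: measurable_halfpow|exact: measurable_snd].
    apply: measurableT_comp => //; apply: measurableT_comp => //.
    apply: measurable_funM; last exact: measurable_snd.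
    apply: measurable_funD; first exact: measurable_cst.
    by apply: measurableT_comp; [exact: measurable_clip|exact: measurable_fst].
  by apply: measurableT_comp; [exact: measurable_phiX|exact: measurable_snd].
have h2 : (0 : R) < 2^-1 by [].
have mi : leb.-integrable setT (EFin \o (fun t => 16 * (halfpow p t * expR (- (2^-1 * t))))).
  exact: (integrableZl measurableT 16 (integrable_halfpow p0 h2)).
have := @cint_swap _ _ _ (measurableTypeR R) R mU leb f _ mf mi.
move=> ->; last first.
  move=> u t; rewrite /f cabs_real/=; have /andP[q0 q1] := halfpow_phiX_bounds p t.
  apply: le_trans q1; rewrite mulrAC normrM (ger0_norm q0).
  have [t0|t0] := ltP 0 t; last by rewrite /halfpow ltNge t0/= !mul0r.
  rewrite ler_piMr// ger0_norm ?expR_ge0// -[leRHS]expR0 ler_expR oppr_le0.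
  by apply: mulr_ge0; apply: ltW.
apply: eq_cint => t; rewrite /f/= /laplace.
have [t0|t0] := ltP 0 t; last first.
  have halfpow0 : halfpow p t = 0 by rewrite /halfpow ltNge t0.
  rewrite halfpow0 mul0r; apply: complex_eqE => /=; rewrite /Rintegral integral0_eq//.
  by move=> x _; rewrite !mul0r.
have im : cintble mU (fun u : R => (expR (- (t * clip u)))%:C).
  apply: (@cintble_bounded _ R R _ _ 1).
    by apply: cmeas_real; exact: measurable_expclip.
  by move=> u; rewrite cabs_real ger0_norm ?expR_ge0// expclip_le1// ltW.
have e u : (halfpow p t * expR (- ((a - 1 + clip u) * t)) * phiX t)%:C =
    (halfpow p t * (phiX t * expR (- ((a - 1) * t))))%:C * (expR (- (t * clip u)))%:C.
  rewrite -rmorphM; congr (_%:C).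
  have -> : - ((a - 1 + clip u) * t) = - ((a - 1) * t) + - (t * clip u) by ring.
  by rewrite expRD; ring.
rewrite (eq_cint _ e) cintZ// -mE// [halfpow p t * (_ * mgf _)]mulrA [RHS]rmorphM/=.
congr (_ * _).
apply: complex_eqE => //=.
by rewrite /Rintegral integral0.
Qed.

End real_exponent.
End withU.
End charX.

(** * The difference identity at real points *)

Section uniform_and_triangular.
Context {R : realType}.

Lemma measurable_unit_if (h : R -> R) : measurable_fun setT h ->
  measurable_fun setT (fun u : R => if (0 < u) && (u < 1) then h u else 0).
Proof.
move=> mh; apply: measurable_fun_ifT => //.
by apply: measurable_and; apply: measurable_fun_ltr.
Qed.

Lemma measurable_pdf_U1 : measurable_fun setT (@pdf_U1 R).
Proof. exact: (measurable_unit_if (measurable_cst (1 : R))). Qed.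

Lemma measurable_pdf_U2 : measurable_fun setT (@pdf_U2 R).
Proof.
apply: measurable_unit_if; apply: measurable_funM; first exact: measurable_cst.
by apply: measurable_funB; [exact: measurable_cst|exact: measurable_id].
Qed.

Lemma pdf_U1_02 (u : R) : 0 <= pdf_U1 u <= 2.
Proof. by rewrite /pdf_U1; case: ifP => _; lra. Qed.

Lemma pdf_U2_02 (u : R) : 0 <= pdf_U2 u <= 2.
Proof. by rewrite /pdf_U2; case: ifP => h; lra. Qed.

Lemma pdf_U1_out (u : R) : ~~ ((0 < u) && (u < 1)) -> pdf_U1 u = 0.
Proof. by rewrite /pdf_U1 => /negbTE ->. Qed.

Lemma pdf_U2_out (u : R) : ~~ ((0 < u) && (u < 1)) -> pdf_U2 u = 0.
Proof. by rewrite /pdf_U2 => /negbTE ->. Qed.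

Definition mgf1 (t : R) : R := (1 - expR (- t)) / t.
Definition mgf2 (t : R) : R := 2 * (t - 1 + expR (- t)) / t ^+ 2.

Lemma measurable_expRN : measurable_fun setT (fun t : R => expR (- t)).
Proof. by apply: measurableT_comp. Qed.

Lemma measurable_mgf1 : measurable_fun setT mgf1.
Proof.
apply: measurable_funM; last by apply: measurable_invr; exact: measurable_id.
by apply: measurable_funB; [exact: measurable_cst|exact: measurable_expRN].
Qed.

Lemma measurable_mgf2 : measurable_fun setT mgf2.
Proof.
apply: measurable_funM; last by apply: measurable_invr; exact: measurable_funX.
apply: measurable_funM; first exact: measurable_cst.
apply: measurable_funD; last exact: measurable_expRN.
by apply: measurable_funB; [exact: measurable_id|exact: measurable_cst].
Qed.

Context d {T : measurableType d} (P : probability T R).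
Variables (U1 U2 : {RV P >-> R}).
Hypotheses (U1_pdf : has_pdf U1 (@pdf_U1 R)) (U2_pdf : has_pdf U2 (@pdf_U2 R)).

Lemma mgf_U1 t : 0 < t -> mgf U1 t = mgf1 t.
Proof.
move=> t0; rewrite (mgfE U1_pdf measurable_pdf_U1 (ltW t0)).
pose G (u : R) := - (expR (- (t * u)) / t).
pose H (u : R) := expR (- (t * u)).
have dG u : is_derive u (1 : R) G (H u).
  apply: is_derive_eq.
  rewrite /H /GRing.scale/=; field; lra.
have cH : forall u, {for u, continuous H}.
  move=> u; apply: differentiable_continuous; apply/derivable1_diffP.
  by apply: ex_derive.
have := Rintegral_unit dG cH.
rewrite /G/= mulr0 oppr0 expR0 mulr1 => h.
transitivity (- (expR (- t) / t) - - (1 / t)); last by rewrite /mgf1; ring.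
rewrite -h; apply: eq_Rintegral => u _; rewrite /pdf_U1 /clip /H.
by case: ifP => _; rewrite ?mulr1 ?mulr0.
Qed.

Lemma mgf_U2 t : 0 < t -> mgf U2 t = mgf2 t.
Proof.
move=> t0; rewrite (mgfE U2_pdf measurable_pdf_U2 (ltW t0)).
pose G (u : R) := 2 * (expR (- (t * u)) * (t^-1 ^+ 2 - (1 - u) * t^-1)).
pose H (u : R) := expR (- (t * u)) * (2 * (1 - u)).
have dG u : is_derive u (1 : R) G (H u).
  apply: is_derive_eq.
  rewrite /H /GRing.scale/=; field; lra.
have cH : forall u, {for u, continuous H}.
  move=> u; apply: differentiable_continuous; apply/derivable1_diffP.
  by apply: ex_derive.
have := Rintegral_unit dG cH.
rewrite /G/= mulr0 oppr0 expR0 mulr1 subrr mul0r !subr0 addr0 !mul1r => h.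
transitivity (2 * (expR (- t) * t^-1 ^+ 2) - 2 * (t^-1 ^+ 2 - t^-1)).
  rewrite -h; apply: eq_Rintegral => u _; rewrite /pdf_U2 /clip /H.
  by case: ifP => _; rewrite ?mulr0.
by rewrite /mgf2; field; lra.
Qed.

End uniform_and_triangular.

Section difference.
Context {R : realType} d (T : measurableType d) (P : probability T R)
  d' (T' : measurableType d') (P' : probability T' R).
Variables (U1 U2 X : {RV P >-> R}) (S2 : {RV P' >-> R}).
Hypotheses (U1_pdf : has_pdf U1 (@pdf_U1 R)) (U2_pdf : has_pdf U2 (@pdf_U2 R))
  (S2_char : forall theta : R, char_fun S2 theta = (charS2 theta)%:C)
  (X_law : same_law P P' X (fun w => S2 w / 2))
  (X_pdf : has_pdf X (@pdf_sinh R))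
  (XU1 : independent_RV X U1) (XU2 : independent_RV X U2).
Notation leb := (@lebesgue_measure R).

Lemma phiXE (t : R) : 0 < t ->
  phiX t = t ^+ 2 * expR (- t) / (1 - expR (- t)) ^+ 2.
Proof.
move=> t0; rewrite /phiX /charS2 gt_eqF ?divr_gt0// /sinh.
set r := expR (- (t / 2)); have r0 : 0 < r by exact: expR_gt0.
have -> : expR (t / 2) = r^-1 by rewrite /r expRN invrK.
have -> : expR (- t) = r ^+ 2 by rewrite /r -expRM_natl; congr expR; field.
have r1 : r < 1 by rewrite /r -[ltRHS]expR0 ltr_expR oppr_lt0 divr_gt0.
have r2 : r ^+ 2 < 1 by rewrite expr_lt1 ?ltW.
field; rewrite !gt_eqF//; nra.
Qed.

(** The identity behind the theorem.  With [q = e^-t], passing from [a] to [a + 1]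
    multiplies the exponential by [q], and the bracket becomes
    [(1 - q)^2 (a t - 1) / t^2], which cancels the denominator of [phiX]. *)
Lemma kernel_difference (a t : R) : 0 < t ->
  phiX t * expR (- ((a - 1) * t)) * (2^-1 * mgf2 t + (a - 1) * mgf1 t) -
  phiX t * expR (- ((a + 1 - 1) * t)) * (2^-1 * mgf2 t + a * mgf1 t) =
  expR (- (a * t)) * (a * t - 1).
Proof.
move=> t0; rewrite phiXE// /mgf1 /mgf2 addrK.
have -> : - (a * t) = - ((a - 1) * t) + - t by ring.
rewrite expRD; set q := expR (- t); set E := expR _.
have q1 : q < 1 by rewrite /q -[ltRHS]expR0 ltr_expR oppr_lt0.
by field; rewrite subr_eq0 gt_eqF// gt_eqF.
Qed.

(** The right-hand side of the representation, in terms of [expect_pow]. *)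
Definition rhsE (a : R) (s : R[i]) : R[i] :=
  2^-1 * expect_pow X U2 a s + (a - 1)%:C * expect_pow X U1 a s.

(** After multiplication by [Gamma(p+1)] both sides are integrals over [t]; the
    integrands agree by [kernel_difference], and [p = (p + 1) - 1] comes from
    [gammaI_rec]. *)
Lemma rhsE_difference_real (a p : R) : 1 <= a -> 0 < p < 1 ->
  rhsE a (p + 1)%:C - rhsE (a + 1) (p + 1)%:C = p%:C * cpow a%:C (- (p + 1)%:C).
Proof.
move=> a1 /andP[p0 p1].
have a0 : 0 < a by lra.
have a11 : 1 <= a + 1 by lra.
have G0 : gammaI p 1 != 0.
  by apply: contraTneq (gammaI1_gt0 p0) => ->; rewrite ltxx.
have e1 b : 1 <= b -> gammaI p 1 * expect_pow X U1 b (p + 1)%:C = cint leb (laplace b p mgf1).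
  move=> b1; exact: (gammaI_expect_pow S2_char X_law U1_pdf measurable_pdf_U1 pdf_U1_02
    pdf_U1_out X_pdf XU1 b1 p0 (or_intror p1) (mgf_U1 U1_pdf)).
have e2 b : 1 <= b -> gammaI p 1 * expect_pow X U2 b (p + 1)%:C = cint leb (laplace b p mgf2).
  move=> b1; exact: (gammaI_expect_pow S2_char X_law U2_pdf measurable_pdf_U2 pdf_U2_02
    pdf_U2_out X_pdf XU2 b1 p0 (or_intror p1) (mgf_U2 U2_pdf)).
have i1 b : 1 <= b -> cintble leb (laplace b p mgf1).
  move=> b1; exact: (cintble_laplace b1 p0 measurable_mgf1 (mgf_U1 U1_pdf)).
have i2 b : 1 <= b -> cintble leb (laplace b p mgf2).
  move=> b1; exact: (cintble_laplace b1 p0 measurable_mgf2 (mgf_U2 U2_pdf)).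
have iG q : 0 < q -> cintble leb (fun t => (halfpow q t)%:C * cexp (a%:C * (- t%:C))).
  by move=> q0; apply: gammaI_cintble.
have p10 : 0 < p + 1 by lra.
apply: (mulfI G0).
have -> : gammaI p 1 * (p%:C * cpow a%:C (- (p + 1)%:C)) =
    a%:C * gammaI (p + 1) a%:C - gammaI p a%:C.
  rewrite gammaI_rec// [gammaI p a%:C]gammaI_cpow//.
  set w := cpow _ _; rewrite rmorphD/= rmorph1.
  by rewrite [(_ + 1) * _]mulrDl mul1r addrK mulrCA.
pose F b t := 2^-1 * laplace b p mgf2 t + (b - 1)%:C * laplace b p mgf1 t.
have iF b : 1 <= b -> cintble leb (F b).
  by move=> b1; apply: cintbleD; apply: cintbleZ; [exact: i2|exact: i1].
have lin (g c k x y : R[i]) : g * (c * x + k * y) = c * (g * x) + k * (g * y).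
  by rewrite mulrDr !(mulrCA g).
have eF b : 1 <= b -> gammaI p 1 * rhsE b (p + 1)%:C = cint leb (F b).
  move=> b1; have h1 := @cintZ _ (measurableTypeR R) R leb (b - 1)%:C _ (i1 b b1).
  have h2 := @cintZ _ (measurableTypeR R) R leb 2^-1 _ (i2 b b1).
  have h := @cintD _ (measurableTypeR R) R leb _ _ (cintbleZ 2^-1 (i2 b b1))
    (cintbleZ (b - 1)%:C (i1 b b1)).
  apply: etrans (esym (etrans h (f_equal2 +%R h2 h1))).
  rewrite /rhsE lin.
  exact: (f_equal2 (fun x y => 2^-1 * x + (b - 1)%:C * y) (e2 b b1) (e1 b b1)).
rewrite mulrBr; apply: etrans (f_equal2 (fun x y => x - y) (eF a a1) (eF _ a11)) _.
apply: etrans (esym (@cintB _ (measurableTypeR R) R leb _ _ (iF a a1) (iF _ a11))) _.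
have hG := @cintZ _ (measurableTypeR R) R leb a%:C _ (iG _ p10).
have h := @cintB _ (measurableTypeR R) R leb _ _ (cintbleZ a%:C (iG _ p10)) (iG _ p0).
apply: etrans (etrans h (f_equal2 (fun x y => x - y) hG erefl)).
apply: eq_cint => t; rewrite /F /laplace.
have -> : 2^-1 = (2^-1)%:C :> R[i] by rewrite fmorphV rmorph_nat.
have -> : a%:C * - t%:C = (- (a * t))%:C by rewrite rmorphN rmorphM/= mulrN.
rewrite cexp_real -!rmorphM -!rmorphD -!rmorphB/=.
congr (_%:C); rewrite -halfpowS.
have [t0|t0] := ltP 0 t; last by rewrite /halfpow ltNge t0/= !(mul0r, mulr0) !addr0 subrr.
have := congr1 ( *%R (halfpow p t)) (kernel_difference a t0).
set c1 := expR (- ((a - 1) * t)); set c2 := expR (- ((a + 1 - 1) * t)).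
set c3 := expR _; set A := mgf1 t; set B := mgf2 t; set q := phiX t.
have -> : a + 1 - 1 = a by rewrite addrK.
move=> hk; transitivity (halfpow p t * (c3 * (a * t - 1))); last by ring.
by rewrite -hk; ring.
Qed.

End difference.

(** * Analytic continuation and the Hurwitz zeta function *)

Section exponential.
Context {R : realType}.

Lemma analytic_cexp_lin (l z0 : R[i]) : analytic_at (fun s => cexp (s * l)) z0.
Proof.
apply/analytic_atP; exists 1 => //.
exists (fun n => cexp (z0 * l) * (expc n * l ^+ n)) => w _.
rewrite /psums_to mulrDl cexpD.
have e N : psum (fun n => cexp (z0 * l) * (expc n * l ^+ n)) w N -
    cexp (z0 * l) * cexp (w * l) = cexp (z0 * l) * (psum expc (w * l) N - cexp (w * l)).
  rewrite mulrBr; congr (_ - _); rewrite /psum big_distrr/=.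
  by apply: eq_bigr => n _; rewrite exprMn; ring.
under eq_fun do rewrite e cabsM.
suff : cabs (cexp (z0 * l)) * cabs (psum expc (w * l) N - cexp (w * l)) @[N --> \oo] -->
    cabs (cexp (z0 * l)) * 0 by rewrite mulr0.
by apply: cvgM; [exact: cvg_cst|exact: cexp_series].
Qed.

Lemma real_neq0 (a : R) : 0 < a -> a%:C != 0 :> R[i].
Proof. by move=> a0; rewrite -cabs_gt0 cabs_real gtr0_norm. Qed.

Lemma analytic_cpow_real (a : R) (z0 : R[i]) : 0 < a ->
  analytic_at (fun s => cpow a%:C (- s)) z0.
Proof.
move=> a0; have -> : (fun s => cpow a%:C (- s)) = (fun s => cexp (s * - clog a%:C)).
  by apply/funext => s; rewrite cpowE ?real_neq0// mulNr mulrN.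
exact: analytic_cexp_lin.
Qed.

End exponential.

Section continuation.
Context {R : realType} d (T : measurableType d) (P : probability T R)
  d' (T' : measurableType d') (P' : probability T' R).
Variables (U1 U2 X : {RV P >-> R}) (S2 : {RV P' >-> R}).
Hypotheses (U1_pdf : has_pdf U1 (@pdf_U1 R)) (U2_pdf : has_pdf U2 (@pdf_U2 R))
  (S2_char : forall theta : R, char_fun S2 theta = (charS2 theta)%:C)
  (X_law : same_law P P' X (fun w => S2 w / 2))
  (X_pdf : has_pdf X (@pdf_sinh R))
  (XU1 : independent_RV X U1) (XU2 : independent_RV X U2).

Notation rhsE := (rhsE U1 U2 X).
Notation m1 := measurable_pdf_U1.
Notation m2 := measurable_pdf_U2.

Lemma rhsE_analytic a s : 1 <= a -> 1 < a \/ complex.Re s < 2 ->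
  analytic_at (rhsE a) s.
Proof.
move=> a1 as2; apply: analyticD; apply: analyticZ.
  exact: (expect_pow_analytic U2_pdf m2 pdf_U2_02 pdf_U2_out X_pdf XU2 a1 as2).
exact: (expect_pow_analytic U1_pdf m1 pdf_U1_02 pdf_U1_out X_pdf XU1 a1 as2).
Qed.

(** Both sides are analytic on the half-plane or plane considered and agree at the
    real points of ]1, 2[, which accumulate at 3/2. *)
Lemma rhsE_difference a s : 1 <= a -> 1 < a \/ complex.Re s < 2 ->
  rhsE a s - rhsE (a + 1) s = (s - 1) * cpow a%:C (- s).
Proof.
move=> a1 as2; have a0 : 0 < a by lra.
pose h s := (rhsE a s - rhsE (a + 1) s) - (s - 1) * cpow a%:C (- s).
suff : h s = 0 by move/eqP; rewrite subr_eq0 => /eqP.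
pose z : R[i] := (3 / 2)%:C.
rewrite -[s](subrKC z); apply: analytic_segment => [t t01|e e0].
  have ast : 1 < a \/ complex.Re (z + t%:C * (s - z)) < 2.
    case: as2 => [|s2]; [by left|right].
    have /andP[t0 t1] := t01; rewrite Re_add Re_mul Re_sub/=.
    have [->|tn1] := eqVneq t 1; first by lra.
    have t1' : t < 1 by rewrite lt_neqAle tn1.
    have s2' : 0 <= 2 - complex.Re s by lra.
    by have := mulr_ge0 t0 s2'; lra.
  apply: analyticB.
    apply: analyticB; first exact: rhsE_analytic.
    by apply: rhsE_analytic; [lra|left; lra].
  by apply: analytic_mul_lin; exact: analytic_cpow_real.
(* keeps [3/2 + q] below 2 *)
pose q := Num.min (e / 2) (1 / 4).
have q0 : 0 < q by rewrite lt_min; apply/andP; split; lra.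
have qe : q <= e / 2 by rewrite ge_min lexx.
have q4 : q <= 1 / 4 by rewrite ge_min lexx orbT.
exists q%:C; first by rewrite cabs_real gtr0_norm//; lra.
have -> : z + q%:C = ((2^-1 + q) + 1)%:C.
  by rewrite -rmorphD; congr (_%:C); lra.
rewrite /h (rhsE_difference_real U1_pdf U2_pdf S2_char X_law X_pdf XU1 XU2 a1); last by lra.
by move: (2^-1 + q) => y; rewrite rmorphD/= rmorph1 addrK subrr.
Qed.

(** The factor [a - 1] in front of the second expectation costs one power of
    [a - 1], which is why [1 < Re s] is needed for the bound to tend to 0. *)
Lemma rhsE_bound a s : 2 <= a -> 1 < complex.Re s ->
  cabs (rhsE a s) <= 4 * expR (`|complex.Im s| * pi) *
    expR ((1 - complex.Re s) * ln (a - 1)).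
Proof.
move=> a2 s1; have a1 : 1 < a by lra.
have s0 : 0 <= complex.Re s by lra.
have a10 : 0 < a - 1 by lra.
have aux (K E u v : R) : 0 <= K -> 0 <= E -> v <= 2 * K * E -> u <= 2 * K * E ->
    2^-1 * u + (a - 1) * v <= 4 * K * ((a - 1) * E).
  move=> K0 E0 vK uK; have KE := mulr_ge0 K0 E0.
  by have := ler_wpM2l (ltW a10) vK; have := ler_wpM2r KE a2; lra.
have b1 := @expect_pow_bound _ _ _ P X U1 a s a1 s0.
have b2 := @expect_pow_bound _ _ _ P X U2 a s a1 s0.
have half (w : R[i]) : cabs (2^-1 * w) <= 2^-1 * cabs w.
  rewrite cabsM; have -> // : cabs (2^-1 : R[i]) = 2^-1.
  by rewrite cabsV -[2]/(2%:R) cabs_natr.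
have scal (k : R) (w : R[i]) : 0 < k -> cabs (k%:C * w) <= k * cabs w.
  by move=> k0; rewrite cabsM cabs_real gtr0_norm.
have h2 := half (expect_pow X U2 a s).
have h1 := scal _ (expect_pow X U1 a s) a10.
apply: (le_trans (cabsD _ _)); apply: (le_trans (lerD h2 h1)) => {h1 h2}.
have -> : (1 - complex.Re s) * ln (a - 1) = ln (a - 1) + - complex.Re s * ln (a - 1).
  by rewrite mulrBl mul1r mulNr.
rewrite expRD lnK ?posrE//.
exact: (aux _ _ _ _ (expR_ge0 _) (expR_ge0 _) b1 b2).
Qed.

Lemma rhsE_cvg0 a s : 1 <= a -> 1 < complex.Re s ->
  cabs (rhsE (a + N%:R) s) @[N --> \oo] --> (0 : R).
Proof.
move=> a1 s1; set K := 4 * expR (`|complex.Im s| * pi).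
have K0 : 0 < K by rewrite mulr_gt0 ?expR_gt0.
apply/cvgrPdist_lt => e e0.
pose c := complex.Re s - 1; have c0 : 0 < c by rewrite subr_gt0.
(* the solution of [K B^-c = e] *)
pose B := expR (- ln (e / K) / c).
near=> N.
have N1 : (1 : R) <= N%:R by near: N; exact: nbhs_infty_ger.
have NB : B < N%:R by near: N; exact: nbhs_infty_gtr.
rewrite sub0r normrN ger0_norm ?cabs_ge0//.
apply: (le_lt_trans (@rhsE_bound (a + N%:R) s _ s1)); first by lra.
rewrite -/K mulrC -ltr_pdivlMr// -[ltRHS]lnK ?posrE ?divr_gt0// ltr_expR.
have a10 : 0 < a + N%:R - 1 by lra.
have : ln B < ln (a + N%:R - 1) by rewrite ltr_ln ?posrE ?expR_gt0//; lra.
rewrite /B expRK ltr_pdivrMr// /c; lra.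
Unshelve. all: by end_near.
Qed.

(** The entire extension of [rhsE a]: by the difference equation it equals [rhsE a],
    and [a + 1 > 1] removes every restriction on [s]. *)
Definition rhs_entire (a : R) (s : R[i]) : R[i] :=
  (s - 1) * cpow a%:C (- s) + rhsE (a + 1) s.

Lemma rhs_entire_analytic a s : 1 <= a -> analytic_at (rhs_entire a) s.
Proof.
move=> a1; apply: analyticD.
  by apply: analytic_mul_lin; apply: analytic_cpow_real; lra.
by apply: rhsE_analytic; [lra|left; lra].
Qed.

Lemma rhs_entireE a s : 1 <= a -> 1 < a \/ complex.Re s < 2 -> rhs_entire a s = rhsE a s.
Proof. by move=> a1 as2; rewrite /rhs_entire -rhsE_difference// subrK. Qed.

Lemma rhs_entire_telescope a s N : 1 <= a ->
  rhs_entire a s = (s - 1) * (\sum_(0 <= n < N.+1) cpow (n%:R + a)%:C (- s)) +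
           rhsE (a + N.+1%:R) s.
Proof.
move=> a1.
have step (k x y u v : R[i]) : u - v = k * y -> k * x + u = k * (x + y) + v.
  by move=> uv; rewrite mulrDr -uv addrA addrNK.
have aN n : 1 <= a + n%:R by rewrite (le_trans a1)// lerDl.
have aN' n : 1 < a + n.+1%:R by rewrite (le_lt_trans a1)// ltrDl ltr0n.
have e n : a + n.+1%:R = a + n%:R + 1 by rewrite -addrA natr1.
elim: N => [|N IH]; first by rewrite big_nat1 (add0r a).
rewrite (big_nat_recr _ _ _ (leq0n _)) (e N.+1) (addrC N.+1%:R a).
apply: (etrans IH); apply: step.
exact: (rhsE_difference (aN _) (or_introl (aN' _))).
Qed.

Lemma neq1_Re (s : R[i]) : 1 < complex.Re s -> s != 1.
Proof. by apply: contraTneq => ->; rewrite ltxx. Qed.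

Lemma hurwitz_seriesE a s : 1 <= a -> 1 < complex.Re s ->
  hurwitz_series a s = rhs_entire a s / (s - 1).
Proof.
move=> a1 s1; have s10 : s - 1 != 0 by rewrite subr_eq0 neq1_Re.
apply: (@cvg_lim (Cplx R)); first exact: norm_hausdorff.
apply/Cplx_cvgP.
(* partial sums with at least one term, as in the telescoped identity *)
rewrite -(cvg_shiftS (fun n => cabs (series (fun n => cpow (n%:R + a)%:C (- s) : Cplx R) n -
   rhs_entire a s / (s - 1)))).
have e N : cabs (series (fun n => cpow (n%:R + a)%:C (- s) : Cplx R) N.+1 -
    rhs_entire a s / (s - 1)) = (cabs (s - 1))^-1 * cabs (rhsE (a + N.+1%:R) s).
  rewrite -cabsV -cabsM -cabsN (rhs_entire_telescope s N a1) /series/=; congr cabs.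
  by field.
rewrite /= (funext e).
have r0 := rhsE_cvg0 a1 s1.
rewrite -(cvg_shiftS (fun N => cabs (rhsE (a + N%:R) s))) in r0.
suff : (cabs (s - 1))^-1 * cabs (rhsE (a + N.+1%:R) s) @[N --> \oo] -->
    (cabs (s - 1))^-1 * 0 by rewrite mulr0.
by apply: cvgM; [exact: cvg_cst|exact: r0].
Qed.

(** The quotient of the entire function by [s - 1] is an analytic continuation, so
    the choice defining [hurwitz_zeta] is made among existing ones. *)
Lemma hurwitz_zeta_spec (a : R) : 1 <= a -> analytic_continuation
  [set s | s != 1] [set s | 1 < complex.Re s] (hurwitz_series a) (hurwitz_zeta a).
Proof.
move=> a1; rewrite /hurwitz_zeta.
apply: (@xgetPex _ (fun=> 0) [set f | analytic_continuation
    [set s : R[i] | s != 1] [set s : R[i] | 1 < complex.Re s] (hurwitz_series a) f]).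
exists (fun s => rhs_entire a s / (s - 1)); split => [s s1|s s1].
  by apply: analytic_div_lin => //; exact: rhs_entire_analytic.
by rewrite hurwitz_seriesE.
Qed.

(** Uniqueness of the continuation: the difference of the two sides vanishes for
    [1 < Re s], and a segment starting there and avoiding 1 leads to any other
    point. *)
Lemma hurwitz_zeta_rhs_entire (a : R) s : 1 <= a -> s != 1 ->
  (s - 1) * hurwitz_zeta a s = rhs_entire a s.
Proof.
move=> a1 s1; have [ana eqs] := hurwitz_zeta_spec a1.
pose h s := (s - 1) * hurwitz_zeta a s - rhs_entire a s.
have h0 z : 1 < complex.Re z -> h z = 0.
  move=> z1; rewrite /h (eqs z z1) hurwitz_seriesE// mulrCA mulfV ?mulr1 ?subrr//.
  by rewrite subr_eq0 neq1_Re.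
suff : h s = 0 by move/eqP; rewrite subr_eq0 => /eqP.
(* the segment to [s] has constant nonzero imaginary part, or an imaginary part
   that vanishes at its end [s] only *)
pose w : R[i] := 2 +i* (if complex.Im s == 0 then 1 else complex.Im s).
rewrite -[s](subrKC w); apply: analytic_segment => [t t01|e e0].
  apply: analyticB; last exact: rhs_entire_analytic.
  apply: analytic_mul_lin; apply: ana => /=; apply: contra_neq s1 => e.
  have := congr1 (@complex.Im R) e; have := congr1 (@complex.Re R) e.
  rewrite Re_add Im_add Re_mul Im_mul Re_sub Im_sub/=.
  case: eqVneq => [s0 eR eI|s0 _ eI]; last first.
    by exfalso; move/eqP: s0; apply; lra.
  have t1 : t = 1 by rewrite s0 in eI; lra.
  apply: complex_eqE => //=; rewrite t1 in eR; lra.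
exists (e / 2)%:C; first by rewrite cabs_real gtr0_norm; lra.
by apply: h0; rewrite Re_add/=; lra.
Qed.

Lemma hurwitz_zeta_cvg1 (a : R) : 1 <= a ->
  ((s - 1) * hurwitz_zeta a s : Cplx R) @[s --> (1 : Cplx R)^'] --> (rhs_entire a 1 : Cplx R).
Proof.
move=> a1.
apply: (@cvg_trans _ ((rhs_entire a s : Cplx R) @[s --> (1 : Cplx R)^'])).
  apply: near_eq_cvg; rewrite /dnbhs near_withinE.
  by apply: filterE => s s1; rewrite hurwitz_zeta_rhs_entire.
apply: cvg_within_filter.
exact: (analytic_continuous (rhs_entire_analytic 1 a1)).
Qed.

End continuation.

(** * The integral representation *)

Theorem theorem2p2 (R : realType)
    (d : measure_display) (T : measurableType d) (P : probability T R)
    (d' : measure_display) (T' : measurableType d') (P' : probability T' R)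
    (U1 U2 X : {RV P >-> R}) (S2 : {RV P' >-> R})
    (U1_pdf : has_pdf U1 (@pdf_U1 R))
    (U2_pdf : has_pdf U2 (@pdf_U2 R))
    (S2_char : forall theta : R, char_fun S2 theta = (charS2 theta)%:C)
    (X_law : same_law P P' X (fun w => S2 w / 2))
    (X_pdf : has_pdf X (@pdf_sinh R))
    (X_U1_indep : independent_RV X U1)
    (X_U2_indep : independent_RV X U2) :
  (forall a : R, 1 <= a ->
    let Z1 s w := cpow ((a - 1 + U1 w) +i* X w) (- s) in
    let Z2 s w := cpow ((a - 1 + U2 w) +i* X w) (- s) in
    let rhs (s : R[i]) := 2^-1 * cexpectation P (Z2 s)
                          + (a - 1)%:C * cexpectation P (Z1 s) in
    (* region of absolute convergence: everything if a > 1, Re s < 2 if a = 1 *)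
    let dom := [set s : R[i] | 1 < a \/ complex.Re s < 2] in
    (forall s, dom s -> cintegrable P (Z1 s) /\ cintegrable P (Z2 s)) /\
    exists G : R[i] -> R[i],
      [/\ analytic_continuation setT dom rhs G,
          forall s : R[i], s != 1 -> (s - 1) * hurwitz_zeta a s = G s &
          ((s - 1) * hurwitz_zeta a s : Cplx R) @[s --> (1 : Cplx R)^']
            --> (G 1 : Cplx R)])
  /\
  (let Z s w := cpow (U2 w +i* X w) (- s) in
   let rhs (s : R[i]) := 2^-1 * cexpectation P (Z s) in
   let dom := [set s : R[i] | complex.Re s < 2] in
   (forall s, dom s -> cintegrable P (Z s)) /\
   exists G : R[i] -> R[i],
     [/\ analytic_continuation setT dom rhs G,
         forall s : R[i], s != 1 -> (s - 1) * riemann_zeta s = G s &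
         ((s - 1) * riemann_zeta s : Cplx R) @[s --> (1 : Cplx R)^']
           --> (G 1 : Cplx R)]).
Proof.
have m1 := @measurable_pdf_U1 R; have m2 := @measurable_pdf_U2 R.
have l1 a s := @expect_powE _ T R P X U1 _ U1_pdf m1 (@pdf_U1_02 R) (@pdf_U1_out R)
  X_pdf X_U1_indep a s.
have l2 a s := @expect_powE _ T R P X U2 _ U2_pdf m2 (@pdf_U2_02 R) (@pdf_U2_out R)
  X_pdf X_U2_indep a s.
have main (a : R) : 1 <= a ->
    [/\ forall s : R[i], analytic_at (rhs_entire U1 U2 X a) s,
        forall s : R[i], 1 < a \/ complex.Re s < 2 -> rhs_entire U1 U2 X a s = rhsE U1 U2 X a s,
        forall s : R[i], s != 1 -> (s - 1) * hurwitz_zeta a s = rhs_entire U1 U2 X a s &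
        ((s - 1) * hurwitz_zeta a s : Cplx R) @[s --> (1 : Cplx R)^']
          --> (rhs_entire U1 U2 X a 1 : Cplx R)].
  move=> a1; split.
  - by move=> s; exact: (rhs_entire_analytic U1_pdf U2_pdf X_pdf X_U1_indep X_U2_indep).
  - by move=> s; exact: (rhs_entireE U1_pdf U2_pdf S2_char X_law X_pdf X_U1_indep X_U2_indep).
  - by move=> s; exact: (hurwitz_zeta_rhs_entire U1_pdf U2_pdf S2_char X_law X_pdf
      X_U1_indep X_U2_indep).
  - exact: (hurwitz_zeta_cvg1 U1_pdf U2_pdf S2_char X_law X_pdf X_U1_indep X_U2_indep).
split.
  move=> a a1 Z1 Z2 rhs dom; have [ana eqR eqz lim1] := main a a1; split.
    by move=> s ds; split; [exact: (proj1 (l1 a s a1 ds))|exact: (proj1 (l2 a s a1 ds))].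
  exists (rhs_entire U1 U2 X a); split => //; split => // s ds; rewrite eqR// /rhsE /rhs.
  by rewrite (proj2 (l1 a s a1 ds)) (proj2 (l2 a s a1 ds)).
move=> Z rhs dom; have [ana eqR eqz lim1] := main 1 (lexx 1).
have Z2E s : Z s = (fun w => cpow ((1 - 1 + U2 w) +i* X w) (- s)).
  by apply/funext => w; rewrite /Z subrr add0r.
split.
  by move=> s ds; rewrite Z2E; exact: (proj1 (l2 1 s (lexx 1) (or_intror ds))).
exists (rhs_entire U1 U2 X 1); split => //; split => // s ds.
rewrite eqR; last by right.
by rewrite /rhsE /rhs Z2E (proj2 (l2 1 s (lexx 1) (or_intror ds))) subrr mul0r addr0.
Qed.
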